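(* Let $X, X_1, X_2, \ldots$ be i.i.d. $\mathbb{R}^d$-valued random variables ($d\ge 1$) whose common distribution has a Lebesgue density $f$. Assume that the kernel $K$ satisfies conditions (K.i), (K.ii), (K.iii), (K.iv) listed in the context and that $f$ is bounded. Then for any $c>0$, with probability 1, $$\limsup_{n \to \infty}\ \sup_{c \log n/n \leq h \leq 1} \frac{\sqrt{nh}\, \|\widehat{f}_{n,h} - \mathbb{E}\widehat{f}_{n,h}\|_\infty}{\sqrt{\log(1/h) \vee \log\log n}} =: K(c) < \infty .$$
   Context: A kernel is a measurable function $K:\mathbb{R}^d\to\mathbb{R}$. For bandwidth $h>0$ the kernel density estimator is $$\widehat{f}_{n,h}(x) = (nh)^{-1}\sum_{i=1}^n K\big((x-X_i)/h^{1/d}\big),\qquad x\in\mathbb{R}^d,$$ $\|\psi\|_\infty=\sup_{x\in\mathbb{R}^d}|\psi(x)|$, and $a\vee b=\max(a,b)$. Conditions on $K$: (K.i) $\int_{\mathbb{R}^d}K(s)\,ds=1$. (K.ii) $\|K\|_\infty=\sup_{x\in\mathbb{R}^d}|K(x)|=\kappa<\infty$. Let $\mathcal{K}=\{K((x-\cdot)/h^{1/d}): h>0,\ x\in\mathbb{R}^d\}$. For $\varepsilon>0$ let $N(\varepsilon,\mathcal{K})=\sup_Q N(\kappa\varepsilon,\mathcal{K},d_Q)$, the supremum being over all probability measures $Q$ on the Borel sets of $\mathbb{R}^d$, where $d_Q$ is the $L_2(Q)$-metric and $N(\delta,\mathcal{K},d_Q)$ is the minimal number of balls $\{g: d_Q(g,g')<\delta\}$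 of $d_Q$-radius $\delta$ needed to cover $\mathcal{K}$. (K.iii) For some $C>0$ and $\nu>0$, $N(\varepsilon,\mathcal{K})\le C\varepsilon^{-\nu}$ for all $0<\varepsilon<1$. (K.iv) $\mathcal{K}$ is a pointwise measurable class: there is a countable subclass $\mathcal{K}_0\subset\mathcal{K}$ such that for every $g\in\mathcal{K}$ there is a sequence $\{g_m\}$ in $\mathcal{K}_0$ with $g_m(z)\to g(z)$ for all $z\in\mathbb{R}^d$. *)

(* Defs.v *)
From HB Require Import structures.
From mathcomp Require Import all_boot all_order all_algebra.
From mathcomp Require Import all_classical all_reals all_analysis.
Import Order.TTheory GRing.Theory Num.Theory.
Import numFieldNormedType.Exports.

Set Implicit Arguments.
Unset Strict Implicit.
Unset Printing Implicit Defensive.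

Local Open Scope classical_set_scope.
Local Open Scope ring_scope.

(* R^d; the library's product sigma-algebra on tuples over the Borel sets of R
   is the Borel sigma-algebra of R^d. *)
Notation euclid R d := (d.-tuple (measurableTypeR R)).

Definition tcons (R : realType) (d : nat)
    (p : measurableTypeR R * euclid R d) : euclid R d.+1 :=
  [the d.+1.-tuple _ of p.1 :: p.2].

Fixpoint lebesgue_euclid (R : realType) (d : nat) : set (euclid R d) -> \bar R :=
  match d with
  | 0%N => \d_([tuple] : euclid R 0)
  | d'.+1 => pushforward (@lebesgue_measure R \x @lebesgue_euclid R d')%E
               (@tcons R d')
  end.

Lemma measurable_tcons (R : realType) (d : nat) :
  measurable_fun setT (@tcons R d).
Proof. exact: measurable_cons. Qed.

Section lebesgue_euclid_step.
Context (R : realType) (d : nat).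
Variable m : {sigma_finite_measure set (euclid R d) -> \bar R}.

Let step := pushforward (@lebesgue_measure R \x m)%E (@tcons R d).

Let step0 : step set0 = 0%E.
Proof. by rewrite /step /pushforward preimage_set0 measure0. Qed.

Let step_ge0 A : (0 <= step A)%E.
Proof. by rewrite /step /pushforward; exact: measure_ge0. Qed.

Let step_sigma_additive : semi_sigma_additive step.
Proof.
move=> F mF tF mUF; rewrite /step /pushforward preimage_bigcup.
apply: measure_semi_sigma_additive.
- by move=> n; rewrite -[X in measurable X]setTI; exact: measurable_tcons.
- apply/trivIsetP => i j _ _ ij; rewrite -preimage_setI.
  by move/trivIsetP : tF => /(_ _ _ _ _ ij) ->//; rewrite preimage_set0.
- by rewrite -preimage_bigcup -[X in measurable X]setTI;
    exact: measurable_tcons.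
Qed.

HB.instance Definition _ := isMeasure.Build _ _ _ step
  step0 step_ge0 step_sigma_additive.

Let step_sigma_finite : sigma_finite setT step.
Proof.
have /sigma_finiteP[F [TF ndF Foo]] := sigma_finiteT (@lebesgue_measure R).
have /sigma_finiteP[G [TG ndG Goo]] := sigma_finiteT m.
pose uncons (t : euclid R d.+1) : measurableTypeR R * euclid R d :=
  (thead t, [tuple of behead t]).
have muncons : measurable_fun setT uncons.
  apply: measurable_fun_pair; first exact: measurable_tnth.
  exact: measurable_behead.
have tconsK : cancel (@tcons R d) uncons.
  by move=> [x t]; congr pair; apply/val_inj.
exists (fun k => uncons @^-1` (F k `*` G k)).
  rewrite -preimage_bigcup (_ : \bigcup_k _ = setT) ?preimage_setT//.
  apply/seteqP; split=> // -[x t] _.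
  have [n _ Fnx] : (\bigcup_k F k) x by rewrite -TF.
  have [k _ Gkt] : (\bigcup_k G k) t by rewrite -TG.
  exists (maxn n k) => //; split.
  - by move: x Fnx; exact/subsetPset/ndF/leq_maxl.
  - by move: t Gkt; exact/subsetPset/ndG/leq_maxr.
move=> k; have [mFk Fkoo] := Foo k; have [mGk Gkoo] := Goo k; split.
  by rewrite -[X in measurable X]setTI; apply: muncons => //;
    exact: measurableX.
rewrite /step /pushforward (_ : _ @^-1` _ = F k `*` G k).
  by rewrite product_measure1E// lte_mul_pinfty// ge0_fin_numE.
by apply/funext => p; rewrite -[LHS]/((F k `*` G k) (uncons (tcons p))) tconsK.
Qed.

HB.instance Definition _ := Measure_isSigmaFinite.Build _ _ _ step
  step_sigma_finite.

Definition lebesgue_euclid_step :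
  {sigma_finite_measure set (euclid R d.+1) -> \bar R} := step.

End lebesgue_euclid_step.

Fixpoint lebesgue_euclid_pack (R : realType) (d : nat) :
    {sigma_finite_measure set (euclid R d) -> \bar R} :=
  match d with
  | 0%N => \d_([tuple] : euclid R 0)
  | d'.+1 => lebesgue_euclid_step (lebesgue_euclid_pack R d')
  end.

Lemma lebesgue_euclid_packE (R : realType) (d : nat) :
  @lebesgue_euclid R d = lebesgue_euclid_pack R d.
Proof. by elim: d => [|d IHd] //=; rewrite IHd. Qed.

Section lebesgue_euclid_measure.
Context (R : realType) (d : nat).

Let leb0 : @lebesgue_euclid R d set0 = 0%E.
Proof. by rewrite lebesgue_euclid_packE measure0. Qed.

Let leb_ge0 A : (0 <= @lebesgue_euclid R d A)%E.
Proof. by rewrite lebesgue_euclid_packE measure_ge0. Qed.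

Let leb_sigma_additive : semi_sigma_additive (@lebesgue_euclid R d).
Proof.
by rewrite lebesgue_euclid_packE; exact: measure_semi_sigma_additive.
Qed.

HB.instance Definition _ := isMeasure.Build _ _ _ (@lebesgue_euclid R d)
  leb0 leb_ge0 leb_sigma_additive.

Let leb_sigma_finite : sigma_finite setT (@lebesgue_euclid R d).
Proof. by rewrite lebesgue_euclid_packE; exact: sigma_finiteT. Qed.

HB.instance Definition _ := Measure_isSigmaFinite.Build _ _ _
  (@lebesgue_euclid R d) leb_sigma_finite.

End lebesgue_euclid_measure.

Lemma lebesgue_euclid_box (R : realType) (d : nat)
    (A : 'I_d -> set (measurableTypeR R)) :
  (forall i, measurable (A i)) ->
  lebesgue_euclid [set x : euclid R d | forall i, A i (tnth x i)] =
  (\prod_(i < d) lebesgue_measure (A i))%E.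
Proof.
elim: d A => [|d IHd] A mA.
  by rewrite big_ord0 /= diracE mem_set// => -[].
rewrite big_ord_recl -IHd//= /pushforward -product_measure1E//; last first.
  rewrite [X in measurable X](_ : _ = \bigcap_(i : 'I_d)
      ((fun x : euclid R d => tnth x i) @^-1` A (lift ord0 i))).
    apply: fin_bigcap_measurable; first exact: finite_finset.
    move=> i _; rewrite -[X in measurable X]setTI.
    exact: measurable_tnth.
  by apply/seteqP; split=> x /= xA i; [move=> _|]; exact: xA.
congr ((_ \x _)%E _); apply/seteqP; split=> -[x t] /=.
  by move=> At; split=> [|i]; [exact: (At ord0)|
    have := At (lift ord0 i); rewrite tnthS].
by move=> [Ax At] i; case: (unliftP ord0 i) => [j|] ->; rewrite ?tnthS.
Qed.

Section iid.
Context d d' (T : measurableType d) (T' : measurableType d') (R : realType).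
Variable P : probability T R.

Definition mutually_independent (X : nat -> {RV P >-> T'}) :=
  forall (s : seq nat) (A : nat -> set T'), uniq s ->
    (forall i, i \in s -> measurable (A i)) ->
    P (\bigcap_(i in [set` s]) (X i @^-1` A i)) =
    (\prod_(i <- s) P (X i @^-1` A i))%E.

Definition identically_distributed (X : nat -> {RV P >-> T'}) :=
  forall i j (A : set T'), measurable A ->
    distribution P (X i) A = distribution P (X j) A.

End iid.

Section kernel_estimation.
Context (R : realType) (d : nat).
Implicit Types (f g K : euclid R d -> R) (F : set (euclid R d -> R)).
Implicit Types (x y z : euclid R d) (h kappa : R).

Definition has_lebesgue_density (mu : set (euclid R d) -> \bar R) f :=
  [/\ measurable_fun setT f, (forall x, 0 <= f x) &
    forall A, measurable A ->
      mu A = (\int[@lebesgue_euclid R d]_(x in A) (f x)%:E)%E].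

Definition supnorm (psi : euclid R d -> \bar R) : \bar R :=
  ereal_sup [set `|psi x|%E | x in setT].

Definition rescale h x y : euclid R d :=
  [tuple (tnth x i - tnth y i) / h `^ (d%:R^-1) | i < d].

Definition kde K (s : nat -> euclid R d) (n : nat) h x : R :=
  (n%:R * h)^-1 * \sum_(i < n) K (rescale h x (s i)).

Definition kernel_class K : set (euclid R d -> R) :=
  [set g | exists h x, 0 < h /\ g = (fun y => K (rescale h x y))].

Definition L2dist (Q : probability (euclid R d) R) g g' : \bar R :=
  'N[Q]_2%:E[EFin \o (g \- g')%R]%E.

(* The centres range over all of L_2(Q), not only over the covered class; the
   value is +oo if there is no finite cover. *)
Definition covering_number (Q : probability (euclid R d) R) (delta : R) F :
    \bar R :=
  ereal_inf [set (m%:R)%:E | m in [set m : nat |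
    exists c : 'I_m -> euclid R d -> R,
      (forall i, c i \in Lfun Q 2%:E) /\
      forall g, F g -> exists i, (L2dist Q g (c i) < delta%:E)%E]].

Definition uniform_covering_number (delta : R) F : \bar R :=
  ereal_sup [set covering_number Q delta F | Q in setT].

Definition uniform_entropy_condition K kappa :=
  exists C nu : R, [/\ 0 < C, 0 < nu & forall eps : R, 0 < eps < 1 ->
    (uniform_covering_number (kappa * eps) (kernel_class K) <=
      (C * eps `^ (- nu))%:E)%E].

Definition pointwise_measurable_class F :=
  exists F0 : set (euclid R d -> R), [/\ countable F0, F0 `<=` F &
    forall g, F g -> exists u : nat -> euclid R d -> R,
      (forall m, F0 (u m)) /\ forall z, (fun m => u m z) @ \oo --> g z].

Section deviation.
Context d' (Omega : measurableType d') (P : probability Omega R).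
Variable X : nat -> {RV P >-> euclid R d}.

(* The observations X_1, X_2, ... are X 0, X 1, ... *)
Definition kde_rv K (n : nat) h x (w : Omega) : R :=
  kde K (fun i => X i w) n h x.

Definition normalized_deviation K (n : nat) h (w : Omega) : \bar R :=
  ((Num.sqrt (n%:R * h))%:E *
    supnorm (fun x => (kde_rv K n h x w)%:E - 'E_P[kde_rv K n h x]) *
    ((Num.sqrt (Num.max (ln h^-1) (ln (ln n%:R))))^-1)%:E)%E.

(* Only large n matter for the limit superior: for n <= 2 the logarithms are
   degenerate, and the range of h is empty (value -oo) when c log n / n > 1. *)
Definition sup_deviation K (c : R) (n : nat) (w : Omega) : \bar R :=
  ereal_sup [set normalized_deviation K n h w | h in
    [set h : R | c * ln n%:R / n%:R <= h <= 1]].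

End deviation.
End kernel_estimation.

(* Main.v *)
Require Import Defs.
From HB Require Import structures.
From mathcomp Require Import all_boot all_order all_algebra.
From mathcomp Require Import all_classical all_reals all_analysis.
From mathcomp Require Import measurable_realfun ring lra.
Import Order.TTheory GRing.Theory Num.Theory.
Import numFieldNormedType.Exports.

Set Implicit Arguments.
Unset Strict Implicit.
Unset Printing Implicit Defensive.

Local Open Scope classical_set_scope.
Local Open Scope ring_scope.

(** Write [S n h x] for the sum over [i < n] of the centred kernels [K (rescale h x (X
    i)) - E K (rescale h x (X 0))]. Multiplied out, the theorem says that the limit
    superior of [|S n h x|] over the rate [sqrt (n h (ln h^-1 \/ ln ln n))], uniformly
    over the points and the admissible bandwidths, is almost surely a finite constant.

    Finiteness ([kernel_sum_bound]). Cut the sample sizes into blocks up to [N = 2 ^ k]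
    and the bandwidths into blocks around [h = 2 ^ - j], and put [L = ln h^-1 \/ ln ln N
    \/ 1]. In one block, [one_scale_tail] bounds by a multiple of [expR (- 3 L)] the
    probability that some sum exceeds a multiple of [sqrt (N h L)]; this is of order [k
    ^ -3], only [k + 1] bandwidth blocks are admissible, and the Borel-Cantelli lemma
    applies. The inequality comes from symmetrization: compare the sample with an
    independent ghost sample ([ghost_sample]) and average over the exchanges of an
    observation with its ghost, which preserve the joint law ([symmetrized_pr]). For
    fixed observations, the sum is then a walk with random signs, whose maximum is
    subgaussian ([rsum_max_tail]) with a variance proxy of the order of the sum of
    squares over the double sample, and polynomial covering numbers allow a chaining
    argument ([chaining_tail]). Two facts give the sharp variance [N h] in place of [N].
    A bounded density makes the second moment of a kernel of bandwidth [h] at most of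
    order [h] ([kernel_sq_integral]); and the empirical second moments are of the same
    order, since a large one would be out of balance with that of the ghost sample,
    which is again unlikely under random exchanges ([half_sample_tail]). Admissibility,
    [c ln n <= n h], enters here: it makes [N h] dominate the entropy [L]. Finally, the
    uncountable class is replaced by a countable one by pointwise measurability
    ([dominating_family]).

    Constancy. Whether the limit superior exceeds a level [q] does not depend on
    finitely many observations, since the rate tends to infinity uniformly
    ([level_event_shift]). Kolmogorov's zero-one law would make the event trivial,
    except that the supremum over the uncountable set of pairs [(h, x)], normalized by a
    rate that varies with [h], yields a projection of a measurable set. Such a
    projection is obtained by the Souslin operation ([projection_ae]), and sets so
    obtained from a sigma-algebra agree with members of it up to a null set
    ([souslin_ae]). This is enough for a zero-one law for events given up to null sets
    ([zero_one_law]). The least level that is almost surely not exceeded is then the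
    almost sure value of the limit superior. *)

(** * Random signs *)

Section rademacher.
Context (R : realType).
Implicit Types (a : nat -> R) (s : nat -> bool) (N m : nat).

(** For small [x] both exponentials are below geometric series, by
    [1 + y <= expR y] alone; for large [x] each is below [expR (2 x ^ 2)]. *)
Lemma cosh_le_expR (x : R) : (expR x + expR (- x)) / 2 <= expR (2 * x ^+ 2).
Proof.
have [xl|xg] := leP (x ^+ 2) (1 / 2).
  have hb (y : R) : y < 1 -> expR y <= (1 - y)^-1.
    move=> y1; rewrite -[y in expR y]opprK expRN lef_pV2 ?posrE ?expR_gt0//.
      exact: expR_ge1Dx.
    by rewrite subr_gt0.
  have x1 : x < 1 by nra.
  have x1' : - x < 1 by nra.
  have := hb _ x1; have := hb _ x1'.
  have -> : expR (2 * x ^+ 2) = (expR (- (2 * x ^+ 2)))^-1 by rewrite expRN invrK.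
  have H : expR (- (2 * x ^+ 2)) <= 1 - x ^+ 2.
    apply: (le_trans (y := (1 + 2 * x ^+ 2)^-1)).
      rewrite expRN lef_pV2 ?posrE ?expR_gt0//; first exact: expR_ge1Dx.
      by nra.
    rewrite -[leLHS]mul1r ler_pdivrMr; last by nra.
    by set y := x ^+ 2 in xl *; have : 0 <= y by [exact: sqr_ge0]; nra.
  move=> h1 h2; apply: (le_trans (y := (1 - x ^+ 2)^-1)); last first.
    by rewrite lef_pV2 ?posrE ?expR_gt0//; nra.
  have -> : (1 - x ^+ 2)^-1 = ((1 - x)^-1 + (1 - - x)^-1) / 2.
    by field; apply/and3P; split; apply/eqP; nra.
  lra.
have h (y : R) : y ^+ 2 = x ^+ 2 -> expR y <= expR (2 * x ^+ 2).
  by move=> yx; rewrite ler_expR; nra.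
have := h x erefl; have := h (- x) (sqrrN x); lra.
Qed.

Definition scons (b : bool) s : nat -> bool :=
  fun i => if i is j.+1 then s j else b.

(** The mean of [F] over the [2 ^ N] choices of the first [N] signs. Recursion on
    the first sign makes conditioning on the first step of a walk a computation. *)
Fixpoint sgavg N (F : (nat -> bool) -> R) : R :=
  if N is M.+1 then
    (sgavg M (fun s => F (scons true s)) + sgavg M (fun s => F (scons false s))) / 2
  else F (fun=> false).

Lemma sgavg_le N F G : (forall s, F s <= G s) -> sgavg N F <= sgavg N G.
Proof.
elim: N F G => [|N IH] F G FG; first exact: FG.
by rewrite /= ler_pM2r ?invr_gt0// lerD// IH.
Qed.

Lemma sgavg_cst N c : sgavg N (fun=> c) = c.
Proof. by elim: N => //= N ->; lra. Qed.

Lemma sgavgD N F G : sgavg N (fun s => F s + G s) = sgavg N F + sgavg N G.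
Proof. by elim: N F G => //= N IH F G; rewrite !IH; lra. Qed.

Definition freq N (A : set (nat -> bool)) : R := sgavg N (\1_A).

Lemma freq_sub N (A B : set (nat -> bool)) : A `<=` B -> freq N A <= freq N B.
Proof.
move=> AB; apply: sgavg_le => s; rewrite !indicE ler_nat.
by have [/set_mem/AB/mem_set ->//|] := boolP (s \in A).
Qed.

Lemma freq0 N : freq N set0 = 0.
Proof. by rewrite /freq indic0 sgavg_cst. Qed.

Lemma freq_le1 N A : freq N A <= 1.
Proof.
by rewrite -[leRHS](sgavg_cst N 1); apply: sgavg_le => s; rewrite indicE lern1 leq_b1.
Qed.

Lemma freq_setU N (A B : set (nat -> bool)) :
  freq N (A `|` B) <= freq N A + freq N B.
Proof.
rewrite /freq -sgavgD; apply: sgavg_le => s; rewrite !indicE -natrD ler_nat in_setU.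
by case: (s \in A); case: (s \in B).
Qed.

Lemma freq_has N (T : eqType) (l : seq T) (A : T -> set (nat -> bool)) b :
  (forall x, x \in l -> freq N (A x) <= b) ->
  freq N [set s | exists2 x, x \in l & A x s] <= (size l)%:R * b.
Proof.
elim: l => [|x l IH] Ab.
  by rewrite (_ : [set _ | _] = set0) ?freq0 ?mul0r//; apply/seteqP; split=> // s [].
apply: (@le_trans _ _ (freq N (A x `|` [set s | exists2 x, x \in l & A x s]))).
  apply: freq_sub => s [y]; rewrite inE => /predU1P[->|yl] As; first by left.
  by right; exists y.
apply: (le_trans (freq_setU _ _ _)).
rewrite /= -natr1 mulrDl mul1r addrC lerD//; last by apply: Ab; rewrite inE eqxx.
by apply: IH => y yl; apply: Ab; rewrite inE yl orbT.
Qed.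

Lemma freqS N A : freq N.+1 A =
  (freq N [set s | A (scons true s)] + freq N [set s | A (scons false s)]) / 2.
Proof. by []. Qed.

Definition rsum a s m : R := \sum_(i < m) (-1) ^+ s i * a i.

Lemma rsum_scons a b s m : rsum a (scons b s) m.+1 =
  (-1) ^+ b * a 0%N + rsum (fun i => a i.+1) s m.
Proof. by rewrite /rsum big_ord_recl. Qed.

Lemma rsum0 a s : rsum a s 0 = 0. Proof. by rewrite /rsum big_ord0. Qed.

(** Exponential maximal inequality for a signed walk started at [x]: the
    right-hand side is a supermartingale along the walk, so it may be stopped at
    the first passage above [u]. *)
Lemma rsum_max_exp N a x u lam : 0 <= lam ->
  freq N [set s | exists2 m, (m <= N)%N & u <= x + rsum a s m] <=
  expR (lam * (x - u) + 2 * lam ^+ 2 * \sum_(i < N) a i ^+ 2).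
Proof.
move=> lam0; elim: N a x => [|N IH] a x.
all: have [ux|xu] := leP u x.
1,3: apply: (le_trans (freq_le1 _ _)); rewrite -[leLHS]expR0 ler_expR addr_ge0//.
1,3: by apply: mulr_ge0; rewrite ?subr_ge0.
1,2: by rewrite mulr_ge0 ?sumr_ge0 ?mulr_ge0 ?sqr_ge0// => i _; exact: sqr_ge0.
  rewrite (_ : [set _ | _] = set0) ?freq0 ?expR_ge0//.
  apply/seteqP; split=> // s [m]; rewrite leqn0 => /eqP ->.
  by rewrite rsum0 addr0 leNgt xu.
have sub b : [set s | [set s | exists2 m, (m <= N.+1)%N & u <= x + rsum a s m]
      (scons b s)] `<=`
    [set s | exists2 m, (m <= N)%N &
      u <= (x + (-1) ^+ b * a 0%N) + rsum (fun i => a i.+1) s m].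
  move=> s [[|m] mN]; first by rewrite rsum0 addr0 leNgt xu.
  by rewrite rsum_scons addrA => ?; exists m.
rewrite freqS big_ord_recl.
have h b := le_trans (freq_sub N (sub b)) (IH _ _).
have ht := h true; have hf := h false.
rewrite ler_pdivrMr//; apply: (le_trans (lerD ht hf)).
set S := \sum_(i < N) _; rewrite expr1 expr0 !mul1r mulN1r.
have c := cosh_le_expR (lam * a 0%N).
have -> : lam * (x - a 0%N - u) + 2 * lam ^+ 2 * S =
  (lam * (x - u) + 2 * lam ^+ 2 * S) + - (lam * a 0%N) by ring.
have -> : lam * (x + a 0%N - u) + 2 * lam ^+ 2 * S =
  (lam * (x - u) + 2 * lam ^+ 2 * S) + lam * a 0%N by ring.
have -> : lam * (x - u) + 2 * lam ^+ 2 * (a (@ord0 N) ^+ 2 + S) =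
  (lam * (x - u) + 2 * lam ^+ 2 * S) + 2 * (lam * a 0%N) ^+ 2 by rewrite /=; ring.
rewrite !expRD -mulrDr -[leRHS]mulrA ler_wpM2l ?mulr_ge0 ?expR_ge0//.
by rewrite addrC -ler_pdivrMr.
Qed.

Lemma rsumN a s m : rsum (fun i => - a i) s m = - rsum a s m.
Proof. by rewrite /rsum -sumrN; apply: eq_bigr => i _; rewrite mulrN. Qed.

Lemma rsumD a b s m : rsum (fun i => a i + b i) s m = rsum a s m + rsum b s m.
Proof. by rewrite /rsum -big_split; apply: eq_bigr => i _; rewrite mulrDr. Qed.

Lemma rsum_le a s m : `|rsum a s m| <= \sum_(i < m) `|a i|.
Proof.
rewrite /rsum; apply: (le_trans (ler_norm_sum _ _ _)); apply: ler_sum => i _.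
by rewrite normrM normrX normrN1 expr1n mul1r.
Qed.

(** Hoeffding's inequality for the running maximum of a signed walk. *)
Lemma rsum_max_tail N a u V : 0 <= u -> 0 < V -> \sum_(i < N) a i ^+ 2 <= V ->
  freq N [set s | exists2 m, (m <= N)%N & u <= `|rsum a s m|] <=
  2 * expR (- (u ^+ 2 / (8 * V))).
Proof.
move=> u0 V0 aV.
have one (b : nat -> R) : \sum_(i < N) b i ^+ 2 <= V ->
    freq N [set s | exists2 m, (m <= N)%N & u <= 0 + rsum b s m] <=
    expR (- (u ^+ 2 / (8 * V))).
  move=> bV; have lam0 : 0 <= u / (4 * V) by apply: divr_ge0 => //; lra.
  apply: (le_trans (rsum_max_exp _ _ _ _ lam0)); rewrite ler_expR.
  apply: (@le_trans _ _ (u / (4 * V) * (0 - u) + 2 * (u / (4 * V)) ^+ 2 * V)).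
    by rewrite lerD2l ler_wpM2l// mulr_ge0// sqr_ge0.
  by rewrite le_eqVlt; apply/orP; left; apply/eqP; field; rewrite gt_eqF.
have oneN := one (fun i => - a i).
rewrite mulrDl mul1r; apply: le_trans (lerD (one _ aV) (oneN _)); last first.
  by rewrite (eq_bigr (fun i : 'I_N => a i ^+ 2))// => i _; rewrite sqrrN.
apply: le_trans (freq_setU _ _ _); apply: freq_sub => s [m mN].
rewrite ler_normr => /orP[|] h; [left|right]; exists m => //; rewrite add0r//.
by rewrite rsumN.
Qed.

End rademacher.

Arguments freq {R}.
Arguments freq_setU {R}.
Arguments freq_sub {R} N [A B].
Arguments freq_le1 {R}.

(** * Chaining under random signs *)

Section chaining.
Context (R : realType).
Implicit Types (v : nat -> R) (s : nat -> bool) (N m r : nat).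

(** A double sample is indexed by [0, ..., N + N - 1], the ghost of the index [i]
    being [N + i]. *)
Definition fold_diff N v : nat -> R := fun i => v i - v (N + i)%N.

Definition sqnorm N v : R := \sum_(i < N) (v i ^+ 2 + v (N + i)%N ^+ 2).

Lemma fold_diff_sq N v : \sum_(i < N) fold_diff N v i ^+ 2 <= 2 * sqnorm N v.
Proof.
rewrite /sqnorm mulr_sumr; apply: ler_sum => i _; rewrite /fold_diff.
have := sqr_ge0 (v i + v (N + i)%N); nra.
Qed.

Lemma rsum_norm_le N v s m V : (m <= N)%N -> 0 <= V ->
  \sum_(i < N) v i ^+ 2 <= V ^+ 2 -> `|rsum v s m| <= N%:R * V.
Proof.
move=> mN V0 vV; apply: (le_trans (rsum_le _ _ _)).
rewrite -[N in N%:R]card_ord -sum1_card natr_sum mulr_suml.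
rewrite (big_ord_widen N (fun i => `|v i|) mN) big_mkcond/=; apply: ler_sum => i _.
rewrite mul1r; case: ifP => // _; rewrite -ler_sqr ?nnegrE// real_normK ?num_real//.
by apply: le_trans vV; rewrite (bigD1 i)//= lerDl sumr_ge0// => j _; exact: sqr_ge0.
Qed.

Section chain.
Variables (v : nat -> nat -> R) (N : nat) (T : nat -> seq nat) (S L B C : R).
Hypotheses (S0 : 0 < S) (L1 : 1 <= L) (C0 : 0 <= C) (CB : C + 1 <= B).
Hypothesis v_bound : forall k, sqnorm N (v k) <= S.
Hypothesis T_size : forall r, (size (T r))%:R <= expR (C * L * r.+1%:R).
Hypothesis T_net : forall r k, exists2 j, j \in T r &
  sqnorm N (fun i => v k i - v j i) <= S / 16 ^+ r.

Let t := 16 * Num.sqrt (S * B * L).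
Let q := expR (- ((B - C) * L)).

Let near r k := sval (cid2 (T_net r k)).
Let near_in r k : near r k \in T r.
Proof. by rewrite /near; case: cid2. Qed.
Let near_le r k : sqnorm N (fun i => v k i - v (near r k) i) <= S / 16 ^+ r.
Proof. by rewrite /near; case: cid2. Qed.

Let link r k : nat -> R :=
  if r is r'.+1 then fun i => v k i - v (near r' k) i else v k.

Let bad r := [set s | exists2 k, k \in T r &
  exists2 m, (m <= N)%N & t / 2 ^+ r <= `|rsum (fold_diff N (link r k)) s m|].

Let SBL_gt0 : 0 < S * B * L.
Proof. by move: L1 C0 CB => L1' C0' CB'; rewrite !mulr_gt0//; lra. Qed.

Let t_sq : t ^+ 2 = 256 * (S * B * L).
Proof. by rewrite /t exprMn sqr_sqrtr ?ltW//; ring. Qed.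

Let t_gt0 : 0 < t. Proof. by rewrite /t mulr_gt0// sqrtr_gt0. Qed.

Let pow4 r : r.+1%:R <= 4 ^+ r :> R.
Proof.
by rewrite -natrX ler_nat; apply: (leq_trans (ltn_expl r (erefl : (1 < 4)%N))).
Qed.

Let bad_freq r : freq N (bad r) <= 2 * q ^+ r.+1.
Proof.
move: S0 L1 C0 CB => S0' L1' C0' CB'.
have BL : 0 <= B * L by rewrite mulr_ge0; lra.
pose V := 2 * (if r is r'.+1 then S / 16 ^+ r' else S).
have V0 : 0 < V by rewrite /V; case: (r) => [|r']; rewrite mulr_gt0 ?divr_gt0 ?exprn_gt0.
have link_le k : \sum_(i < N) fold_diff N (link r k) i ^+ 2 <= V.
  apply: (le_trans (fold_diff_sq _ _)); rewrite /V ler_pM2l// /link.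
  by case: (r) => [|r1] //; exact: near_le.
have expo : B * L * r.+1%:R <= (t / 2 ^+ r) ^+ 2 / (8 * V).
  have -> : (t / 2 ^+ r) ^+ 2 = 256 * (S * B * L) / 4 ^+ r.
    rewrite expr_div_n t_sq -exprM mulnC exprM.
    by have -> : (2 : R) ^+ 2 = 4 by ring.
  rewrite ler_pdivlMr; last by rewrite mulr_gt0.
  rewrite ler_pdivlMr//.
  have -> : B * L * r.+1%:R * (8 * V) * 4 ^+ r = (B * L) * (r.+1%:R * (8 * V) * 4 ^+ r)
    by ring.
  have -> : 256 * (S * B * L) = (B * L) * (256 * S) by ring.
  apply: ler_wpM2l => //; rewrite /V; case: (r) => [|r'].
    by rewrite expr0; lra.
  have -> : r'.+2%:R * (8 * (2 * (S / 16 ^+ r'))) * 4 ^+ r'.+1 =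
     (16 * S) * (r'.+2%:R * 4 ^+ r'.+1 / 16 ^+ r') by ring.
  have -> : 256 * S = (16 * S) * 16 by ring.
  rewrite ler_pM2l; last by rewrite mulr_gt0.
  rewrite ler_pdivrMr ?exprn_gt0// -exprS.
  have -> : (16 : R) ^+ r'.+1 = 4 ^+ r'.+1 * 4 ^+ r'.+1.
    by rewrite -exprMn; congr (_ ^+ _); ring.
  by rewrite ler_pM2r.
apply: (le_trans (freq_has (b := 2 * expR (- (B * L * r.+1%:R))) _)).
  move=> k kT; apply: (le_trans (rsum_max_tail _ V0 (link_le k))).
    by rewrite divr_ge0// ltW.
  by rewrite ler_pM2l// ler_expR lerN2.
apply: (le_trans (ler_wpM2r _ (T_size r))); first by rewrite mulr_ge0// expR_ge0.
rewrite mulrCA ler_pM2l// -expRD /q -expRM_natr ler_expR.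
by rewrite le_eqVlt; apply/orP; left; apply/eqP; ring.
Qed.

Let q_le : q <= 1 / 2.
Proof.
move: L1 CB => L1' CB'; rewrite /q expRN ler_pdivlMr// mulrC ler_pdivrMr ?expR_gt0// mul1r.
apply: le_trans (expR_ge1Dx _); suff : 1 <= (B - C) * L by lra.
nra.
Qed.

Let badU_freq J : freq N [set s | exists2 r, (r < J)%N & bad r s] <=
  4 * q * (1 - 2^-1 ^+ J).
Proof.
have q0 : 0 < q by exact: expR_gt0.
have ql := q_le.
elim: J => [|J IH].
  rewrite (_ : [set _ | _] = set0) ?freq0 ?expr0 ?subrr ?mulr0//.
  by apply/seteqP; split=> // s [r].
apply: (@le_trans _ _ (freq N ([set s | exists2 r, (r < J)%N & bad r s] `|` bad J))).
  apply: freq_sub => s [r]; rewrite ltnS leq_eqVlt => /predU1P[->|rJ] b.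
    by right.
  by left; exists r.
apply: (le_trans (freq_setU _ _ _)); apply: (le_trans (lerD IH (bad_freq J))).
have : q ^+ J <= 2^-1 ^+ J.
  by apply: lerXn2r; rewrite ?nnegrE ?invr_ge0 ?(ltW q0)// -[leRHS]div1r.
by rewrite !exprS; set x := q ^+ J; set y := _^-1 ^+ J => xy; nra.
Qed.

(** Every function is reached through its successive approximations in the nets
    [T 0], [T 1], ...; the link into [T r] has squared length [S / 16 ^ r], so
    thresholds decreasing like [2 ^- r] leave room in the Gaussian exponent to pay
    for the [expR (C L (r + 1))] links of level [r]. *)
Lemma chaining_tail :
  freq N [set s | exists k, exists2 m, (m <= N)%N &
    3 * t < `|rsum (fold_diff N (v k)) s m|] <= 4 * q.
Proof.
have q0 : 0 < q by exact: expR_gt0.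
move: S0 L1 C0 CB t_gt0 => S0' L1' C0' CB' t0.
apply: (@le_trans _ _ (freq N [set s | exists2 r, (r < N.+1)%N & bad r s])); last first.
  apply: (le_trans (badU_freq _)); rewrite ler_piMr//; last by rewrite mulr_ge0// ltW.
apply: freq_sub => s [k [m mN]]; apply: contraPP => nbad.
have nbadr r j m' : (r < N.+1)%N -> j \in T r -> (m' <= N)%N ->
    `|rsum (fold_diff N (link r j)) s m'| <= t / 2 ^+ r.
  move=> rN jT mN'; rewrite leNgt; apply/negP => h; apply: nbad.
  by exists r => //; exists j => //; exists m' => //; exact: ltW.
have decomp (u : nat -> R) (w : nat -> R) :
    rsum (fold_diff N u) s m =
    rsum (fold_diff N (fun i => u i - w i)) s m + rsum (fold_diff N w) s m.
  rewrite -rsumD /rsum; apply: eq_bigr => i _; congr (_ * _).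
  by rewrite /fold_diff; ring.
have chain r : (r < N.+1)%N -> forall j, j \in T r ->
    `|rsum (fold_diff N (v j)) s m| <= t * (2 - 2^-1 ^+ r).
  elim: r => [|r IH] rN j jT.
    by have := nbadr _ _ _ rN jT mN; rewrite expr0 divr1 /link; lra.
  rewrite (decomp _ (v (near r j))); apply: (le_trans (ler_normD _ _)).
  have h1 := nbadr _ _ _ rN jT mN; have h2 := IH (ltnW rN) _ (near_in r j).
  apply: (le_trans (lerD h1 h2)); rewrite -exprVn exprS.
  by set y := _^-1 ^+ r; lra.
apply/negP; rewrite -leNgt (decomp _ (v (near N k))).
apply: (le_trans (ler_normD _ _)).
have h2 := chain _ (ltnSn N) _ (near_in N k).
(* Below level [N] no probability is needed: the remainder has at most [N] terms of
   size [4 ^- N] relative to [t]. *)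
have h1 : `|rsum (fold_diff N (fun i => v k i - v (near N k) i)) s m| <= t.
  apply: (le_trans (rsum_norm_le (V := Num.sqrt (2 * S) / 4 ^+ N) _ mN _ _)).
  - by rewrite divr_ge0// sqrtr_ge0.
  - apply: (le_trans (fold_diff_sq _ _)).
    have S2 : 0 <= 2 * S by rewrite mulr_ge0// ltW.
    rewrite expr_div_n (sqr_sqrtr S2) -[leRHS]mulrA ler_pM2l//.
    apply: (le_trans (near_le N k)); rewrite -exprM mulnC exprM.
    by have -> : (4 : R) ^+ 2 = 16 by ring.
  rewrite mulrA ler_pdivrMr ?exprn_gt0// mulrC ler_pM ?sqrtr_ge0//.
    rewrite /t; apply: (@le_trans _ _ (1 * (16 * Num.sqrt (S * B * L)))); last by rewrite mul1r.
    have -> : 16 = Num.sqrt (256 : R).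
      by have -> : (256 : R) = 16 ^+ 2 by [ring|]; rewrite sqrtr_sqr ger0_norm.
    rewrite mul1r -sqrtrM// ler_sqrt; last by rewrite mulr_ge0// ltW.
    have : S * 1 <= S * (B * L) by rewrite ler_pM2l// mulr_ege1//; lra.
    by rewrite -mulrA; lra.
  by apply: le_trans (pow4 N); rewrite ler_nat.
have : 0 <= 2^-1 ^+ N :> R by rewrite exprn_ge0// invr_ge0.
by set y := _^-1 ^+ N in h2 *; move=> y0; have : 0 <= t * y by [rewrite mulr_ge0// ltW|]; lra.
Qed.

End chain.

(** The symmetries of a double sample: an observation and its ghost trade places
    wherever the sign is negative. *)
Definition fswap N s (i : nat) : nat :=
  (if i < N then (if s i then N + i else i)
   else if i < N + N then (if s (i - N) then i - N else i) else i)%N.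

Lemma fswap_lt N s (i : 'I_N) : fswap N s i = if s i then (N + i)%N else i.
Proof. by rewrite /fswap ltn_ord. Qed.

Lemma fswap_ge N s (i : 'I_N) : fswap N s (N + i) = if s i then (i : nat) else (N + i)%N.
Proof. by rewrite /fswap ltnNge leq_addr/= ltn_add2l ltn_ord addnC addnK. Qed.

Lemma fswapK N s : cancel (fswap N s) (fswap N s).
Proof.
move=> i; have [iN|Ni] := ltnP i N.
  have -> : i = Ordinal iN by []; rewrite fswap_lt.
  by case: ifP => si; rewrite ?fswap_ge ?fswap_lt ?si.
have [iN2|NNi] := ltnP i (N + N).
  have jN : (i - N < N)%N by rewrite ltn_subLR.
  have -> : i = (N + Ordinal jN)%N by rewrite /= subnKC.
  by rewrite fswap_ge; case: ifP => si; rewrite ?fswap_ge ?fswap_lt ?si.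
have E : fswap N s i = i by rewrite /fswap !ltnNge Ni NNi.
by rewrite !E.
Qed.

Lemma fold_diff_fswap N s v (i : 'I_N) :
  fold_diff N (v \o fswap N s) i = (-1) ^+ s i * fold_diff N v i.
Proof.
by rewrite /fold_diff /= fswap_lt fswap_ge; case: (s i); rewrite ?expr1 ?expr0; ring.
Qed.

Lemma sqnorm_fswap N s v : sqnorm N (v \o fswap N s) = sqnorm N v.
Proof.
by apply: eq_bigr => i _ /=; rewrite fswap_lt fswap_ge; case: (s i) => //; rewrite addrC.
Qed.

(** The two half-sample second moments have a fixed sum under the exchanges, and
    their difference is a signed sum whose variance is at most [kap ^ 2] times
    that same sum; so they are unlikely to be very different. The net [T] reduces
    the statement to finitely many functions. *)
Lemma half_sample_tail (v : nat -> nat -> R) N (T : seq nat) (kap Y : R) :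
  0 < kap -> 0 < Y ->
  (forall k i, `|v k i| <= kap) ->
  (forall k, exists2 j, j \in T & sqnorm N (fun i => v k i - v j i) <= Y) ->
  freq N [set s | exists k,
    34 * Y < \sum_(i < N) v k (fswap N s i) ^+ 2 /\
    \sum_(i < N) v k (fswap N s (N + i)) ^+ 2 <= Y] <=
  (size T)%:R * (2 * expR (- (Y / (2 * kap ^+ 2)))).
Proof.
move=> kap0 Y0 v_kap T_net.
(* As [a ^ 2 <= 2 b ^ 2 + 2 (a - b) ^ 2], passing to a neighbour in the net turns the
   bounds [34 Y] and [Y] into [16 Y] and [4 Y]. *)
pose bad j := [set s | 16 * Y < \sum_(i < N) v j (fswap N s i) ^+ 2 /\
    \sum_(i < N) v j (fswap N s (N + i)) ^+ 2 <= 4 * Y].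
apply: (@le_trans _ _ (freq N [set s | exists2 j, j \in T & bad j s])).
  apply: freq_sub => s [k [h1 h2]]; have [j jT vj] := T_net k; exists j => //.
  pose u i := v k i - v j i.
  have ule : sqnorm N (u \o fswap N s) <= Y by rewrite sqnorm_fswap.
  rewrite /sqnorm big_split/= in ule.
  have u1 : 0 <= \sum_(i < N) u (fswap N s i) ^+ 2.
    by apply: sumr_ge0 => i _; exact: sqr_ge0.
  have u2 : 0 <= \sum_(i < N) u (fswap N s (N + i)) ^+ 2.
    by apply: sumr_ge0 => i _; exact: sqr_ge0.
  have sq2 (a b : R) : a ^+ 2 <= 2 * b ^+ 2 + 2 * (a - b) ^+ 2.
    by have := sqr_ge0 (a - 2 * b); nra.
  have e1 : \sum_(i < N) v k (fswap N s i) ^+ 2 <=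
      2 * \sum_(i < N) v j (fswap N s i) ^+ 2 + 2 * \sum_(i < N) u (fswap N s i) ^+ 2.
    by rewrite !mulr_sumr -big_split; apply: ler_sum => i _; exact: sq2.
  have e2 : \sum_(i < N) v j (fswap N s (N + i)) ^+ 2 <=
      2 * \sum_(i < N) v k (fswap N s (N + i)) ^+ 2 +
      2 * \sum_(i < N) u (fswap N s (N + i)) ^+ 2.
    rewrite !mulr_sumr -big_split; apply: ler_sum => i _.
    by apply: (le_trans (sq2 _ (v k (fswap N s (N + i))))); rewrite lerD2l /u; nra.
  by split; lra.
apply: freq_has => j _.
pose w i := fold_diff N (fun i => v j i ^+ 2) i.
pose W := sqnorm N (v j).
have Wd s : W = \sum_(i < N) v j (fswap N s i) ^+ 2 +
    \sum_(i < N) v j (fswap N s (N + i)) ^+ 2.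
  by rewrite /W -(sqnorm_fswap N s) /sqnorm big_split.
have Dd s : rsum w s N = \sum_(i < N) v j (fswap N s i) ^+ 2 -
    \sum_(i < N) v j (fswap N s (N + i)) ^+ 2.
  rewrite /rsum -sumrB; apply: eq_bigr => i _.
  by rewrite /w -(fold_diff_fswap s (fun i => v j i ^+ 2)).
have [WY|YW] := leP W (16 * Y).
  rewrite (_ : bad j = set0) ?freq0 ?mulr_ge0 ?expR_ge0//.
  apply/seteqP; split=> // s [h1 h2]; have := Wd s.
  have : 0 <= \sum_(i < N) v j (fswap N s (N + i)) ^+ 2.
    by apply: sumr_ge0 => i _; exact: sqr_ge0.
  by lra.
have W0 : 0 < W by lra.
have wV : \sum_(i < N) w i ^+ 2 <= kap ^+ 2 * W.
  rewrite /W /sqnorm mulr_sumr; apply: ler_sum => i _; rewrite /w /fold_diff.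
  have sqle (x : R) : `|x| <= kap -> x ^+ 2 <= kap ^+ 2.
    by move=> xk; rewrite -[x ^+ 2]real_normK ?num_real// ler_sqr ?nnegrE ?(ltW kap0).
  have k1 := sqle _ (v_kap j i); have k2 := sqle _ (v_kap j (N + i)%N).
  move: k1 k2 (sqr_ge0 (v j i)) (sqr_ge0 (v j (N + i)%N)).
  set x := v j i ^+ 2; set y := v j (N + i)%N ^+ 2; set z := kap ^+ 2 => k1 k2 x0 y0.
  by nra.
(* The total [W] exceeds [16 Y] and one half is at most [4 Y], so that the halves
   differ by at least [W - 8 Y], which is more than [W / 2]. *)
apply: (@le_trans _ _ (freq N [set s | exists2 m, (m <= N)%N & W / 2 <= `|rsum w s m|])).
  apply: freq_sub => s [h1 h2]; exists N => //.
  apply: le_trans (ler_norm _); rewrite Dd; have := Wd s; lra.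
apply: (le_trans (rsum_max_tail _ _ wV)); first by rewrite divr_ge0// ltW.
  by rewrite mulr_gt0// exprn_gt0.
have k20 : 0 < kap ^+ 2 by rewrite exprn_gt0.
rewrite ler_pM2l// ler_expR lerN2.
rewrite ler_pdivrMr ?mulr_gt0//.
have -> : (W / 2) ^+ 2 / (8 * (kap ^+ 2 * W)) * (2 * kap ^+ 2) = W / 16.
  by field; rewrite !gt_eqF.
lra.
Qed.

End chaining.

(** * Real-valued probabilities *)

Section real_probability.
Context d (T : measurableType d) (R : realType) (P : probability T R).
Implicit Types A B : set T.

Definition pr A : R := fine (P A).

Lemma prE A : measurable A -> P A = (pr A)%:E.
Proof. by move=> mA; rewrite /pr fineK// fin_num_measure. Qed.

Lemma pr_ge0 A : 0 <= pr A. Proof. by rewrite /pr fine_ge0. Qed.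

Lemma pr_set0 : pr set0 = 0. Proof. by rewrite /pr measure0. Qed.

Lemma pr_setT : pr setT = 1. Proof. by rewrite /pr probability_setT. Qed.

Lemma pr_sub A B : measurable A -> measurable B -> A `<=` B -> pr A <= pr B.
Proof. by move=> mA mB AB; rewrite -lee_fin -!prE// le_measure// inE. Qed.

Lemma pr_setU_disj A B : measurable A -> measurable B -> A `&` B = set0 ->
  pr (A `|` B) = pr A + pr B.
Proof.
move=> mA mB AB; apply: EFin_inj; rewrite EFinD -!prE//; last exact: measurableU.
exact: measureU.
Qed.

Lemma pr_setU A B : measurable A -> measurable B -> pr (A `|` B) <= pr A + pr B.
Proof.
move=> mA mB; have mD : measurable (B `\` A) by exact: measurableD.
have -> : A `|` B = A `|` (B `\` A).
  apply/seteqP; split=> x; last by move=> [|[]]; [left|right].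
  by have [Ax _|nAx [|]] := pselect (A x); [left|left|right].
rewrite pr_setU_disj// ?lerD2l//; first by apply: pr_sub => //; exact: subDsetl.
by apply/seteqP; split=> // x [Ax [_]].
Qed.

Lemma pr_setC A : measurable A -> pr (~` A) = 1 - pr A.
Proof.
move=> mA; apply/eqP; rewrite eq_sym subr_eq; apply/eqP.
rewrite -pr_setU_disj ?setvU ?setUv ?setICl ?pr_setT//; exact: measurableC.
Qed.

Lemma pr_bigcup_le (A : nat -> set T) c : (forall k, measurable (A k)) ->
  (forall n, pr (\bigcup_(k < n) A k) <= c) -> pr (\bigcup_k A k) <= c.
Proof.
move=> mA Ac.
have mU n : measurable (\bigcup_(k < n) A k) by exact: bigcup_measurable.
have -> : \bigcup_k A k = \bigcup_n \bigcup_(k < n) A k.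
  apply/seteqP; split=> x [k _]; first by move=> Akx; exists k.+1 => //; exists k => /=.
  by move=> [j _ ?]; exists j.
rewrite -lee_fin -prE; last exact: bigcup_measurable.
have h : (P \o (fun n => \bigcup_(k < n) A k)) @ \oo --> P (\bigcup_n \bigcup_(k < n) A k).
  apply: nondecreasing_cvg_mu => //; first exact: bigcup_measurable.
  move=> m n mn; apply/subsetPset => x [k /= km Akx]; exists k => //=.
  exact: leq_trans mn.
rewrite -(cvg_lim _ h)//; apply: lime_le; first by apply/cvg_ex; eexists; exact: h.
by apply: nearW => n /=; rewrite prE// lee_fin.
Qed.

End real_probability.

(** * Independent blocks and exchangeability *)

Section iid_blocks.
Context d d' (Om : measurableType d) (E : measurableType d') (R : realType).
Context (P : probability Om R) (X : nat -> {RV P >-> E}).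
Hypotheses (X_indep : mutually_independent X) (X_idist : identically_distributed X).

Local Notation Q := (pr (distribution P (X 0%N))).
Local Notation pr := (pr P).

Lemma measurable_RV i A : measurable A -> measurable (X i @^-1` A).
Proof. by move=> mA; rewrite -[X in measurable X]setTI; exact: measurable_funP. Qed.

(** The sets are moved to the positions [a i] because independence is expressed by
    a family of sets indexed by the observations. *)
Lemma block_pr (a : nat -> nat) n (A : nat -> set E) : injective a ->
  (forall i, measurable (A i)) ->
  pr [set w | forall i, (i < n)%N -> A i (X (a i) w)] = \prod_(i < n) Q (A i).
Proof.
move=> a_inj mA; pose B j := [set y | forall i, (i < n)%N -> a i = j -> A i y].
have mB j : measurable (B j).
  rewrite (_ : B j = \bigcap_(i in [set i | (i < n)%N /\ a i = j]) A i).
    by apply: bigcap_measurableType.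
  by apply/seteqP; split=> y h; [move=> i [] *; exact: h|move=> i *; exact: h].
have BA i : (i < n)%N -> B (a i) = A i.
  move=> ni; apply/seteqP; split=> y; first by apply.
  by move=> Ay k _ /a_inj ->.
have := X_indep (s := map a (index_iota 0 n)) (A := B).
rewrite map_inj_uniq// iota_uniq => /(_ erefl (fun i _ => mB i)).
rewrite big_map big_mkord => XB.
rewrite (_ : [set w | _] = \bigcap_(i in [set` map a (index_iota 0 n)]) (X i @^-1` B i)); last first.
  apply/seteqP; split=> w.
    move=> h j /= /mapP[i]; rewrite mem_index_iota => /andP[_ ni] ->.
    by rewrite BA//; exact: h.
  move=> h i ni; have := h (a i); rewrite /= BA//; apply.
  by apply: map_f; rewrite mem_index_iota.
rewrite /pr XB.
have -> : (\prod_(i < n) P (X (a i) @^-1` B (a i)) = \prod_(i < n) (Q (A i))%:E)%E.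
  apply: eq_bigr => i _; rewrite BA// -[LHS]/(distribution P (X (a i)) (A i)).
  by rewrite (X_idist (a i) 0%N)// prE.
by rewrite prodEFin.
Qed.

Definition sig_obs (I : set nat) : set (set Om) :=
  <<s [set C | exists i A, [/\ I i, measurable A & C = X i @^-1` A]] >>.

Lemma sig_obs_RV (I : set nat) i A : I i -> measurable A -> sig_obs I (X i @^-1` A).
Proof. by move=> Ii mA; apply: sub_sigma_algebra; exists i, A. Qed.

Lemma sig_obs_measurable I : sig_obs I `<=` measurable.
Proof.
apply: smallest_sub; first exact: sigma_algebra_measurable.
by move=> _ [i [A [_ mA ->]]]; exact: measurable_RV.
Qed.

Lemma sig_obsS I J : I `<=` J -> sig_obs I `<=` sig_obs J.
Proof.
by move=> IJ; apply: sub_sigma_algebra2 => _ [i [A [/IJ Ji mA ->]]]; exists i, A.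
Qed.

Let cyl (I : set nat) : set (set Om) := [set C | exists A n,
  [/\ forall i, measurable (A i), forall i, ~ (I i /\ (i < n)%N) -> A i = setT &
      C = [set w | forall i, A i (X i w)] ] ].

Let cylE (A : nat -> set E) n : (forall i, (n <= i)%N -> A i = setT) ->
  [set w | forall i, A i (X i w)] = [set w | forall i, (i < n)%N -> A i (X i w)].
Proof.
move=> AT; apply/seteqP; split=> w h i; first by move=> _; exact: h.
by have [/AT ->//|ni] := leqP n i; exact: h.
Qed.

Let cyl_pr (A : nat -> set E) n : (forall i, measurable (A i)) ->
  (forall i, (n <= i)%N -> A i = setT) ->
  pr [set w | forall i, A i (X i w)] = \prod_(i < n) Q (A i).
Proof. by move=> mA AT; rewrite (cylE AT) (block_pr (a := id)). Qed.

Let cyl_measurable I : cyl I `<=` measurable.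
Proof.
move=> _ [A [n [mA _ ->]]].
rewrite (_ : [set w | _] = \bigcap_i X i @^-1` A i); last first.
  by apply/seteqP; split=> w h i; [move=> _; exact: h|exact: h].
by apply: bigcapT_measurable => i; exact: measurable_RV.
Qed.

Let cylI I : setI_closed (cyl I).
Proof.
move=> _ _ [A [n [mA AT ->]]] [B [m [mB BT ->]]].
exists (fun i => A i `&` B i), (maxn n m); split.
- by move=> i; exact: measurableI.
- move=> i Ii; rewrite AT ?BT ?setTI// => -[Ii' h]; apply: Ii; split => //.
    by rewrite leq_max h orbT.
  by rewrite leq_max h.
- apply/seteqP; split=> w /=; first by move=> [hA hB] i.
  by move=> h; split=> i; have [] := h i.
Qed.

Let cylT I : cyl I setT.
Proof. by exists (fun=> setT), 0%N; split => //; apply/seteqP; split. Qed.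

Let sig_obs_cyl I : sig_obs I `<=` <<s cyl I >>.
Proof.
apply: smallest_sub; first exact: smallest_sigma_algebra.
move=> _ [i [A [Ii mA ->]]]; apply: sub_sigma_algebra.
exists (fun j => if j == i then A else setT), i.+1; split.
- by move=> j; case: ifP.
- by move=> j; case: eqP => // -> /(_ (conj Ii (ltnSn i))).
- apply/seteqP; split=> w; first by move=> Aw j; case: eqP => [->|].
  by move=> /(_ i); rewrite eqxx.
Qed.

Let cyl_indep I J A B : I `&` J = set0 -> cyl I A -> cyl J B ->
  pr (A `&` B) = pr A * pr B.
Proof.
move=> IJ [F [n [mF FT ->]]] [G [m [mG GT ->]]].
pose N := maxn n m.
have FN i : (N <= i)%N -> F i = setT.
  by rewrite geq_max => /andP[ni _]; apply: FT => -[_]; rewrite ltnNge ni.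
have GN i : (N <= i)%N -> G i = setT.
  by rewrite geq_max => /andP[_ ni]; apply: GT => -[_]; rewrite ltnNge ni.
rewrite (cyl_pr mF FN) (cyl_pr mG GN).
rewrite (_ : _ `&` _ = [set w | forall i, (F i `&` G i) (X i w)]); last first.
  apply/seteqP; split=> w /=; first by move=> [hF hG] i.
  by move=> h; split=> i; have [] := h i.
rewrite (@cyl_pr (fun i => F i `&` G i) N); last 2 first.
- by move=> i; exact: measurableI.
- by move=> i Ni; rewrite FN ?GN ?setTI.
rewrite -big_split; apply: eq_bigr => i _ /=.
have [Ii|nIi] := pselect (I i).
  rewrite (GT i) ?setIT ?pr_setT ?mulr1// => -[Ji _].
  by have : (I `&` J) i by []; rewrite IJ.
by rewrite (FT i) ?setTI ?pr_setT ?mul1r// => -[].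
Qed.

(** Both sides are finite measures of [A], so Dynkin's theorem on pi-systems
    applies. *)
Lemma product_rule_generated (G : set (set Om)) B : G `<=` measurable -> setI_closed G -> G setT ->
  measurable B -> (forall A, G A -> pr (A `&` B) = pr A * pr B) ->
  forall A, <<s G >> A -> pr (A `&` B) = pr A * pr B.
Proof.
move=> Gm GI GT mB GB A sGA.
have sGm : <<s G >> `<=` measurable.
  by apply: smallest_sub => //; exact: sigma_algebra_measurable.
pose m1 := mrestr P mB; pose m2 := mscale (NngNum (pr_ge0 P B)) P.
have m12 C : measurable C -> (m1 C = (pr (C `&` B))%:E) * (m2 C = (pr C * pr B)%:E)%type.
  move=> mC; rewrite /m1 /m2 /mrestr /mscale/= prE; last exact: measurableI.
  by rewrite (prE P mC) -EFinM mulrC.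
have mA := sGm _ sGA.
suff : m1 A = m2 A by rewrite !m12// => -[].
apply: (g_sigma_algebra_measure_unique G Gm (fun=> setT)) => //.
- by rewrite bigcup_const.
- move=> C GC; have [e1 e2] := m12 _ (Gm _ GC).
  exact: etrans e1 (etrans (congr1 EFin (GB _ GC)) (esym e2)).
- move=> _; have [e1 _] := m12 _ (@measurableT _ Om).
  exact: (eq_ind_r (fun x => x < +oo)%E (ltry _) e1).
Qed.

(** The product rule passes from finite cylinders to the generated sigma-algebras,
    one argument at a time. *)
Lemma sig_obs_indep I J A B : I `&` J = set0 -> sig_obs I A -> sig_obs J B ->
  pr (A `&` B) = pr A * pr B.
Proof.
move=> IJ sA sB.
apply: (@product_rule_generated (cyl I)) => //; [exact: sig_obs_measurable sB| |exact: sig_obs_cyl].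
move=> C cC; rewrite setIC mulrC.
apply: (@product_rule_generated (cyl J)) => //; [exact: cyl_measurable cC| |exact: sig_obs_cyl].
by move=> D cD; rewrite setIC mulrC; exact: cyl_indep cC cD.
Qed.

Definition seq_cyl : set (set (nat -> E)) :=
  [set C | exists i A, measurable A /\ C = [set z | A (z i)]].

Definition seqspace := g_sigma_algebraType seq_cyl.

Lemma measurable_coord i : measurable_fun [set: seqspace] (fun z : seqspace => z i).
Proof.
move=> _ A mA; rewrite setTI; apply: sub_sigma_algebra.
by exists i, A.
Qed.

Definition seq_obs (a : nat -> nat) (w : Om) : seqspace := fun i => X (a i) w.

Lemma measurable_seq_obs a : measurable_fun setT (seq_obs a).
Proof.
apply: (@measurability _ _ Om seqspace setT (seq_obs a) seq_cyl) => // _ [_ [i [A [mA ->]]] <-].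
by rewrite setTI; exact: measurable_RV.
Qed.

Lemma seq_obs_sig (I : set nat) a (C : set seqspace) : (forall i, I (a i)) ->
  measurable C -> sig_obs I (seq_obs a @^-1` C).
Proof.
move=> Ia; pose H := [set C : set seqspace | sig_obs I (seq_obs a @^-1` C)].
suff : <<s seq_cyl >> `<=` H by apply.
apply: smallest_sub.
  have [s0 sD sU] := smallest_sigma_algebra setT
    [set C | exists i A, [/\ I i, measurable A & C = X i @^-1` A]].
  split; first by rewrite /H /= preimage_set0.
    by move=> A HA; rewrite /H /= setTD preimage_setC -setTD; exact: sD.
  by move=> F HF; rewrite /H /= preimage_bigcup; exact: sU.
by move=> _ [i [A [mA ->]]]; rewrite /H /=; exact: (sig_obs_RV (Ia i)).
Qed.

(** Exchangeability: finite-dimensional distributions determine the law, and those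
    of distinct observations are products of one common factor. *)
Lemma seq_obs_law a (C : set seqspace) : injective a -> measurable C ->
  pr (seq_obs a @^-1` C) = pr (seq_obs id @^-1` C).
Proof.
move=> a_inj mC.
pose fc : set (set seqspace) := [set D | exists A n,
  (forall i, measurable (A i)) /\ D = [set z | forall i, (i < n)%N -> A i (z i)] ].
have fcm : fc `<=` measurable.
  move=> _ [A [n [mA ->]]].
  rewrite (_ : [set z | _] = \bigcap_(i in `I_n) [set z | A i (z i)]); last first.
    by apply/seteqP; split=> z h i; [move=> /=; exact: h|exact: h].
  by apply: bigcap_measurableType => i _; apply: sub_sigma_algebra; exists i, (A i).
have fcI : setI_closed fc.
  move=> _ _ [A [n [mA ->]]] [B [m [mB ->]]].
  exists (fun i => (if (i < n)%N then A i else setT) `&`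
                   (if (i < m)%N then B i else setT)), (maxn n m); split.
    by move=> i; apply: measurableI; case: ifP.
  apply/seteqP; split=> z /=.
    by move=> [hA hB] i _; split; case: ifP => // h; [exact: hA|exact: hB].
  move=> h; split=> i im.
    by have [] := h i (leq_trans im (leq_maxl _ _)); rewrite im.
  by have [_] := h i (leq_trans im (leq_maxr _ _)); rewrite im.
have fcT : fc setT.
  by exists (fun=> setT), 0%N; split => //; apply/seteqP; split.
have sC : <<s fc >> C.
  apply: (smallest_sub (smallest_sigma_algebra _ _) _ mC).
  move=> _ [i [A [mA ->]]]; apply: sub_sigma_algebra.
  exists (fun j => if j == i then A else setT), i.+1; split.
    by move=> j; case: ifP.
  apply/seteqP; split=> z /=; first by move=> Az j _; case: eqP => [->|].
  by move=> /(_ i (ltnSn i)); rewrite eqxx.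
have mo b (D : set seqspace) : measurable D -> measurable (seq_obs b @^-1` D).
  by move=> mD; rewrite -[X in measurable X]setTI; exact: measurable_seq_obs.
pose Y b : {RV P >-> seqspace} := HB.pack (seq_obs b)
  (isMeasurableFun.Build _ _ _ _ (seq_obs b) (measurable_seq_obs b)).
apply: EFin_inj; rewrite -!prE; [|exact: mo|exact: mo].
apply: (g_sigma_algebra_measure_unique fc fcm (fun=> setT) _ _
  (distribution P (Y a)) (distribution P (Y id))) => //.
- by rewrite bigcup_const.
- move=> _ [A [n [mA ->]]].
  have mD : measurable ([set z | forall i, (i < n)%N -> A i (z i)] : set seqspace).
    by apply: fcm; exists A, n.
  have id_inj : injective (id : nat -> nat) by [].
  have e := etrans (block_pr n a_inj mA) (esym (block_pr n id_inj mA)).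
  exact: etrans (prE P (mo a _ mD)) (etrans (congr1 EFin e) (esym (prE P (mo id _ mD)))).
- by move=> _; rewrite /= probability_setT ltry.
Qed.

End iid_blocks.

(** * Symmetrization *)

Section symmetrization.
Context d d' (Om : measurableType d) (E : measurableType d') (R : realType).
Context (P : probability Om R) (X : nat -> {RV P >-> E}).
Hypotheses (X_indep : mutually_independent X) (X_idist : identically_distributed X).
Local Notation pr := (pr P).

Lemma integral_freq N (A : (nat -> bool) -> set Om) : (forall s, measurable (A s)) ->
  measurable_fun setT (fun w => freq N [set s | A s w] : R) /\
  (\int[P]_w (freq N [set s | A s w] : R)%:E = (sgavg N (fun s => pr (A s)))%:E)%E.
Proof.
elim: N A => [|N IH] A mA.
  have E0 : (fun w => freq 0 [set s | A s w] : R) = \1_(A (fun=> false)).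
    by apply/funext => w; rewrite /freq/= !indicE; congr (_%:R); apply/idP/idP => /set_mem ?; apply/mem_set.
  split; first by rewrite E0; exact: measurable_indic.
  rewrite (eq_integral (fun w => (\1_(A (fun=> false)) w : R)%:E)).
    by rewrite integral_indic// setIT -prE.
  by move=> w _; rewrite -E0.
have [m1 i1] := IH (fun s => A (scons true s)) (fun s => mA _).
have [m2 i2] := IH (fun s => A (scons false s)) (fun s => mA _).
have E0 : (fun w => freq N.+1 [set s | A s w] : R) =
    (fun w => (freq N [set s | A (scons true s) w] +
               freq N [set s | A (scons false s) w]) / 2) by [].
have f0 (B : set (nat -> bool)) : 0 <= freq N B :> R.
  by rewrite -(freq0 R N); exact: freq_sub.
split; first by rewrite E0; apply: measurable_funM => //; exact: measurable_funD.
rewrite (eq_integral (fun w => (((freq N [set s | A (scons true s) w])%:E +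
    (freq N [set s | A (scons false s) w])%:E) * (2^-1)%:E)%E)); last by [].
rewrite ge0_integralZr//; last 2 first.
- by apply: emeasurable_funD; exact/measurable_EFinP.
- by move=> w _; rewrite adde_ge0// lee_fin.
rewrite ge0_integralD//; last 4 first.
- by move=> w _; rewrite lee_fin.
- exact/measurable_EFinP.
- by move=> w _; rewrite lee_fin.
- exact/measurable_EFinP.
by rewrite i1 i2.
Qed.

(** The law of the sequence of observations is invariant under the random
    exchanges of [i] and [N + i]; averaging over them first turns a pointwise count
    of signs into a bound on the probability. *)
Lemma symmetrized_pr N (C : set (seqspace E)) b : measurable C ->
  (forall z : seqspace E, freq N [set s | C (z \o fswap N s)] <= b) ->
  pr (seq_obs X id @^-1` C) <= b.
Proof.
move=> mC Cb; pose A s := seq_obs X (fswap N s) @^-1` C.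
have mA s : measurable (A s).
  by rewrite -[X in measurable X]setTI; exact: measurable_seq_obs.
have -> : pr (seq_obs X id @^-1` C) = sgavg N (fun s => pr (A s)).
  rewrite -[LHS](sgavg_cst N); congr (sgavg N _); apply/funext => s.
  by rewrite -(seq_obs_law X_indep X_idist (can_inj (fswapK N s)) mC).
have [mf fi] := integral_freq N mA.
rewrite -lee_fin -fi; apply: (@le_trans _ _ (\int[P]_w b%:E)%E).
  have f0 (B : set (nat -> bool)) : 0 <= freq N B :> R.
    by rewrite -(freq0 R N); exact: freq_sub.
  apply: ge0_le_integral => //.
  - by move=> w _; rewrite lee_fin.
  - exact/measurable_EFinP.
  - by move=> w _; rewrite lee_fin; exact: (Cb (seq_obs X id w)).
rewrite integral_cst// [X in (_ * X)%E](_ : _ = 1%E) ?mule1//; exact: probability_setT.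
Qed.

(** Comparison with a ghost sample: the first [k] for which [U k] occurs is
    determined by the block [I], so the event [W k] of the block [J] still has its
    unconditional probability. *)
Lemma ghost_sample (I J : set nat) (U W : nat -> set Om) V : I `&` J = set0 ->
  (forall k, sig_obs X I (U k)) -> (forall k, sig_obs X J (W k)) -> measurable V ->
  (forall k, 2^-1 <= pr (W k)) -> (forall k, U k `&` W k `<=` V) ->
  pr (\bigcup_k U k) <= 2 * pr V.
Proof.
move=> IJ sU sW mV W2 UWV.
have mU k : measurable (U k) by exact: sig_obs_measurable (sU k).
have mW k : measurable (W k) by exact: sig_obs_measurable (sW k).
apply: pr_bigcup_le => // n.
pose Un n := \bigcup_(k < n) U k; pose D n := U n `\` Un n.
pose Vn n := \bigcup_(k < n) (D k `&` W k).
have sUn m : sig_obs X I (Un m).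
  exact: (@bigcup_measurable _ (g_sigma_algebraType _) _ _ (fun k _ => sU k)).
have mUn m : measurable (Un m) by exact: sig_obs_measurable (sUn m).
have sD m : sig_obs X I (D m).
  exact: (@measurableD _ (g_sigma_algebraType _) _ _ (sU m) (sUn m)).
have mD m : measurable (D m) by exact: sig_obs_measurable (sD m).
have mVn m : measurable (Vn m) by apply: bigcup_measurable => k _; exact: measurableI.
have UnS m : Un m.+1 = Un m `|` D m.
  apply/seteqP; split=> w.
    move=> [k /=]; rewrite ltnS leq_eqVlt => /predU1P[->|km] Uw; last by left; exists k.
    by have [?|?] := pselect (Un m w); [left|right].
  move=> [[k /= km Uw]|[Uw _]]; first by exists k => //=; exact: ltnW.
  by exists m => /=.
have VnS m : Vn m.+1 = Vn m `|` (D m `&` W m).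
  apply/seteqP; split=> w.
    by move=> [k /=]; rewrite ltnS leq_eqVlt => /predU1P[->|km] Uw; [right|left; exists k].
  move=> [[k /= km Uw]|Uw]; first by exists k => //=; exact: ltnW.
  by exists m => /=.
have VnUn m : Vn m `<=` Un m by move=> w [k /= km [[Uw _] _]]; exists k.
apply: (@le_trans _ _ (2 * pr (Vn n))); last first.
  rewrite ler_pM2l//; apply: pr_sub => // w [k _ [[Uw _] Ww]]; exact: (UWV k).
rewrite -/(Un n); elim: n => [|n IH].
  rewrite /Un (_ : \bigcup_(k < 0) U k = set0) ?pr_set0 ?mulr_ge0 ?pr_ge0//.
  by apply/seteqP; split=> // w [].
have DW : pr (D n `&` W n) = pr (D n) * pr (W n).
  exact: (sig_obs_indep X_indep X_idist IJ (sD n) (sW n)).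
rewrite UnS VnS !pr_setU_disj//; last 3 first.
- exact: measurableI.
- by apply/seteqP; split=> // w [/VnUn Uw [[_ nU] _]].
- by apply/seteqP; split=> // w [Uw [_ nU]].
rewrite DW; have := pr_ge0 P (D n); have := W2 n; nra.
Qed.

End symmetrization.

(** * Moments of bounded functions of the observations *)

Section level_sets.
Context d (T : measurableType d) (R : realType).
Implicit Type f : T -> R.

Lemma measurable_gt_set f c : measurable_fun setT f -> measurable [set x | c < f x].
Proof.
move=> mf; rewrite (_ : [set _ | _] = f @^-1` `]c, +oo[).
  by rewrite -[X in measurable X]setTI; exact: mf.
by apply/seteqP; split=> x /=; rewrite in_itv/= andbT.
Qed.

Lemma measurable_le_set f c : measurable_fun setT f -> measurable [set x | f x <= c].
Proof.
move=> mf; rewrite (_ : [set _ | _] = ~` [set x | c < f x]).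
  by apply: measurableC; exact: measurable_gt_set.
by apply/seteqP; split=> x /=; [rewrite leNgt => /negP|move/negP; rewrite -leNgt].
Qed.

End level_sets.

Section bounded_measurable.
Context d (T : measurableType d) (R : realType).
Implicit Types f g : T -> R.

(** Bounded measurable functions are integrable for every probability and closed
    under the ring operations, so integrability never has to be argued again. *)
Definition bmf f := measurable_fun setT f /\ exists M, forall x, `|f x| <= M.

Lemma bmf_integrable (mu : probability T R) f : bmf f ->
  mu.-integrable setT (EFin \o f).
Proof.
move=> [mf [M fM]]; apply: measurable_bounded_integrable => //.
  by rewrite (@le_lt_trans _ _ 1%E) ?ltry// probability_le1.
exists M; split; first exact: num_real.
by move=> x Mx y _ /=; exact: le_trans (fM y) (ltW Mx).
Qed.

Lemma bmf_cst c : bmf (fun=> c).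
Proof. by split; [exact: measurable_cst|exists `|c|]. Qed.

Lemma bmfD f g : bmf f -> bmf g -> bmf (fun x => f x + g x).
Proof.
move=> [mf [M fM]] [mg [N gN]]; split; first exact: measurable_funD.
by exists (M + N) => x; rewrite (le_trans (ler_normD _ _))// lerD.
Qed.

Lemma bmfM f g : bmf f -> bmf g -> bmf (fun x => f x * g x).
Proof.
move=> [mf [M fM]] [mg [N gN]]; split; first exact: measurable_funM.
by exists (M * N) => x; rewrite normrM ler_pM.
Qed.

Lemma bmfB f g : bmf f -> bmf g -> bmf (fun x => f x - g x).
Proof.
move=> [mf [M fM]] [mg [N gN]]; split; first exact: measurable_funB.
by exists (M + N) => x; rewrite (le_trans (ler_normB _ _))// lerD.
Qed.

Lemma bmf_sq f : bmf f -> bmf (fun x => f x ^+ 2).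
Proof. by move=> bf; under eq_fun do rewrite expr2; exact: bmfM. Qed.

Lemma bmf_sum n (f : nat -> T -> R) : (forall i, bmf (f i)) ->
  bmf (fun x => \sum_(i < n) f i x).
Proof.
move=> bf; elim: n => [|n IH].
  by under eq_fun do rewrite big_ord0; exact: bmf_cst.
by under eq_fun do rewrite big_ord_recr/=; exact: bmfD.
Qed.

Lemma Rintegral_sum (mu : probability T R) n (f : nat -> T -> R) :
  (forall i, bmf (f i)) ->
  \int[mu]_x (\sum_(i < n) f i x) = \sum_(i < n) \int[mu]_x f i x.
Proof.
move=> bf; elim: n => [|n IH].
  by under eq_Rintegral do rewrite big_ord0; rewrite Rintegral_cst// big_ord0 mul0r.
under eq_Rintegral do rewrite big_ord_recr/=.
rewrite RintegralD//; [by rewrite big_ord_recr/= IH| |].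
  by apply: bmf_integrable; exact: bmf_sum.
exact: bmf_integrable.
Qed.

Lemma Rintegral_cst1 (mu : probability T R) c : \int[mu]_(x in setT) c = c.
Proof.
rewrite Rintegral_cst// [X in fine X](_ : _ = 1%E) ?mulr1//.
exact: probability_setT.
Qed.

Lemma markov_pr (mu : probability T R) f u : (forall x, 0 <= f x) -> bmf f -> 0 < u ->
  pr mu [set x | u < f x] <= (\int[mu]_x f x) / u.
Proof.
move=> f0 bf u0; rewrite ler_pdivlMr// mulrC.
have mA : measurable [set x | u < f x] by exact: measurable_gt_set bf.1.
have bA : bmf (\1_[set x | u < f x] : T -> R).
  split; first exact: measurable_indic.
  by exists 1 => x; rewrite indicE ger0_norm// lern1 leq_b1.
have -> : pr mu [set x | u < f x] = \int[mu]_x \1_[set x | u < f x] x.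
  by rewrite /Rintegral integral_indic// setIT.
rewrite -RintegralZl//; last exact: bmf_integrable.
apply: le_Rintegral => //.
- apply: bmf_integrable; apply: bmfM => //; exact: bmf_cst.
- exact: bmf_integrable.
- move=> x _; rewrite indicE; case: (boolP (x \in _)) => [/set_mem /= ux|_].
    by rewrite mulr1 ltW.
  by rewrite mulr0.
Qed.

End bounded_measurable.

Lemma bmf_comp d d' (T : measurableType d) (T' : measurableType d') (R : realType)
    (f : T' -> R) (g : T -> T') : bmf f -> measurable_fun setT g -> bmf (f \o g).
Proof.
move=> [mf [M fM]] mg; split; first exact: measurableT_comp.
by exists M => x; exact: fM.
Qed.

Section iid_moments.
Context d d' (Om : measurableType d) (E : measurableType d') (R : realType).
Context (P : probability Om R) (X : nat -> {RV P >-> E}).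
Hypotheses (X_indep : mutually_independent X) (X_idist : identically_distributed X).
Implicit Types g : E -> R.
Local Notation Q := (distribution P (X 0%N)).

Lemma bmf_obs g i : bmf g -> bmf (fun w => g (X i w)).
Proof. by move=> bg; apply: (bmf_comp bg); exact: measurable_funP. Qed.

Lemma Rintegral_obs g i : bmf g -> \int[P]_w g (X i w) = \int[Q]_y g y.
Proof.
move=> bg; rewrite /Rintegral; congr fine.
rewrite -[LHS](@integral_distribution _ _ _ _ _ P (X i) (EFin \o g)); last 2 first.
- by apply/measurable_EFinP; exact: bg.1.
- by apply: (@bmf_integrable _ _ _ P (fun w => g (X i w))); exact: bmf_obs.
by apply: eq_measure_integral => A mA _; exact: X_idist.
Qed.

(** A pair of distinct observations has the product law, and Fubini's theorem
    separates the factors. *)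
Lemma Rintegral_obs2 g i j : bmf g -> i != j ->
  \int[P]_w (g (X i w) * g (X j w)) = (\int[Q]_y g y) ^+ 2.
Proof.
move=> bg ij.
have mp : measurable_fun setT (fun w => (X i w, X j w)).
  by apply: measurable_fun_pair; exact: measurable_funP.
pose Y : {RV P >-> (E * E)%type} := HB.pack (fun w => (X i w, X j w))
  (isMeasurableFun.Build _ _ _ _ (fun w => (X i w, X j w)) mp).
have YQ A : measurable A -> (Q \x Q)%E A = distribution P Y A.
  apply: product_measure_unique => B C mB mC.
  have := X_indep (s := [:: i; j]) (A := fun k => if k == i then B else C).
  rewrite /= inE ij => /(_ erefl) XBC.
  rewrite /= -[RHS](congr2 _ (X_idist i 0%N mB) (X_idist j 0%N mC)).
  move: XBC; rewrite !big_cons big_nil eqxx eq_sym (negbTE ij) mule1 => <-.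
    rewrite /distribution/= /pushforward; congr (P _); apply/seteqP; split=> w.
      by move=> [Bw Cw] k /=; rewrite !inE => /orP[|]/eqP->;
        rewrite ?eqxx// eq_sym (negbTE ij).
    move=> h; split; first by have := h i; rewrite /= inE !eqxx; exact.
    have := h j; rewrite /= !inE eqxx orbT eq_sym (negbTE ij); exact.
  by move=> k _; case: ifP.
pose phi (p : E * E) := g p.1 * g p.2.
have bphi : bmf phi.
  by apply: bmfM; apply: (bmf_comp bg); [exact: measurable_fst|exact: measurable_snd].
have iphi : (Q \x Q)%E.-integrable setT (EFin \o phi).
  apply: measurable_bounded_integrable => //; last 2 first.
  - exact: bphi.1.
  - have [_ [M hM]] := bphi; exists M; split; first exact: num_real.
    by move=> x Mx y _ /=; exact: le_trans (hM y) (ltW Mx).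
  rewrite [X in (X < _)%E](_ : _ = 1%E) ?ltry//.
  exact: (etrans (YQ setT measurableT) (probability_setT _)).
transitivity (fine (\int[Q \x Q]_p (phi p)%:E)%E).
  rewrite /Rintegral; congr fine.
  rewrite -[LHS](@integral_distribution _ _ _ _ _ P Y (EFin \o phi)); last 2 first.
  - by apply/measurable_EFinP; exact: bphi.1.
  - by apply: (@bmf_integrable _ _ _ P (fun w => phi (Y w))); apply: (bmf_comp bphi).
  by apply: eq_measure_integral => A mA _; exact: esym (YQ A mA).
rewrite -(integral12_prod_meas1 iphi) /fubini_F /phi/=.
have ig := bmf_integrable Q bg.
have igf := integrable_fin_num measurableT ig.
under eq_integral => x _.
  under eq_integral do rewrite EFinM.
  rewrite integralZl//.
  over.
rewrite /= -(fineK igf) integralZr//= -(fineK igf) -EFinM.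
by rewrite expr2.
Qed.

(** Centred independent variables are orthogonal, so only the diagonal terms of the
    square remain, and a variance is at most a second moment. *)
Lemma Rintegral_centred_sum g N m v : bmf g -> \int[Q]_y g y ^+ 2 <= v ->
  \int[P]_w (\sum_(i < m) (g (X (N + i)%N w) - \int[Q]_y g y)) ^+ 2 <= m%:R * v.
Proof.
move=> bg gv; set mu := \int[Q]_y g y; pose phi y := g y - mu.
have bphi : bmf phi by apply: bmfB => //; exact: bmf_cst.
have phi0 : \int[Q]_y phi y = 0.
  rewrite RintegralB//; [|exact: bmf_integrable|by apply: bmf_integrable; exact: bmf_cst].
  by rewrite Rintegral_cst1 subrr.
have phi2 : \int[Q]_y phi y ^+ 2 <= v.
  apply: le_trans gv.
  have -> : (fun y => phi y ^+ 2) = (fun y => g y ^+ 2 - (2 * mu * g y - mu ^+ 2)).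
    by apply/funext => y; rewrite /phi; ring.
  rewrite RintegralB//; last 2 first.
  - by apply: bmf_integrable; exact: bmf_sq.
  - apply: bmf_integrable; apply: bmfB; last exact: bmf_cst.
    by apply: bmfM => //; exact: bmf_cst.
  rewrite RintegralB//; last 2 first.
  - by apply: bmf_integrable; apply: bmfM => //; exact: bmf_cst.
  - by apply: bmf_integrable; exact: bmf_cst.
  rewrite RintegralZl//; last exact: bmf_integrable.
  by rewrite Rintegral_cst1 -/mu; have := sqr_ge0 mu; nra.
have bX i : bmf (fun w => phi (X (N + i)%N w)) by exact: bmf_obs.
have -> : (fun w => (\sum_(i < m) (g (X (N + i)%N w) - mu)) ^+ 2) =
    (fun w => \sum_(i < m) \sum_(j < m) (phi (X (N + i)%N w) * phi (X (N + j)%N w))).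
  apply/funext => w; rewrite expr2 mulr_suml; apply: eq_bigr => i _.
  by rewrite mulr_sumr.
rewrite (@Rintegral_sum _ _ _ P m (fun i w => \sum_(j < m) (phi (X (N + i)%N w) * phi (X (N + j)%N w)))); last first.
  move=> i; apply: (@bmf_sum _ _ _ m (fun j w => phi (X (N + i)%N w) * phi (X (N + j)%N w))).
  by move=> j; exact: bmfM.
rewrite -[m in m%:R]card_ord -sum1_card natr_sum mulr_suml; apply: ler_sum => i _.
rewrite (@Rintegral_sum _ _ _ P m (fun j w => phi (X (N + i)%N w) * phi (X (N + j)%N w)));
  last by move=> j; exact: bmfM.
rewrite (bigD1 i)//= big1 ?addr0 => [|j ji]; last first.
  by rewrite Rintegral_obs2// ?phi0 ?expr0n// eqn_add2l eq_sym.
rewrite mul1r; apply: le_trans phi2.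
rewrite -(@Rintegral_obs (fun y => phi y ^+ 2) (N + i)%N); last exact: bmf_sq.
by under eq_Rintegral do rewrite -expr2.
Qed.

(** Chebyshev's inequality. *)
Lemma centred_sum_pr g N m v t : bmf g -> \int[Q]_y g y ^+ 2 <= v ->
  0 < t -> 2 * (m%:R * v) <= t ^+ 2 ->
  2^-1 <= pr P [set w | `|\sum_(i < m) (g (X (N + i)%N w) - \int[Q]_y g y)| <= t].
Proof.
move=> bg gv t0 mt; set S := fun w => \sum_(i < m) (g (X (N + i)%N w) - \int[Q]_y g y).
have bS : bmf S.
  apply: (@bmf_sum _ _ _ m (fun i w => g (X (N + i)%N w) - \int[Q]_y g y)) => i.
  by apply: bmfB; [exact: bmf_obs|exact: bmf_cst].
have -> : [set w | `|S w| <= t] = ~` [set w | t ^+ 2 < S w ^+ 2].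
  apply/seteqP; split=> w /=.
    by rewrite -[S w ^+ 2]real_normK ?num_real// => h; apply/negP; rewrite -leNgt ler_sqr ?nnegrE ?(ltW t0).
  by move=> /negP; rewrite -leNgt -[S w ^+ 2]real_normK ?num_real// ler_sqr ?nnegrE ?(ltW t0).
have b2 := bmf_sq bS.
have t20 : 0 < t ^+ 2 by rewrite exprn_gt0.
have mA : measurable [set w | t ^+ 2 < S w ^+ 2] by exact: measurable_gt_set b2.1.
rewrite pr_setC//.
have h := markov_pr P (fun w => sqr_ge0 (S w)) b2 t20.
have hv : \int[P]_w S w ^+ 2 <= m%:R * v by exact: Rintegral_centred_sum.
suff : (\int[P]_w S w ^+ 2) / t ^+ 2 <= 2^-1 by lra.
rewrite ler_pdivrMr//; lra.
Qed.

(** Markov's inequality. *)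
Lemma sum_sq_pr g N m v : bmf g -> \int[Q]_y g y ^+ 2 <= v -> 0 < v -> (0 < m)%N ->
  2^-1 <= pr P [set w | \sum_(i < m) g (X (N + i)%N w) ^+ 2 <= 2 * m%:R * v].
Proof.
move=> bg gv v0 m0; set S := fun w => \sum_(i < m) g (X (N + i)%N w) ^+ 2.
have bgi i : bmf (fun w => g (X (N + i)%N w) ^+ 2) by apply: bmf_sq; exact: bmf_obs.
have bS : bmf S by apply: (@bmf_sum _ _ _ m (fun i w => g (X (N + i)%N w) ^+ 2)).
have t0 : 0 < 2 * m%:R * v by rewrite !mulr_gt0// ltr0n.
have -> : [set w | S w <= 2 * m%:R * v] = ~` [set w | 2 * m%:R * v < S w].
  by apply/seteqP; split=> w /=; [rewrite leNgt => /negP|move/negP; rewrite -leNgt].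
have mA : measurable [set w | 2 * m%:R * v < S w] by exact: measurable_gt_set bS.1.
rewrite pr_setC//.
have S0 w : 0 <= S w by apply: sumr_ge0 => i _; exact: sqr_ge0.
have h := markov_pr P S0 bS t0.
have hv : \int[P]_w S w <= m%:R * v.
  rewrite (@Rintegral_sum _ _ _ P m (fun i w => g (X (N + i)%N w) ^+ 2))//.
  rewrite -[m in m%:R]card_ord -sum1_card natr_sum mulr_suml; apply: ler_sum => i _.
  by rewrite mul1r (@Rintegral_obs (fun y => g y ^+ 2))//; exact: bmf_sq.
suff : (\int[P]_w S w) / (2 * m%:R * v) <= 2^-1 by lra.
rewrite ler_pdivrMr//; lra.
Qed.

End iid_moments.

(** * Lebesgue measure under the rescaling of a kernel *)

Section rescaling.
Context (R : realType).
Local Notation leb := (@lebesgue_measure R).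
Local Notation lebd d := (@lebesgue_euclid R d).

Let push d d' (T1 : measurableType d) (T2 : measurableType d')
    (m : {measure set T1 -> \bar R}) (f : T1 -> T2) (mf : measurable_fun setT f) :
    {measure set T2 -> \bar R} :=
  measure_function_pushforward__canonical__measure_function_Measure m mf.

Definition reflect_coord (x s : R) (y : measurableTypeR R) : measurableTypeR R := (x - y) / s.

Lemma measurable_reflect_coord x s : measurable_fun setT (reflect_coord x s).
Proof.
apply: measurable_funM; last exact: measurable_cst.
by apply: measurable_funB; [exact: measurable_cst|exact: measurable_id].
Qed.

Lemma lebesgue_reflect_coord x s A : 0 < s -> measurable A ->
  leb (reflect_coord x s @^-1` A) = (s%:E * leb A)%E.
Proof.
move=> s0 mA; have si0 : 0 <= s^-1 by rewrite invr_ge0 ltW.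
pose mu := mscale (NngNum si0) (push leb (measurable_reflect_coord x s)).
have muE B : mu B = (s^-1%:E * leb (reflect_coord x s @^-1` B))%E by [].
have -> : leb A = mu A.
  apply: lebesgue_measure_unique mA => _ [[a b] _ <-]; rewrite [RHS]muE.
  have -> : reflect_coord x s @^-1` `]a, b] = `[x - s * b, x - s * a[%classic.
    apply/seteqP; split=> y; rewrite /reflect_coord /= !in_itv/= ltr_pdivlMr// ler_pdivrMr//.
      by move=> /andP[h1 h2]; apply/andP; split; lra.
    by move=> /andP[h1 h2]; apply/andP; split; lra.
  rewrite !lebesgue_measure_itv/= !lte_fin.
  have -> : (x - s * b < x - s * a) = (a < b).
    by rewrite ltrD2l ltrN2 ltr_pM2l.
  case: ifP => _; last by rewrite mule0.
  by rewrite -!EFinB -EFinM; congr EFin; field; rewrite gt_eqF.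
by rewrite muE muleA -EFinM divff ?gt_eqF// mul1e.
Qed.

Definition reflect_scale d (x : euclid R d) (s : R) (y : euclid R d) : euclid R d :=
  [tuple (tnth x i - tnth y i) / s | i < d].

Lemma measurable_reflect_scale d x s : measurable_fun setT (@reflect_scale d x s).
Proof.
apply/measurable_fun_tnthP => i.
rewrite (_ : _ \o _ = reflect_coord (tnth x i) s \o (fun y => tnth y i)); last first.
  by apply/funext => y /=; rewrite tnth_mktuple.
by apply: measurableT_comp; [exact: measurable_reflect_coord|exact: measurable_tnth].
Qed.

(** Induction on the dimension: after division by [s ^ d], the image of Lebesgue
    measure agrees with a product measure on rectangles. *)
Lemma lebesgue_reflect_scale d x s A : 0 < s -> measurable A ->
  lebd d (reflect_scale x s @^-1` A) = ((s ^+ d)%:E * lebd d A)%E.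
Proof.
move=> s0; elim: d x A => [|d IH] x A mA.
  rewrite /= expr0 mul1e !diracE; congr ((nat_of_bool _)%:R%:E); apply/idP/idP => /set_mem h;
    apply/mem_set; move: h; rewrite /= (tuple0 (reflect_scale _ _ _)); exact.
pose x0 := thead x; pose x1 : euclid R d := [tuple of behead x].
pose Phi (p : measurableTypeR R * euclid R d) := (reflect_coord x0 s p.1, reflect_scale x1 s p.2).
have mPhi : measurable_fun setT Phi.
  apply: measurable_fun_pair.
    by apply: measurableT_comp; [exact: measurable_reflect_coord|exact: measurable_fst].
  by apply: measurableT_comp; [exact: measurable_reflect_scale|exact: measurable_snd].
have sd0 : 0 < s ^+ d.+1 by rewrite exprn_gt0.
have si0 : 0 <= (s ^+ d.+1)^-1 by rewrite invr_ge0 ltW.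
pose mu := mscale (NngNum si0) (push (leb \x lebd d)%E mPhi).
have muE B : mu B = ((s ^+ d.+1)^-1%:E * (leb \x lebd d)%E (Phi @^-1` B))%E by [].
have mtA : measurable (@tcons R d @^-1` A).
  by rewrite -[X in measurable X]setTI; exact: measurable_tcons.
have -> : lebd d.+1 A = mu (@tcons R d @^-1` A).
  rewrite /= /pushforward; apply: product_measure_unique mtA => B C mB mC.
  rewrite [LHS]muE (_ : Phi @^-1` _ = (reflect_coord x0 s @^-1` B) `*` (reflect_scale x1 s @^-1` C))//.
  rewrite [X in (_ * X)%E]product_measure1E; last 2 first.
  - by rewrite -[X in measurable X]setTI; exact: measurable_reflect_coord.
  - by rewrite -[X in measurable X]setTI; exact: measurable_reflect_scale.
  rewrite [X in (_ * (X * _))%E]lebesgue_reflect_coord// [X in (_ * (_ * X))%E]IH//.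
  have hE (u v : \bar R) :
      (((s ^+ d.+1)^-1)%:E * (s%:E * u * ((s ^+ d)%:E * v)) = u * v)%E.
    rewrite -(muleA s%:E) (muleCA u) !muleA -!EFinM -mulrA -exprS.
    by rewrite mulVf ?mul1e// expf_neq0// gt_eqF.
  exact: hE.
rewrite muE muleA -EFinM divff ?gt_eqF// mul1e /= /pushforward.
congr (_ _); apply/seteqP; split=> -[y t] /=.
all: have -> : reflect_scale x s (tcons (y, t)) = tcons (Phi (y, t)).
1,3: apply: eq_from_tnth => i; rewrite tnth_mktuple.
1,2: case: (unliftP ord0 i) => [j|] ->; rewrite !(tnthS, tnth0) ?tnth_mktuple/=.
1,3: by rewrite [in LHS](tuple_eta x) tnthS.
1,2: by rewrite /reflect_coord /x0 /thead.
all: by [].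
Qed.

Lemma integral_reflect_scale d x s (F : euclid R d -> R) : 0 < s -> measurable_fun setT F ->
  (forall y, 0 <= F y) ->
  (\int[lebd d]_y (F (reflect_scale x s y))%:E = (s ^+ d)%:E * \int[lebd d]_y (F y)%:E)%E.
Proof.
move=> s0 mF F0; have sd0 : 0 <= s ^+ d by rewrite exprn_ge0// ltW.
have mE : measurable_fun setT (EFin \o F) by exact/measurable_EFinP.
have mr := @measurable_reflect_scale d x s.
transitivity (\int[push (lebd d) mr]_y (F y)%:E)%E.
  rewrite [RHS]ge0_integral_pushforward//.
  by move=> y _; rewrite lee_fin.
rewrite (eq_measure_integral (mscale (NngNum sd0) (lebd d))); last first.
  by move=> A mA _; exact: lebesgue_reflect_scale.
by rewrite ge0_integral_mscale// => y _; rewrite lee_fin.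
Qed.

End rescaling.

(** * The kernel class: second moments and empirical covers *)

Section kernel_class_facts.
Context (R : realType) (d : nat).
Local Notation lebd := (@lebesgue_euclid R d).
Implicit Types (K g : euclid R d -> R) (h : R) (x y : euclid R d).

Lemma measurable_rescaled K h x : measurable_fun setT K ->
  measurable_fun setT (fun y => K (rescale h x y)).
Proof.
move=> mK; apply: (measurableT_comp mK).
exact: (measurable_reflect_scale x (h `^ d%:R^-1)).
Qed.

(** A law with density at most [M] is at most [M] times Lebesgue measure, [K ^ 2] is
    at most [kap |K|], and the change of variables contributes
    [(h ^ (1 / d)) ^ d = h]. *)
Lemma kernel_sq_integral (Q : probability (euclid R d) R) (f K : euclid R d -> R)
    (M kap h : R) x : (0 < d)%N -> has_lebesgue_density Q f ->
  (forall y, `|f y| <= M) -> measurable_fun setT K ->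
  lebd.-integrable setT (EFin \o K) -> (forall y, `|K y| <= kap) -> 0 < h ->
  \int[Q]_y K (rescale h x y) ^+ 2 <= M * kap * (\int[lebd]_y `|K y|) * h.
Proof.
move=> d0 [mf f0 Qf] fM mK iK Kk h0.
pose z : euclid R d := [tuple 0 | i < d].
have M0 : 0 <= M := le_trans (normr_ge0 _) (fM z).
have k0 : 0 <= kap := le_trans (normr_ge0 _) (Kk z).
pose s := h `^ d%:R^-1.
have s0 : 0 < s by rewrite powR_gt0.
have sd : s ^+ d = h.
  rewrite -powR_mulrn ?powR_ge0// /s -powRrM mulVf ?powRr1 ?ltW//.
  by rewrite pnatr_eq0 -lt0n.
pose g y := K (rescale h x y).
have mg : measurable_fun setT g by exact: measurable_rescaled.
have mg2 : measurable_fun setT (fun y => (g y ^+ 2)%:E).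
  by apply/measurable_EFinP; exact: measurable_funX.
have mnK : measurable_fun setT (fun y => `|K y|) by exact: measurableT_comp.
have QM A : measurable A -> (Q A <= mscale (NngNum M0) lebd A)%E.
  move=> mA; rewrite Qf// /mscale/= -integral_cst//.
  apply: ge0_le_integral => //.
  - by move=> y _; rewrite lee_fin.
  - by apply/measurable_EFinP; exact: measurable_funTS.
  - by move=> y _; rewrite lee_fin (le_trans (ler_norm _)).
have step1 : (\int[Q]_y (g y ^+ 2)%:E <= M%:E * \int[lebd]_y (g y ^+ 2)%:E)%E.
  apply: (le_trans (ge0_le_measure_integral QM measurableT _ mg2)).
    by move=> y; rewrite lee_fin sqr_ge0.
  by rewrite ge0_integral_mscale// => y _; rewrite lee_fin sqr_ge0.
have step2 : (\int[lebd]_y (g y ^+ 2)%:E <= kap%:E * (h%:E * \int[lebd]_y (`|K y|)%:E))%E.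
  rewrite -[in X in (_ * (X * _))%E]sd -(integral_reflect_scale x s0 mnK)//.
  rewrite -ge0_integralZl//; last first.
  - apply/measurable_EFinP; apply: (measurableT_comp mnK).
    exact: measurable_reflect_scale.
  - apply: ge0_le_integral => //.
    + by move=> y _; rewrite lee_fin sqr_ge0.
    + apply: measurable_funeM; apply/measurable_EFinP; apply: (measurableT_comp mnK).
      exact: measurable_reflect_scale.
    + move=> y _; rewrite -EFinM lee_fin -real_normK ?num_real// expr2.
      by apply: ler_wpM2r => //; exact: Kk.
have iK1 : (\int[lebd]_y (`|K y|)%:E)%E = (\int[lebd]_y `|K y|)%:E.
  rewrite /Rintegral fineK//; apply: integrable_fin_num => //.
  exact: integrable_norm iK.
rewrite -lee_fin /Rintegral fineK; last first.
  rewrite ge0_fin_numE; last by apply: integral_ge0 => y _; rewrite lee_fin sqr_ge0.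
  apply: (le_lt_trans (le_trans step1 (lee_wpmul2l _ step2))).
    by rewrite lee_fin.
  by rewrite iK1 -!EFinM ltry.
apply: (le_trans (le_trans step1 (lee_wpmul2l _ step2))); first by rewrite lee_fin.
by rewrite iK1 -!EFinM lee_fin (mulrC h) !mulrA.
Qed.

(** The uniform entropy condition is applied to uniform distributions on finite
    samples, where [L_2] balls become Euclidean balls of sample vectors. *)
Section empirical_measure.
Variables (z : nat -> euclid R d) (n : nat).

Let ninv_ge0 : 0 <= n.+1%:R^-1 :> R. Proof. by rewrite invr_ge0. Qed.

Definition empirical : set (euclid R d) -> \bar R :=
  mscale (NngNum ninv_ge0) (msum (fun i => dirac (z i)) n.+1).

HB.instance Definition _ := Measure.on empirical.

Let empirical_setT : empirical setT = 1%E.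
Proof.
rewrite /empirical /mscale/= /msum (eq_bigr (fun=> 1%E)); last first.
  by move=> i _; rewrite /= diracT.
rewrite sumEFin sumr_const card_ord -EFinM -mulr_natl mulr1 mulVf//.
Qed.

HB.instance Definition _ := Measure_isProbability.Build _ _ _ empirical empirical_setT.

Lemma integral_empirical (F : euclid R d -> R) : measurable_fun setT F ->
  (forall y, 0 <= F y) ->
  (\int[empirical]_y (F y)%:E = (n.+1%:R^-1 * \sum_(i < n.+1) F (z i))%:E)%E.
Proof.
move=> mF F0; have mE : measurable_fun setT (EFin \o F) by exact/measurable_EFinP.
rewrite /empirical ge0_integral_mscale//=; last by move=> y _; rewrite lee_fin.
rewrite ge0_integral_measure_sum//; last by move=> y _; rewrite lee_fin.
rewrite EFinM -sumEFin; congr (_ * _)%E; apply: eq_bigr => i _.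
by rewrite integral_dirac// diracT mul1e.
Qed.

Lemma L2dist_empirical g g' r : measurable_fun setT g -> measurable_fun setT g' ->
  0 < r -> (L2dist empirical g g' < r%:E)%E ->
  \sum_(i < n.+1) (g (z i) - g' (z i)) ^+ 2 <= n.+1%:R * r ^+ 2.
Proof.
move=> mg mg' r0; rewrite /L2dist unlock.
rewrite (eq_integral (fun y => ((g y - g' y) ^+ 2)%:E)); last first.
  by move=> y _; rewrite /= ?abse_EFin ?poweR_EFin powR_mulrn// real_normK// num_real.
rewrite integral_empirical; last 2 first.
- by apply: measurable_funX; exact: measurable_funB.
- by move=> y; exact: sqr_ge0.
set S := \sum_(i < n.+1) _; have S0 : 0 <= S by apply: sumr_ge0 => i _; exact: sqr_ge0.
have n0' : 0 < n.+1%:R :> R by rewrite ltr0n.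
have nS0 : 0 <= n.+1%:R^-1 * S by rewrite mulr_ge0.
rewrite poweR_EFin lte_fin => h.
have : (n.+1%:R^-1 * S) `^ 2^-1 ^+ 2 <= r ^+ 2.
  by rewrite ler_sqr ?nnegrE ?powR_ge0 ?ltW.
rewrite -powR_mulrn ?powR_ge0// -powRrM mulVf// powRr1// mulrC ler_pdivrMr//.
by rewrite mulrC.
Qed.

End empirical_measure.

(** Centres in [L_2] are traded for centres in the class itself, at the price of
    doubling the radius. *)
Lemma empirical_cover K (kap C nu : R) (G : nat -> euclid R d -> R) (z : nat -> euclid R d)
    n (eps : R) : 0 < kap -> 0 <= C -> 0 < nu -> measurable_fun setT K ->
  (uniform_covering_number (kap * eps) (kernel_class K) <= (C * eps `^ (- nu))%:E)%E ->
  (forall k, kernel_class K (G k)) -> (0 < n)%N -> 0 < eps < 1 ->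
  exists T : seq nat, (size T)%:R <= (C + 1) * eps `^ (- nu) /\
    forall k, exists2 j, j \in T &
      \sum_(i < n) (G k (z i) - G j (z i)) ^+ 2 <= 4 * n%:R * (kap * eps) ^+ 2.
Proof.
move=> k0 C0 nu0 mK ent GK n0 /andP[e0 e1].
have mG k : measurable_fun setT (G k).
  by have [h [x [_ ->]]] := GK k; exact: measurable_rescaled.
case: n n0 => // n' _; pose Q : probability (euclid R d) R := empirical z n'.
have eps1 : 1 <= eps `^ (- nu).
  rewrite powRN invf_ge1 ?powR_gt0//.
  have p1 : (1 : R) `^ nu = 1 by rewrite powR1.
  by rewrite -[leRHS]p1 ge0_ler_powR ?nnegrE ?(ltW nu0) ?(ltW e0) ?(ltW e1).
(* An infimum need not be attained: one more ball is allowed, and absorbed into the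
   constant because [eps ^ (- nu)] is at least [1]. *)
have : (covering_number Q (kap * eps) (kernel_class K) <
    (C * eps `^ (- nu) + 1)%:E)%E.
  apply: (@le_lt_trans _ _ (C * eps `^ (- nu))%:E); last by rewrite lte_fin ltrDl.
  by apply: le_trans ent; apply: ereal_sup_ubound; exists Q.
move=> /ereal_inf_lt[_ [m [c [cL cover]] <-]]; rewrite lte_fin => mC.
have mc i : measurable_fun setT (c i).
  by have /andP[+ _] := cL i; rewrite inE.
have re0 : 0 < kap * eps by rewrite mulr_gt0.
pose pick i := xget 0%N [set k | (L2dist Q (G k) (c i) < (kap * eps)%:E)%E].
exists [seq pick i | i <- enum 'I_m]; split.
  by rewrite size_map size_enum_ord mulrDl mul1r (le_trans (ltW mC))// lerD2l.
move=> k; have [i ki] := cover _ (GK k).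
exists (pick i); first by apply: map_f; rewrite mem_enum.
have pi : (L2dist Q (G (pick i)) (c i) < (kap * eps)%:E)%E.
  by rewrite /pick; case: xgetP => [j -> //|/(_ k)].
have h1 := L2dist_empirical (mG k) (mc i) re0 ki.
have h2 := L2dist_empirical (mG (pick i)) (mc i) re0 pi.
apply: (@le_trans _ _ (\sum_(l < n'.+1) (2 * (G k (z l) - c i (z l)) ^+ 2 +
   2 * (G (pick i) (z l) - c i (z l)) ^+ 2))).
  apply: ler_sum => l _.
  by have := sqr_ge0 (G k (z l) - c i (z l) + (G (pick i) (z l) - c i (z l))); nra.
rewrite big_split/= -!mulr_sumr; lra.
Qed.

End kernel_class_facts.

(** * The maximal inequality at one bandwidth scale *)

Section one_scale.
Context (R : realType) (d : nat) (disp : measure_display).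
Context (Om : measurableType disp) (P : probability Om R).
Context (X : nat -> {RV P >-> euclid R d}).
Hypotheses (X_indep : mutually_independent X) (X_idist : identically_distributed X).
Context (K : euclid R d -> R) (kap C nu : R).
Hypotheses (kap_gt0 : 0 < kap) (C_ge0 : 0 <= C) (nu_gt0 : 0 < nu).
Hypotheses (K_meas : measurable_fun setT K) (K_le : forall y, `|K y| <= kap).
Hypothesis K_entropy : forall eps : R, 0 < eps < 1 ->
  (uniform_covering_number (kap * eps) (kernel_class K) <= (C * eps `^ (- nu))%:E)%E.

Local Notation Q := (distribution P (X 0%N)).
Local Notation S_ := (seqspace (euclid R d)).

(** The rate at which the logarithm of the covering number at radius
    [sqrt h / (2 * 4 ^ r)] grows with [L * r.+1], when [L] dominates [ln h^-1]. *)
Definition entropy_const : R := ln (C + 1) + nu * (ln 2 + ln 4 + 1).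

Lemma entropy_const_ge0 : 0 <= entropy_const.
Proof.
have l1 : 0 <= ln (C + 1) by apply: ln_ge0; rewrite lerDr.
have l2 : 0 <= ln (2 : R) by apply: ln_ge0; rewrite ler1n.
have l3 : 0 <= ln (4 : R) by apply: ln_ge0; rewrite ler1n.
by rewrite /entropy_const addr_ge0// mulr_ge0 ?(ltW nu_gt0)// !addr_ge0.
Qed.

Lemma net_size_le (h L : R) r : 0 < h -> 1 <= L -> ln h^-1 <= L ->
  (C + 1) * (Num.sqrt h / (2 * 4 ^+ r)) `^ (- nu) <=
    expR (entropy_const * L * r.+1%:R).
Proof.
move=> h0 L1 hL.
have C1 : 0 < C + 1 by rewrite ltr_wpDl.
have p4 : 0 < 4 ^+ r :> R by rewrite exprn_gt0.
have e0 : 0 < Num.sqrt h / (2 * 4 ^+ r) by rewrite divr_gt0 ?sqrtr_gt0// mulr_gt0.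
rewrite /powR gt_eqF// -[C + 1]lnK ?posrE// -expRD ler_expR.
have lnh : ln (Num.sqrt h) = ln h / 2.
  have : ln h = ln (Num.sqrt h ^+ 2) by rewrite sqr_sqrtr// ltW.
  by rewrite lnXn ?sqrtr_gt0// => ->; rewrite -[ln _ *+ 2]mulr_natr mulfK.
rewrite lnM ?posrE ?sqrtr_gt0 ?invr_gt0 ?mulr_gt0// lnV ?posrE ?mulr_gt0//.
rewrite lnM ?posrE// lnXn// lnh.
move: hL; rewrite lnV ?posrE// => hL.
have l1 : 0 <= ln (C + 1) by apply: ln_ge0; rewrite lerDr.
have l2 : 0 <= ln (2 : R) by apply: ln_ge0; rewrite ler1n.
have l4 : 0 <= ln (4 : R) by apply: ln_ge0; rewrite ler1n.
rewrite /entropy_const -[ln 4 *+ r]mulr_natr.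
set lc := ln (C + 1) in l1 *; set ll2 := ln 2 in l2 *; set ll4 := ln 4 in l4 *.
set lh := ln h in hL *; rewrite -[r.+1%:R]natr1.
have r0 : 0 <= r%:R :> R by [].
set rr := r%:R in r0 *.
have rL : 1 <= L * (rr + 1) by nra.
have a1 : lc <= lc * (L * (rr + 1)) by rewrite ler_peMr.
suff a2 : ll2 + ll4 * rr - lh / 2 <= (ll2 + ll4 + 1) * (L * (rr + 1)).
  have := ler_wpM2l (ltW nu_gt0) a2; lra.
have b1 : ll2 <= ll2 * (L * (rr + 1)) by rewrite ler_peMr.
have b2 : ll4 * rr <= ll4 * (L * (rr + 1)) by apply: ler_wpM2l => //; nra.
have b3 : - lh / 2 <= L * (rr + 1) by nra.
lra.
Qed.

Section bounds.
Context (D C0 : R) (N : nat) (h L : R) (G : nat -> euclid R d -> R).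
Hypotheses (D_ge0 : 0 <= D) (C0_kap : kap ^+ 2 * (1 + (entropy_const + 3) * D) <= C0).
Hypotheses (N_gt0 : (0 < N)%N) (h_gt0 : 0 < h) (h_le1 : h <= 1).
Hypotheses (L_ge1 : 1 <= L) (L_h : ln h^-1 <= L) (L_N : L <= D * (N%:R * h)).
Hypothesis G_kernel : forall k, kernel_class K (G k).
Hypothesis G_var : forall k, \int[Q]_y G k y ^+ 2 <= C0 * h.

(* [Y] is twice the expected sum of squares over one sample, [S] a level that the sum
   of squares over a double sample rarely exceeds, and [t] the threshold of the
   chaining argument at the level [S]. *)
Let C1 := entropy_const.
Let Y := 2 * N%:R * (C0 * h).
Let S := 68 * Y.
Let t := 16 * Num.sqrt (S * (C1 + 3) * L).

Let G_le k y : `|G k y| <= kap.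
Proof. by have [h' [x [_ ->]]] := G_kernel k; exact: K_le. Qed.

Let G_meas k : measurable_fun setT (G k).
Proof. by have [h' [x [_ ->]]] := G_kernel k; exact: (measurable_rescaled _ _ K_meas). Qed.

Let G_bmf k : bmf (G k). Proof. by split=> //; exists kap. Qed.

Let C1_ge0 : 0 <= C1. Proof. exact: entropy_const_ge0. Qed.

Let kap2_le : kap ^+ 2 <= C0.
Proof.
apply: le_trans C0_kap; rewrite ler_peMr ?sqr_ge0// lerDl mulr_ge0// addr_ge0//.
Qed.

Let C0_gt0 : 0 < C0. Proof. by apply: lt_le_trans kap2_le; rewrite exprn_gt0. Qed.

Let N_gt0' : 0 < N%:R :> R. Proof. by rewrite ltr0n. Qed.

Let Y_gt0 : 0 < Y. Proof. by rewrite /Y !mulr_gt0. Qed.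

Let S_gt0 : 0 < S. Proof. by rewrite /S mulr_gt0. Qed.

Let nets (z : S_) r : exists T : seq nat,
  (size T)%:R <= expR (C1 * L * r.+1%:R) /\
  forall k, exists2 j, j \in T &
    sqnorm N (fun i => G k (z i) - G j (z i)) <= Y / 16 ^+ r.
Proof.
have p4 : 0 < 4 ^+ r :> R by rewrite exprn_gt0.
have sh : 0 < Num.sqrt h by rewrite sqrtr_gt0.
pose eps := Num.sqrt h / (2 * 4 ^+ r).
have e0 : 0 < eps by rewrite divr_gt0// mulr_gt0.
have e1 : eps < 1.
  rewrite /eps ltr_pdivrMr ?mulr_gt0// mul1r.
  have s1 : Num.sqrt h <= 1 by rewrite -sqrtr1 ler_wsqrtr.
  have : 1 <= 4 ^+ r :> R by rewrite exprn_ege1// ler1n.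
  lra.
have e01 : 0 < eps < 1 by rewrite e0 e1.
have [T [Ts TG]] := @empirical_cover R d K kap C nu G z (N + N) eps kap_gt0 C_ge0
  nu_gt0 K_meas (K_entropy e01) G_kernel (ltn_addr _ N_gt0) e01.
exists T; split; first by apply: le_trans Ts _; exact: net_size_le.
move=> k; have [j jT] := TG k; rewrite big_split_ord/= => p; exists j => //.
rewrite /sqnorm big_split/=; apply: (le_trans p); rewrite /eps exprMn expr_div_n.
have -> : (16 : R) ^+ r = (4 ^+ r) ^+ 2.
  by rewrite -exprM mulnC exprM; congr (_ ^+ _); ring.
rewrite sqr_sqrtr ?(ltW h_gt0)//.
rewrite exprMn natrD /Y ler_pdivlMr ?exprn_gt0//.
have -> : 4 * (N%:R + N%:R) * (kap ^+ 2 * (h / (2 ^+ 2 * (4 ^+ r) ^+ 2))) * (4 ^+ r) ^+ 2 =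
   2 * N%:R * (kap ^+ 2 * h) by field; rewrite gt_eqF.
by rewrite ler_pM2l ?mulr_gt0// ler_pM2r.
Qed.

Let measurable_sum_coord (F : nat -> euclid R d -> R) (a : nat -> nat) m :
  (forall i, measurable_fun setT (F i)) ->
  measurable_fun [set: S_] (fun z : S_ => \sum_(i < m) F i (z (a i))).
Proof.
move=> mF; apply: measurable_sum => i.
by apply: (measurableT_comp (mF i)); exact: measurable_coord.
Qed.

Let measurable_sq k : measurable_fun setT (fun y => G k y ^+ 2).
Proof. exact: measurable_funX. Qed.

Let mseq (A : set S_) : measurable A -> measurable (seq_obs X id @^-1` A).
Proof.
by move=> mA; rewrite -[X in measurable X]setTI; exact: measurable_seq_obs.
Qed.

Let large_half : set S_ := [set z : S_ | exists k, 34 * Y < \sum_(i < N) G k (z i) ^+ 2].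

Let m_large_half : measurable large_half.
Proof.
rewrite (_ : large_half = \bigcup_k [set z : S_ | 34 * Y < \sum_(i < N) G k (z i) ^+ 2]).
  apply: bigcupT_measurable => k; apply: measurable_gt_set.
  exact: (@measurable_sum_coord (fun=> (fun y => G k y ^+ 2)) id N).
by apply/seteqP; split=> z [k]; [exists k|exists k].
Qed.

(** An event of the first [m] coordinates does not change when all indices are capped
    at [N.-1], and the capped sequence consists of observations of the first block. *)
Let sig_first m (A : set S_) (B : set Om) : (m <= N)%N -> measurable A ->
  (forall z z' : S_, (forall i, (i < m)%N -> z i = z' i) -> A z -> A z') ->
  B = seq_obs X id @^-1` A -> sig_obs X [set i | (i < N)%N] B.
Proof.
move=> mN mA Am ->.
have -> : seq_obs X id @^-1` A = seq_obs X (fun i => minn i N.-1) @^-1` A.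
  have E w i : (i < m)%N -> seq_obs X id w i = seq_obs X (fun i => minn i N.-1) w i.
    move=> im; rewrite /seq_obs; congr (X _ w); apply/esym/minn_idPl.
    by rewrite -ltnS prednK// (leq_trans im).
  apply/seteqP; split=> w /=; apply: Am => i im; first exact: E.
  by apply/esym/E.
apply: seq_obs_sig => // i /=.
by rewrite gtn_min prednK ?leqnn ?orbT.
Qed.

Let sig_second (A : set S_) :  measurable A ->
  sig_obs X [set i | (N <= i)%N] (seq_obs X (addn N) @^-1` A).
Proof. by move=> mA; apply: seq_obs_sig => // i /=; exact: leq_addr. Qed.

Let blocks_disj : [set i | (i < N)%N] `&` [set i | (N <= i)%N] = set0.
Proof. by apply/seteqP; split=> // i [/= iN]; rewrite leqNgt iN. Qed.

Let q := expR (- (3 * L)).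

(** With probability one half the ghost sample has a second moment of normal size, so
    a large one in the sample itself produces an unlikely imbalance. *)
Let half_pr : pr P (seq_obs X id @^-1` large_half) <= 4 * q.
Proof.
pose both : set S_ := [set z : S_ | exists k, 34 * Y < \sum_(i < N) G k (z i) ^+ 2 /\
  \sum_(i < N) G k (z (N + i)%N) ^+ 2 <= Y].
have m1 k : measurable [set z : S_ | 34 * Y < \sum_(i < N) G k (z i) ^+ 2].
  apply: measurable_gt_set.
  exact: (@measurable_sum_coord (fun=> (fun y => G k y ^+ 2)) id N).
have m2 (a : nat -> nat) k : measurable [set z : S_ | \sum_(i < N) G k (z (a i)) ^+ 2 <= Y].
  apply: measurable_le_set.
  exact: (@measurable_sum_coord (fun=> (fun y => G k y ^+ 2)) a N).
have mb : measurable both.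
  rewrite (_ : both = \bigcup_k ([set z : S_ | 34 * Y < \sum_(i < N) G k (z i) ^+ 2] `&`
      [set z : S_ | \sum_(i < N) G k (z (N + i)%N) ^+ 2 <= Y])).
    by apply: bigcupT_measurable => k; apply: measurableI.
  by apply/seteqP; split=> z [k]; [exists k|exists k].
have bpr : pr P (seq_obs X id @^-1` both) <= 2 * q.
  apply: (symmetrized_pr X_indep X_idist (N := N)) => // z.
  have [T [Ts TG]] := nets z 0.
  have TG' k : exists2 j, j \in T & sqnorm N (fun i => G k (z i) - G j (z i)) <= Y.
    by have := TG k; rewrite expr0 divr1.
  have := @half_sample_tail R (fun k i => G k (z i)) N T kap Y kap_gt0 Y_gt0
    (fun k i => G_le k (z i)) TG'.
  move=> hs; apply: (le_trans hs); rewrite mulrCA ler_pM2l//.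
  apply: (le_trans (ler_wpM2r _ Ts)); first exact: expR_ge0.
  rewrite -expRD /q ler_expR mulr1.
  have k20 : 0 < kap ^+ 2 by rewrite exprn_gt0.
  suff : (C1 + 3) * L <= Y / (2 * kap ^+ 2) by lra.
  rewrite ler_pdivlMr ?mulr_gt0// /Y.
  have e1 : kap ^+ 2 * ((C1 + 3) * D) <= C0.
    by apply: le_trans C0_kap; rewrite ler_pM2l// lerDr.
  have e2 : (C1 + 3) * L <= (C1 + 3) * (D * (N%:R * h)).
    by apply: ler_wpM2l => //; move: C1_ge0 => ?; lra.
  have e3 := ler_wpM2r (ltW k20) e2.
  have e4 : kap ^+ 2 * ((C1 + 3) * D) * (N%:R * h) <= C0 * (N%:R * h).
    by apply: ler_wpM2r => //; rewrite mulr_ge0 ?ltW.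
  lra.
have -> : 4 * q = 2 * (2 * q) by ring.
apply: (@le_trans _ _ (2 * pr P (seq_obs X id @^-1` both))); last by rewrite ler_pM2l.
rewrite (_ : _ @^-1` large_half =
    \bigcup_k (seq_obs X id @^-1` [set z : S_ | 34 * Y < \sum_(i < N) G k (z i) ^+ 2])).
  apply: (ghost_sample X_indep X_idist blocks_disj
    (W := fun k => seq_obs X (addn N) @^-1`
       [set z : S_ | \sum_(i < N) G k (z i) ^+ 2 <= Y])).
  - move=> k; apply: (sig_first (leqnn N) (m1 k)) => // z z' zz'.
    by rewrite /= (eq_bigr (fun i : 'I_N => G k (z' i) ^+ 2))// => i _; rewrite zz'.
  - by move=> k; apply: sig_second; exact: (m2 id k).
  - exact: mseq.
  - move=> k; have := sum_sq_pr X_idist N (G_bmf k) (G_var k) _ N_gt0.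
    by apply; rewrite mulr_gt0.
  - by move=> k w [h1 h2]; exists k.
by apply/seteqP; split=> w [k]; [exists k|exists k].
Qed.

Let large_sq : set S_ := [set z : S_ | exists k, S < sqnorm N (fun i => G k (z i))].

Let m_large_sq : measurable large_sq.
Proof.
rewrite (_ : large_sq = \bigcup_k [set z : S_ | S < sqnorm N (fun i => G k (z i))]).
  apply: bigcupT_measurable => k; apply: measurable_gt_set.
  rewrite (_ : (fun z => _) = (fun z : S_ =>
      \sum_(i < N) G k (z i) ^+ 2 + \sum_(i < N) G k (z (N + i)%N) ^+ 2)).
    apply: measurable_funD.
      exact: (@measurable_sum_coord (fun=> (fun y => G k y ^+ 2)) id N).
    exact: (@measurable_sum_coord (fun=> (fun y => G k y ^+ 2)) (addn N) N).
  by apply/funext => z; rewrite /sqnorm big_split.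
by apply/seteqP; split=> z [k]; [exists k|exists k].
Qed.

(** One of the two halves of the double sample is large, and they have the same
    law. *)
Let large_sq_pr : pr P (seq_obs X id @^-1` large_sq) <= 8 * q.
Proof.
pose sw := fswap N (fun=> true).
have msw : measurable (seq_obs X sw @^-1` large_half).
  by rewrite -[X in measurable X]setTI; exact: measurable_seq_obs.
apply: (@le_trans _ _ (pr P (seq_obs X id @^-1` large_half `|`
    seq_obs X sw @^-1` large_half))).
  apply: pr_sub; [exact: mseq|by apply: measurableU => //; exact: mseq|].
  move=> w [k]; rewrite /sqnorm big_split/= => h1.
  have [h2|h2] := ltP (34 * Y) (\sum_(i < N) G k (X i w) ^+ 2).
    by left; exists k.
  right; exists k; rewrite /seq_obs.
  rewrite (eq_bigr (fun i : 'I_N => G k (X (N + i)%N w) ^+ 2)); last first.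
    by move=> i _; rewrite /sw fswap_lt.
  move: h1; rewrite /S /seq_obs => h1.
  have : 68 * Y = 34 * Y + 34 * Y by lra.
  by move=> E; rewrite E in h1; move: h1 h2; set a := \sum_(i < N) _; set b := \sum_(i < N) _;
    lra.
apply: (le_trans (pr_setU P (mseq m_large_half) msw)).
rewrite (seq_obs_law X_indep X_idist (can_inj (fswapK N (fun=> true))) m_large_half).
by have := half_pr; lra.
Qed.

Let large_dev : set S_ := [set z : S_ | exists k, exists2 m, (m <= N)%N &
  3 * t < `|\sum_(i < m) (G k (z i) - G k (z (N + i)%N))|].

Let m_large_dev : measurable large_dev.
Proof.
rewrite (_ : large_dev = \bigcup_k \bigcup_(m in [set m | (m <= N)%N])
   [set z : S_ | 3 * t < `|\sum_(i < m) (G k (z i) - G k (z (N + i)%N))|]).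
  apply: bigcupT_measurable => k; apply: bigcup_measurable => m _.
  apply: measurable_gt_set; apply: measurableT_comp => //.
  rewrite (_ : (fun z => _) = (fun z : S_ =>
      \sum_(i < m) G k (z i) - \sum_(i < m) G k (z (N + i)%N))).
    apply: measurable_funB.
      exact: (@measurable_sum_coord (fun=> G k) id m).
    exact: (@measurable_sum_coord (fun=> G k) (addn N) m).
  by apply/funext => z; rewrite sumrB.
by apply/seteqP; split=> z; [move=> [k [m mN hm]]; exists k => //; exists m|
  move=> [k _ [m mN hm]]; exists k, m].
Qed.

(** Off the event of large second moments, chaining under random exchanges
    applies. *)
Let large_dev_pr : pr P (seq_obs X id @^-1` large_dev) <= 12 * q.
Proof.
have mD : measurable (large_dev `\` large_sq) by exact: measurableD.
have dpr : pr P (seq_obs X id @^-1` (large_dev `\` large_sq)) <= 4 * q.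
  apply: (symmetrized_pr X_indep X_idist (N := N)) => // z.
  have [zL|zL] := pselect (large_sq z).
    rewrite (_ : [set s | _] = set0) ?freq0 ?mulr_ge0 ?expR_ge0//.
    apply/seteqP; split=> // s [_]; apply.
    have [k hk] := zL; exists k.
    by rewrite -(sqnorm_fswap N s) in hk.
  have v_bound k : sqnorm N (fun i => G k (z i)) <= S.
    by rewrite leNgt; apply/negP => hk; apply: zL; exists k.
  pose T r := sval (cid (nets z r)).
  have T_size r : (size (T r))%:R <= expR (C1 * L * r.+1%:R).
    by rewrite /T; case: cid => /= ? [].
  have T_net r k : exists2 j, j \in T r &
      sqnorm N (fun i => G k (z i) - G j (z i)) <= S / 16 ^+ r.
    rewrite /T; case: cid => /= T' [_ /(_ k)[j jT h1]]; exists j => //.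
    apply: (le_trans h1); rewrite ler_pM2r ?invr_gt0 ?exprn_gt0// /S.
    by rewrite ler_peMl ?(ltW Y_gt0)// ler1n.
  have CB : C1 + 1 <= C1 + 3 by rewrite lerD2l ler1n.
  have := chaining_tail S_gt0 L_ge1 C1_ge0 CB v_bound T_size T_net.
  rewrite (_ : C1 + 3 - C1 = 3); last by ring.
  apply: le_trans; apply: freq_sub => s [[k [m mN hm]] _].
  exists k, m => //; move: hm; rewrite -/t; congr (_ < `|_|).
  rewrite /rsum; apply: eq_bigr => i _.
  have iN : (i < N)%N by exact: leq_trans mN.
  by have := fold_diff_fswap s (fun j => G k (z j)) (Ordinal iN).
apply: (@le_trans _ _ (pr P (seq_obs X id @^-1` large_sq `|`
    seq_obs X id @^-1` (large_dev `\` large_sq)))).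
  apply: pr_sub; [exact: mseq|by apply: measurableU; exact: mseq|].
  by move=> w hw; have [?|?] := pselect (large_sq (seq_obs X id w)); [left|right].
apply: (le_trans (pr_setU P (mseq m_large_sq) (mseq mD))).
by have := large_sq_pr; lra.
Qed.

Let t_gt0 : 0 < t.
Proof.
rewrite /t mulr_gt0// sqrtr_gt0 !mulr_gt0//.
  by rewrite ltr_wpDl.
by apply: lt_le_trans L_ge1.
Qed.

(** By Chebyshev's inequality the centred sum over the ghost sample is below [3 t]
    with probability one half, so a centred sum above [6 t] produces a difference
    above [3 t]. The sample sizes [m <= N] are treated as part of the index. *)
Lemma one_scale_tail :
  pr P [set w | exists k, exists2 m, (m <= N)%N &
    6 * t < `|\sum_(i < m) (G k (X i w) - \int[Q]_y G k y)|] <= 24 * q.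
Proof.
pose dec n : nat * nat := odflt (0%N, 0%N) (unpickle n).
pose mu k := \int[Q]_y G k y.
pose Us n : set S_ := if ((dec n).2 <= N)%N then
  [set z : S_ | 6 * t < `|\sum_(i < (dec n).2) (G (dec n).1 (z i) - mu (dec n).1)|] else set0.
pose Ws n : set S_ := if ((dec n).2 <= N)%N then
  [set z : S_ | `|\sum_(i < (dec n).2) (G (dec n).1 (z i) - mu (dec n).1)| <= 3 * t] else setT.
have msum k m : measurable_fun setT (fun z : S_ => `|\sum_(i < m) (G k (z i) - mu k)|).
  apply: measurableT_comp => //.
  apply: (@measurable_sum_coord (fun=> (fun y => G k y - mu k)) id m) => _.
  by apply: measurable_funB => //.
have mUs n : measurable (Us n).
  by rewrite /Us; case: ifP => // _; apply: measurable_gt_set.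
have mWs n : measurable (Ws n).
  by rewrite /Ws; case: ifP => // _; apply: measurable_le_set.
rewrite (_ : [set w | _] = \bigcup_n seq_obs X id @^-1` Us n); last first.
  apply/seteqP; split=> w.
    move=> [k [m mN hm]]; exists (pickle (k, m)) => //.
    by rewrite /Us /dec /= pickleK/= mN.
  move=> [n _]; rewrite /Us /=; case: ifP => // mN hm.
  by exists (dec n).1, (dec n).2.
have -> : 24 * q = 2 * (12 * q) by ring.
apply: (@le_trans _ _ (2 * pr P (seq_obs X id @^-1` large_dev))); last first.
  by rewrite ler_pM2l//; exact: large_dev_pr.
apply: (ghost_sample X_indep X_idist blocks_disj
  (W := fun n => seq_obs X (addn N) @^-1` Ws n)).
- move=> n; rewrite /Us; case: ifP => mN; last first.
    by rewrite preimage_set0; exact: sigma_algebra0.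
  apply: (@sig_first (dec n).2 [set z : S_ | 6 * t <
    `|\sum_(i < (dec n).2) (G (dec n).1 (z i) - mu (dec n).1)|]) => //.
    by apply: measurable_gt_set.
  move=> z z' zz' /=.
  by rewrite (eq_bigr (fun i : 'I__ => G (dec n).1 (z' i) - mu (dec n).1))// => i _;
    rewrite zz'.
- by move=> n; exact: sig_second.
- exact: mseq.
- move=> n; rewrite /Ws; case: ifP => mN; last first.
    by rewrite preimage_setT pr_setT invf_le1// ler1n.
  have t3 : 0 < 3 * t by rewrite mulr_gt0.
  apply: (centred_sum_pr X_indep X_idist N (G_bmf (dec n).1) (G_var _) t3).
  apply: (@le_trans _ _ Y).
    rewrite /Y -[leRHS]mulrA ler_pM2l// ler_pM2r ?mulr_gt0//.
    by rewrite ler_nat.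
  rewrite /t !exprMn sqr_sqrtr; last first.
    by rewrite ltW// !mulr_gt0// ?ltr_wpDl//; exact: lt_le_trans L_ge1.
  have e1 : 1 <= (C1 + 3) * L by rewrite mulr_ege1//; move: C1_ge0 => ?; lra.
  have e2 : Y * 1 <= Y * ((C1 + 3) * L) by rewrite ler_pM2l.
  have -> : 3 ^+ 2 * (16 ^+ 2 * (S * (C1 + 3) * L)) = 9 * (256 * (68 * (Y * ((C1 + 3) * L)))).
    by rewrite /S; ring.
  by move: e2 Y_gt0; set y := Y; set w := y * (_ * _); lra.
- move=> n w []; rewrite /Us /Ws /=; case: ifP => // mN h1 h2.
  exists (dec n).1, (dec n).2 => //.
  set k := (dec n).1 in h1 h2 *; set m := (dec n).2 in h1 h2 *.
  pose a := \sum_(i < m) (G k (X i w) - mu k).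
  pose b := \sum_(i < m) (G k (X (N + i)%N w) - mu k).
  have -> : \sum_(i < m) (G k (seq_obs X id w i) - G k (seq_obs X id w (N + i)%N)) = a - b.
    by rewrite -sumrB; apply: eq_bigr => i _; rewrite /seq_obs; ring.
  have h1' : 6 * t < `|a| by exact: h1.
  have h2' : `|b| <= 3 * t by exact: h2.
  by apply: lt_le_trans (lerB_dist a b); rewrite ltrBrDr; apply: le_lt_trans h1'; lra.
Qed.

End bounds.
End one_scale.

(** * The almost sure upper bound *)

Section borel_cantelli_telescope.
Context d (T : measurableType d) (R : realType) (P : probability T R).
Implicit Types A E : nat -> set T.

Lemma pr_bigcup_lt A n b : (forall j, measurable (A j)) ->
  (forall j, (j < n)%N -> pr P (A j) <= b) -> pr P (\bigcup_(j < n) A j) <= n%:R * b.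
Proof.
move=> mA; elim: n => [|n IH] Ab.
  by rewrite mul0r (_ : \bigcup_(_ < _) _ = set0) ?pr_set0//; apply/seteqP; split=> // x [].
have -> : \bigcup_(j < n.+1) A j = (\bigcup_(j < n) A j) `|` A n.
  apply/seteqP; split=> x.
    by move=> [j /=]; rewrite ltnS leq_eqVlt => /predU1P[->|jn] Ax; [right|left; exists j].
  move=> [[j /= jn Ax]|Ax]; first by exists j => //=; exact: ltnW.
  by exists n => /=.
have mU : measurable (\bigcup_(j < n) A j) by exact: bigcup_measurable.
apply: (le_trans (pr_setU P mU (mA n))).
rewrite -natr1 mulrDl mul1r lerD//; last exact: Ab.
by apply: IH => j jn; apply: Ab; exact: ltnW.
Qed.

(** The first Borel-Cantelli lemma, for probabilities dominated by the telescoping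
    series of [k^-1 - k.+1^-1]. *)
Lemma ae_eventually_not E k0 (b : R) : (0 < k0)%N -> 0 <= b ->
  (forall k, measurable (E k)) ->
  (forall k, (k0 <= k)%N -> pr P (E k) <= b * (k%:R^-1 - k.+1%:R^-1)) ->
  {ae P, forall w, exists k1, forall k, (k1 <= k)%N -> ~ E k w}.
Proof.
move=> k00 b0 mE Eb; pose U m := \bigcup_i E (m + i)%N.
have mU m : measurable (U m) by exact: bigcup_measurable.
have Um m : (k0 <= m)%N -> pr P (U m) <= b / m%:R.
  move=> km; have m0 : (0 < m)%N := leq_trans k00 km.
  apply: pr_bigcup_le => // n; apply: (@le_trans _ _ (b * (m%:R^-1 - (m + n)%:R^-1))).
    elim: n => [|n IH].
      rewrite addn0 subrr mulr0 (_ : \bigcup_(_ < _) _ = set0) ?pr_set0//.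
      by apply/seteqP; split=> // x [].
    have -> : \bigcup_(j < n.+1) E (m + j)%N = (\bigcup_(j < n) E (m + j)%N) `|` E (m + n)%N.
      apply/seteqP; split=> x.
        by move=> [j /=]; rewrite ltnS leq_eqVlt => /predU1P[->|jn] Ax; [right|left; exists j].
      move=> [[j /= jn Ax]|Ax]; first by exists j => //=; exact: ltnW.
      by exists n => /=.
    have mU' : measurable (\bigcup_(j < n) E (m + j)%N) by exact: bigcup_measurable.
    apply: (le_trans (pr_setU P mU' (mE _))).
    have := Eb (m + n)%N (leq_trans km (leq_addr _ _)); rewrite addnS.
    by move=> h; apply: (le_trans (lerD IH h)); rewrite -mulrDr addrA subrK.
  have : 0 <= b * (m + n)%:R^-1 by rewrite mulr_ge0// invr_ge0.
  by lra.
exists (\bigcap_m U m); split.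
- exact: bigcapT_measurable.
- have mI : measurable (\bigcap_m U m) by exact: bigcapT_measurable.
  rewrite prE//; congr EFin; apply/eqP; rewrite eq_le pr_ge0 andbT.
  apply/ler_addgt0Pl => e e0; rewrite addr0.
  pose m := maxn k0 (Num.truncn (b / e)).+1.
  apply: (@le_trans _ _ (pr P (U m))); first by apply: pr_sub => // w; apply.
  apply: (le_trans (Um m (leq_maxl _ _))).
  have m0 : 0 < m%:R :> R by rewrite ltr0n leq_max k00.
  rewrite ler_pdivrMr// mulrC -ler_pdivrMr//.
  have be : 0 <= b / e by rewrite divr_ge0// ltW.
  have /andP[_ h] := truncn_itv be.
  by apply: (le_trans (ltW h)); rewrite ler_nat leq_maxr.
- move=> w /= nw m _; have [//|nU] := pselect (U m w); exfalso; apply: nw.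
  exists m => k mk Ekw; apply: nU; exists (k - m)%N => //.
  by rewrite subnKC.
Qed.

Lemma Rintegral_bounded_cvg (u : nat -> T -> R) (g : T -> R) (M : R) :
  (forall m, measurable_fun setT (u m)) -> (forall m x, `|u m x| <= M) ->
  (forall x, u ^~ x @ \oo --> g x) ->
  \int[P]_x u m x @[m --> \oo] --> \int[P]_x g x.
Proof.
move=> mu uM ug.
have bg : bmf g.
  split; first exact: (measurable_fun_cvg mu (fun x _ => ug x)).
  exists M => x; have h : `|u m x| @[m --> \oo] --> `|g x| by exact: cvg_norm (ug x).
  rewrite -(cvg_lim _ h)//; apply: limr_le; first by apply/cvg_ex; eexists; exact: h.
  by apply: nearW => m.
have bu m : bmf (u m) by split => //; exists M.
apply: fine_cvg.
rewrite fineK; last by apply: integrable_fin_num => //; exact: bmf_integrable.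
apply: (@dominated_cvg _ _ _ P setT measurableT (fun m => EFin \o u m) (EFin \o g)
  (cst M%:E)) => //.
- by move=> m; apply/measurable_EFinP.
- by move=> x _; apply: cvg_EFin; [exact: nearW|exact: ug].
- by apply: (@bmf_integrable _ _ _ P (fun=> M)); exact: bmf_cst.
- by move=> m x _ /=; rewrite lee_fin.
Qed.

End borel_cantelli_telescope.

Section upper_bound.
Context (R : realType) (d : nat) (disp : measure_display).
Context (Om : measurableType disp) (P : probability Om R).
Context (X : nat -> {RV P >-> euclid R d}) (f K : euclid R d -> R) (kap M c : R).
Hypotheses (d_ge1 : (1 <= d)%N).
Hypotheses (X_indep : mutually_independent X) (X_idist : identically_distributed X).
Hypotheses (f_density : has_lebesgue_density (distribution P (X 0%N)) f).
Hypotheses (f_bounded : forall x, `|f x| <= M).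
Hypotheses (K_meas : measurable_fun setT K).
Hypotheses (K_integrable : (@lebesgue_euclid R d).-integrable setT (EFin \o K)).
Hypotheses (kap_gt0 : 0 < kap) (K_le : forall y, `|K y| <= kap).
Hypotheses (K_entropy : uniform_entropy_condition K kap).
Hypotheses (K_pointwise : pointwise_measurable_class (kernel_class K)).
Hypotheses (c_gt0 : 0 < c).

Local Notation Q := (distribution P (X 0%N)).

Let origin : euclid R d := [tuple 0 | i < d].

Lemma bmf_kernel g : kernel_class K g -> bmf g.
Proof.
by move=> [h [x [_ ->]]]; split; [exact: measurable_rescaled|exists kap].
Qed.

Definition var_const : R := M * kap * (\int[@lebesgue_euclid R d]_y `|K y|).

Lemma kernel_var_le h x : 0 < h ->
  \int[Q]_y K (rescale h x y) ^+ 2 <= var_const * h.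
Proof. by move=> h0; exact: kernel_sq_integral f_density _ _ _ _ _. Qed.

(** A countable family inside the kernel class that dominates all kernels of
    bandwidth at most [hb]. The bandwidth of an approximant is not controlled by
    pointwise convergence, but its second moment is. *)
Lemma dominating_family (C0 hb : R) : var_const < C0 -> 0 < hb ->
  exists G : nat -> euclid R d -> R, [/\ forall k, kernel_class K (G k),
    forall k, \int[Q]_y G k y ^+ 2 <= C0 * hb &
    forall h x n w u, 0 < h <= hb ->
      u < `|\sum_(i < n) (K (rescale h x (X i w)) - \int[Q]_y K (rescale h x y))| ->
      exists k, u < `|\sum_(i < n) (G k (X i w) - \int[Q]_y G k y)| ].
Proof.
move=> vC hb0; have [F0 [cF0 F0K F0d]] := K_pointwise.
have [e F0e] : exists e : nat -> euclid R d -> R, set_surj setT F0 e.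
  exact/pcard_surjP.
pose g0 y := K (rescale hb origin y).
have g0K : kernel_class K g0 by exists hb, origin.
pose G k := if pselect (F0 (e k) /\ \int[Q]_y e k y ^+ 2 <= C0 * hb) then e k else g0.
exists G; split.
- by move=> k; rewrite /G; case: pselect => [[F0ek vk]|nk] //=; exact: F0K.
- move=> k; rewrite /G; case: pselect => [[F0ek vk] //|nk /=].
  apply: (le_trans (kernel_var_le _ hb0)); rewrite ler_wpM2r ?(ltW hb0)//; exact: ltW.
move=> h x n w u /andP[h0 hhb] hu.
pose g y := K (rescale h x y).
have gK : kernel_class K g by exists h, x.
have [v [vF0 vg]] := F0d g gK.
have vK m : kernel_class K (v m) by exact: F0K.
have vm m := (bmf_kernel (vK m)).1.
have vle m y : `|v m y| <= kap by have [h' [x' [_ ->]]] := vK m.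
have c1 : \int[Q]_y v m y @[m --> \oo] --> \int[Q]_y g y.
  exact: Rintegral_bounded_cvg vg.
have c2 : \int[Q]_y v m y ^+ 2 @[m --> \oo] --> \int[Q]_y g y ^+ 2.
  apply: (@Rintegral_bounded_cvg _ _ _ Q (fun m y => v m y ^+ 2) _ (kap ^+ 2)).
  - by move=> m; exact: measurable_funX.
  - by move=> m y; rewrite normrX lerXn2r ?nnegrE// ltW.
  - by move=> y; under eq_fun do rewrite expr2; rewrite expr2; exact: cvgM.
have c3 : `|\sum_(i < n) (v m (X i w) - \int[Q]_y v m y)| @[m --> \oo] -->
    `|\sum_(i < n) (g (X i w) - \int[Q]_y g y)|.
  apply: cvg_norm; apply: cvg_big => [|i _]; first exact: add_continuous.
  by apply: cvgB => //; exact: vg.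
have lt2 : \int[Q]_y g y ^+ 2 < C0 * hb.
  apply: (@le_lt_trans _ _ (var_const * hb)); last by rewrite ltr_pM2r.
  apply: (le_trans (kernel_var_le _ h0)); rewrite ler_wpM2l// /var_const.
  rewrite !mulr_ge0 ?(ltW kap_gt0)//.
    exact: le_trans (normr_ge0 _) (f_bounded origin).
  by apply: Rintegral_ge0.
have n1 : \forall m \near \oo, u < `|\sum_(i < n) (v m (X i w) - \int[Q]_y v m y)|.
  exact: cvgr_gt c3 _ hu.
have n2 : \forall m \near \oo, \int[Q]_y v m y ^+ 2 < C0 * hb.
  exact: cvgr_lt c2 _ lt2.
have [m _ /(_ m (leqnn m))[m1 m2]] := filterI n1 n2.
have [k _ ek] := F0e _ (vF0 m).
exists k; rewrite /G; case: pselect => [Fe|nFe] /=; first by rewrite ek.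
by case: nFe; rewrite ek; split => //; exact: ltW.
Qed.

(** Blocks of sample sizes [2 ^ k.-1 < n <= 2 ^ k] and of bandwidths
    [2 ^- j.+1 < h <= 2 ^- j]. The maximal inequality gives each pair of blocks an
    exceptional probability of order [(log N) ^ -3] with [N = 2 ^ k]; there are at
    most [k + 1] relevant bandwidth blocks, which leaves a summable bound. *)
Lemma kernel_sum_bound : exists A : R, {ae P, forall w, exists n0, forall n, (n0 <= n)%N ->
  forall h x, c * ln n%:R / n%:R <= h <= 1 ->
  `|\sum_(i < n) (K (rescale h x (X i w)) - \int[Q]_y K (rescale h x y))| <=
  A * Num.sqrt (n%:R * h * Num.max (ln h^-1) (ln (ln n%:R)))}.
Proof.
have [C [nu [C_gt0 nu_gt0 K_ent]]] := K_entropy.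
pose C1 := entropy_const C nu.
have C1_ge0 : 0 <= C1 by apply: entropy_const_ge0 => //; exact: ltW.
pose D := 2 / c; have D_ge0 : 0 <= D by rewrite divr_ge0// ltW.
pose C0 := Num.max (var_const + 1) (kap ^+ 2 * (1 + (C1 + 3) * D)).
have vC0 : var_const < C0 by rewrite lt_max ltrDl ltr01.
have kC0 : kap ^+ 2 * (1 + (C1 + 3) * D) <= C0 by rewrite le_max lexx orbT.
have C0_gt0 : 0 < C0.
  apply: lt_le_trans kC0; rewrite mulr_gt0 ?exprn_gt0//.
  by rewrite ltr_wpDr// mulr_ge0// addr_ge0.
pose l : R := ln 2; have l0 : 0 < l by rewrite ln_gt0// ltr1n.
pose hb (j : nat) : R := 2^-1 ^+ j.
have hb0 j : 0 < hb j by rewrite exprn_gt0// invr_gt0.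
have hb1 j : hb j <= 1 by rewrite exprn_ile1// ?invr_ge0// invf_le1// ler1n.
have lnhb j : ln (hb j)^-1 = j%:R * l.
  by rewrite /hb exprVn invrK lnXn// -[ln _ *+ j]mulr_natl.
pose N k : nat := (2 ^ k)%N.
have N0 k : (0 < N k)%N by rewrite expn_gt0.
have NE k : (N k)%:R = 2 ^+ k :> R by rewrite natrX.
have lnN k : ln (N k)%:R = k%:R * l.
  by rewrite NE lnXn// -[ln _ *+ k]mulr_natl.
pose L k j := Num.max (ln (hb j)^-1) (Num.max (ln (ln (N k)%:R)) 1).
pose G_ j := sval (cid (dominating_family vC0 (hb0 j))).
have G_P j : [/\ forall k, kernel_class K (G_ j k),
    forall k, \int[Q]_y G_ j k y ^+ 2 <= C0 * hb j &
    forall h x n w u, 0 < h <= hb j ->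
      u < `|\sum_(i < n) (K (rescale h x (X i w)) - \int[Q]_y K (rescale h x y))| ->
      exists k, u < `|\sum_(i < n) (G_ j k (X i w) - \int[Q]_y G_ j k y)| ].
  by rewrite /G_; case: cid.
pose thr k j := 6 * (16 * Num.sqrt (68 * (2 * (N k)%:R * (C0 * hb j)) * (C1 + 3) * L k j)).
pose bad1 k j := [set w | exists i, exists2 m, (m <= N k)%N &
    thr k j < `|\sum_(l < m) (G_ j i (X l w) - \int[Q]_y G_ j i y)|].
have mbad1 k j : measurable (bad1 k j).
  rewrite (_ : bad1 k j = \bigcup_i \bigcup_(m in [set m | (m <= N k)%N])
      [set w | thr k j < `|\sum_(l < m) (G_ j i (X l w) - \int[Q]_y G_ j i y)|]).
    apply: bigcupT_measurable => i; apply: bigcup_measurable => m _.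
    apply: measurable_gt_set; apply: measurableT_comp => //.
    apply: measurable_sum => l'; apply: measurable_funB => //.
    have [/(_ i) Gk _ _] := G_P j.
    exact: (bmf_obs X l' (bmf_kernel Gk)).1.
  by apply/seteqP; split=> w; [move=> [i [m mN hm]]; exists i => //; exists m|
    move=> [i _ [m mN hm]]; exists i, m].
pose cnd k j := c * (k.-1%:R * l) <= (N k)%:R * hb j.
pose E k := \bigcup_(j < k.+1) (if cnd k j then bad1 k j else set0).
have mE k : measurable (E k).
  by apply: bigcup_measurable => j _; case: ifP.
pose z : R := Num.max 2 (Num.max c^-1 (expR 1)) / l.
have z0 : 0 <= z by rewrite divr_ge0 ?(ltW l0)// le_max ler0n.
pose k0 := (Num.truncn z).+2.
have k0P k : (k0 <= k)%N -> [/\ 2 <= k.-1%:R * l, c^-1 <= k.-1%:R * l & expR 1 <= k.-1%:R * l].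
  move=> kk; have /andP[_ zt] := truncn_itv z0.
  have zk : z <= k.-1%:R.
    by apply: (le_trans (ltW zt)); rewrite ler_nat -ltnS (leq_trans kk)// leqSpred.
  have : Num.max 2 (Num.max c^-1 (expR 1)) <= k.-1%:R * l by rewrite -ler_pdivrMr.
  by rewrite !ge_max => /andP[h1 /andP[h2 h3]].
have kpred k : (k0 <= k)%N -> k%:R = k.-1%:R + 1 :> R.
  by move=> kk; rewrite natr1 prednK// (leq_trans _ kk).
have prE k : (k0 <= k)%N -> pr P (E k) <= 96 / l ^+ 3 * (k%:R^-1 - k.+1%:R^-1).
  move=> kk; have [k2 kc ke] := k0P k kk; have kp := kpred k kk.
  have k1 : 1 <= k%:R :> R by rewrite ler1n (leq_trans _ kk).
  have kl0 : 0 < k%:R * l by rewrite mulr_gt0// (lt_le_trans ltr01).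
  apply: (@le_trans _ _ (k.+1%:R * (24 * ((k%:R * l) ^+ 3)^-1))).
    apply: pr_bigcup_lt; first by move=> j; case: ifP.
    move=> j; rewrite ltnS => jk; case: ifP => cj; last first.
      by rewrite pr_set0 mulr_ge0// invr_ge0 exprn_ge0// ltW.
    have [GK Gv _] := G_P j.
    have jkR : j%:R <= k%:R :> R by rewrite ler_nat.
    have L1 : 1 <= L k j by rewrite /L !le_max lexx !orbT.
    have Lh : ln (hb j)^-1 <= L k j by rewrite /L le_max lexx.
    (* Since [j <= k], the factor [L] is at most [ln N], which the lower bound on the
       bandwidth compares with [N * h]. *)
    have Lkl : L k j <= k%:R * l.
      rewrite /L !ge_max lnhb ler_pM2r// jkR lnN (ltW (ln_sublinear _))//=.
      by move: kp k2 => ->; nra.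
    have LD : L k j <= D * ((N k)%:R * hb j).
      apply: (le_trans Lkl); apply: (@le_trans _ _ (D * (c * (k.-1%:R * l)))).
        have -> : D * (c * (k.-1%:R * l)) = 2 * (k.-1%:R * l) by [rewrite /D; field; rewrite gt_eqF|]; rewrite kp.
        have p1 : 1 <= k.-1%:R :> R by rewrite ler1n -ltnS prednK// (leq_trans _ kk).
        have := ler_wpM2r (ltW l0) p1; lra.
      by rewrite ler_wpM2l.
    have := one_scale_tail X_indep X_idist kap_gt0 (ltW C_gt0) nu_gt0 K_meas K_le K_ent
      D_ge0 kC0 (N0 k) (hb0 j) (hb1 j) L1 Lh LD GK Gv.
    move=> /le_trans; apply; rewrite ler_pM2l//.
    apply: (@le_trans _ _ (expR (- (3 * ln (k%:R * l))))).
      by rewrite ler_expR lerN2 ler_pM2l// /L lnN !le_max lexx orbT.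
    by rewrite expRN lef_pV2 ?posrE ?exprn_gt0 ?expR_gt0// [3 * _]mulrC expRM_natr lnK.
  have k1' : k.+1%:R = k%:R + 1 :> R by rewrite natr1.
  have k0' : 0 < k%:R :> R by exact: lt_le_trans k1.
  rewrite k1'; set x := k%:R in k1 k0' *.
  have -> : x^-1 - (x + 1)^-1 = (x * (x + 1))^-1.
    by field; rewrite !gt_eqF// addr_gt0.
  have x1 : 0 < x + 1 by rewrite addr_gt0.
  rewrite -subr_ge0.
  have -> : 96 / l ^+ 3 * (x * (x + 1))^-1 - (x + 1) * (24 * ((x * l) ^+ 3)^-1) =
      (96 * x ^+ 2 - 24 * (x + 1) ^+ 2) / (x ^+ 3 * l ^+ 3 * (x + 1)).
    by field; rewrite !gt_eqF.
  by rewrite divr_ge0 ?mulr_ge0 ?exprn_ge0 ?(ltW l0) ?(ltW x1) ?(ltW k0')//; nra.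
have b0 : 0 <= 96 / l ^+ 3 by rewrite divr_ge0// exprn_ge0// ltW.
have aeE := ae_eventually_not (erefl : (0 < k0)%N) b0 mE prE.
exists (96 * Num.sqrt (136 * C0 * (C1 + 3) * 8)).
apply: filterS aeE => w [k1 nE].
pose k2 := maxn k0 k1; exists (2 ^ k2.+1)%N => n nn h x /andP[ch h1].
have n1 : (1 < n)%N by rewrite (leq_trans _ nn)// -[2%N]expn1 leq_exp2l.
have /andP[nlo nhi] := up_log_bounds (erefl : (1 < 2)%N) n1.
set k := up_log 2 n in nlo nhi.
have k2k : (k2 <= k)%N.
  by rewrite ltnW// -(leq_exp2l _ _ (erefl : (1 < 2)%N)) (leq_trans nn).
have kk0 : (k0 <= k)%N by rewrite (leq_trans _ k2k)// leq_maxl.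
have kk1 : (k1 <= k)%N by rewrite (leq_trans _ k2k)// leq_maxr.
have [kl2 klc kle] := k0P k kk0; have kp := kpred k kk0.
have nR : 0 < n%:R :> R by rewrite ltr0n ltnW.
have lnn : k.-1%:R * l <= ln n%:R.
  have -> : k.-1%:R * l = ln ((2 ^ k.-1)%N%:R) by rewrite natrX lnXn// -[ln _ *+ _]mulr_natl.
  rewrite ler_ln ?posrE ?ltr0n ?expn_gt0 ?(ltnW n1)//.
  by rewrite ler_nat ltnW.
have chn : c * ln n%:R <= n%:R * h by rewrite [leRHS]mulrC -ler_pdivrMr.
have ck : c * (k.-1%:R * l) <= n%:R * h.
  by apply: le_trans chn; rewrite ler_pM2l.
have nh1 : 1 <= n%:R * h.
  by apply: le_trans ck; rewrite -ler_pdivrMl// mulr1.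
have h0 : 0 < h by rewrite -(pmulr_rgt0 _ nR) (lt_le_trans ltr01).
have hinv0 : 0 <= h^-1 by rewrite invr_ge0 ltW.
pose q := Num.truncn h^-1; have /andP[q1 q2] := truncn_itv hinv0.
have q0 : (0 < q)%N by rewrite truncn_gt0 invf_ge1.
pose j := trunc_log 2 q.
have /andP[jq1 jq2] := trunc_log_bounds (erefl : (1 < 2)%N) q0.
have hbj : h <= hb j.
  rewrite /hb exprVn -[h]invrK lef_pV2 ?posrE ?exprn_gt0 ?invr_gt0//.
  by rewrite -natrX (le_trans _ q1)// ler_nat.
have hbj2 : hb j <= 2 * h.
  rewrite /hb exprVn -ler_pdivrMl// -invfM -exprS -[leRHS]invrK.
  rewrite lef_pV2 ?posrE ?exprn_gt0 ?invr_gt0//.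
  by rewrite -natrX (le_trans (ltW q2))// ler_nat.
have Nn : n%:R <= (N k)%:R :> R by rewrite ler_nat.
have Nn2 : (N k)%:R <= 2 * n%:R :> R.
  rewrite -natrM ler_nat /N -[k]prednK ?(leq_trans _ kk0)// expnS leq_mul2l/=.
  exact: ltnW.
have jk : (j <= k)%N.
  rewrite -(leq_exp2l _ _ (erefl : (1 < 2)%N)) (leq_trans jq1)// (leq_trans _ nhi)//.
  rewrite -(ler_nat R) (le_trans q1)// -[leRHS]mulr1 -ler_pdivrMl//.
  by rewrite -invfM invf_le1 ?mulr_gt0.
have cj : cnd k j.
  by apply: (le_trans ck); rewrite ler_pM// ltW.
set L' := Num.max (ln h^-1) (ln (ln n%:R)).
have lnn0 : 0 < ln n%:R :> R by apply: lt_le_trans lnn; apply: lt_le_trans kl2.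
have L'1 : 1 <= L'.
  rewrite /L' le_max; apply/orP; right; rewrite -[leLHS]expRK ler_ln ?posrE ?expR_gt0//.
  exact: le_trans lnn.
have LL' : L k j <= 2 * L'.
  rewrite /L !ge_max; apply/and3P; split; last by move: L'1; lra.
    apply: (@le_trans _ _ L'); last by move: L'1; lra.
    rewrite /L' le_max ler_ln ?posrE ?invr_gt0//.
    by rewrite lef_pV2 ?posrE// hbj.
  have e1 : ln (ln (N k)%:R) <= ln (2 * ln n%:R) :> R.
    rewrite ler_ln ?posrE ?mulr_gt0//; last first.
      rewrite lnN kp mulrDl mul1r addr_gt0//; exact: lt_le_trans kl2.
    rewrite lnN kp mulrDl mul1r mulrC mulrC.
    have : l <= k.-1%:R * l.
      rewrite ler_peMl ?(ltW l0)// ler1n.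
      by rewrite -ltnS prednK ?(leq_trans _ kk0).
    by move: lnn; lra.
  apply: (le_trans e1); rewrite lnM ?posrE//.
  have e2 : ln 2 <= ln (ln n%:R) :> R.
    by rewrite ler_ln ?posrE// (le_trans kl2).
  have e3 : ln (ln n%:R) <= L' by rewrite /L' le_max lexx orbT.
  lra.
rewrite leNgt; apply/negP => hu.
have [_ _ /(_ h x n w _ _ hu)[|i hi]] := G_P j; first by rewrite h0.
apply: (nE k kk1); exists j => //=; rewrite cj; exists i, n => //.
apply: le_lt_trans hi; rewrite /thr.
have -> : 6 * (16 * Num.sqrt (68 * (2 * (N k)%:R * (C0 * hb j)) * (C1 + 3) * L k j)) =
    96 * Num.sqrt (136 * C0 * (C1 + 3) * ((N k)%:R * hb j * L k j)).
  rewrite mulrA; congr (_ * Num.sqrt _); ring.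
rewrite -[leRHS]mulrA ler_pM2l// -sqrtrM; last first.
  by rewrite !mulr_ge0// ?(ltW C0_gt0)// addr_ge0.
apply: ler_wsqrtr; rewrite -[leRHS]mulrA ler_wpM2l//.
  by rewrite !mulr_ge0// ?(ltW C0_gt0)// addr_ge0.
have -> : 8 * (n%:R * h * L') = (2 * n%:R) * (2 * h) * (2 * L') by ring.
have L0 : 0 <= L k j by rewrite /L !le_max ler01 !orbT.
by rewrite !ler_pM// ?mulr_ge0// ltW.
Qed.

End upper_bound.

(** * Souslin sets are measurable up to null sets *)

Definition agree (n : nat) (s s' : nat -> nat) := forall i, (i < n)%N -> s i = s' i.

Lemma agree_sym n s s' : agree n s s' -> agree n s' s.
Proof. by move=> h i /h. Qed.

Lemma agree_trans n s s' s'' : agree n s s' -> agree n s' s'' -> agree n s s''.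
Proof. by move=> h h' i ni; rewrite h// h'. Qed.

Lemma agreeW m n s s' : (m <= n)%N -> agree n s s' -> agree m s s'.
Proof. by move=> mn h i im; apply: h; exact: leq_trans mn. Qed.

Section souslin_operation.
Context d (T : measurableType d) (R : realType) (P : probability T R).
Variable G : set (set T).
Hypothesis G_meas : G `<=` measurable.

Local Notation sig := (<<s G >>).
Local Notation TG := (g_sigma_algebraType G).

Let sig_meas : sig `<=` measurable.
Proof. by apply: smallest_sub => //; exact: sigma_algebra_measurable. Qed.

Let covers (E : set T) : set R := [set x | exists H, [/\ sig H, E `<=` H & x = pr P H]].

Let ostar E : R := inf (covers E).

Let covers_has_inf E : has_inf (covers E).
Proof.
split; last by exists 0 => _ [H [_ _ ->]]; exact: pr_ge0.
exists 1, setT; split => //; first exact: (@measurableT _ TG).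
by rewrite pr_setT.
Qed.

Let ostar_le E H : sig H -> E `<=` H -> ostar E <= pr P H.
Proof.
move=> sH EH; apply: ge_inf; first exact: (covers_has_inf E).2.
by exists H.
Qed.

Let hull E : exists H, [/\ sig H, E `<=` H & pr P H = ostar E].
Proof.
have h n : exists H, [/\ sig H, E `<=` H & pr P H <= ostar E + n.+1%:R^-1].
  have n0 : 0 < n.+1%:R^-1 :> R by rewrite invr_gt0.
  have [_ [H [sH EH ->]] lt] := inf_adherent n0 (covers_has_inf E).
  by exists H; split => //; exact: ltW.
pose Hn n := sval (cid (h n)).
have HnP n : [/\ sig (Hn n), E `<=` Hn n & pr P (Hn n) <= ostar E + n.+1%:R^-1].
  by rewrite /Hn; case: cid.
pose H := \bigcap_n Hn n.
have sH : sig H by apply: (@bigcapT_measurable _ TG) => n; have [] := HnP n.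
have EH : E `<=` H by move=> t Et n _; have [_ h' _] := HnP n; exact: h'.
exists H; split => //; apply/eqP; rewrite eq_le ostar_le// andbT.
apply/ler_addgt0Pl => e e0.
pose n := Num.truncn e^-1.
have ei : 0 <= e^-1 by rewrite invr_ge0 ltW.
have /andP[_ h1] := truncn_itv ei.
have [sn _ h2] := HnP n.
apply: (@le_trans _ _ (pr P (Hn n))).
  by apply: pr_sub; [exact: sig_meas|exact: sig_meas|move=> t; apply].
rewrite addrC (le_trans h2)// lerD2l -[leRHS]invrK lef_pV2 ?posrE ?invr_gt0//.
exact: ltW.
Qed.

Let ostar_mono E F : E `<=` F -> ostar E <= ostar F.
Proof.
move=> EF; have [H [sH FH <-]] := hull F; apply: ostar_le => //.
exact: subset_trans FH.
Qed.

(** Outer measure is continuous along increasing sequences of arbitrary sets, as the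
    hulls can be chosen increasing. *)
Let ostar_incr (E : nat -> set T) e : 0 < e ->
  (forall m n, (m <= n)%N -> E m `<=` E n) ->
  exists n, ostar (\bigcup_k E k) <= ostar (E n) + e.
Proof.
move=> e0 ndE; apply: contrapT => /forallNP nE.
have small n : ostar (E n) < ostar (\bigcup_k E k) - e.
  by rewrite ltrBrDr ltNge; apply/negP; exact: nE.
pose H n := sval (cid (hull (E n))).
have HP n : [/\ sig (H n), E n `<=` H n & pr P (H n) = ostar (E n)].
  by rewrite /H; case: cid.
pose F n := \bigcap_(m in [set m | (n <= m)%N]) H m.
have sF n : sig (F n).
  by apply: (@bigcap_measurableType _ TG) => m _; have [] := HP m.
have EF n : E n `<=` F n.
  by move=> t Et m /= nm; have [_ h _] := HP m; apply: h; exact: ndE Et.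
have ndF m n : (m <= n)%N -> F m `<=` F n.
  by move=> mn t Ft k /= nk; apply: Ft => /=; exact: leq_trans nk.
have sU : sig (\bigcup_n F n) by exact: (@bigcupT_measurable _ TG).
have h1 : ostar (\bigcup_k E k) <= pr P (\bigcup_n F n).
  by apply: ostar_le => // t [k _ Ek]; exists k => //; exact: EF.
have h2 : pr P (\bigcup_n F n) <= ostar (\bigcup_k E k) - e.
  apply: pr_bigcup_le => [k|n]; first exact: sig_meas.
  apply: le_trans (ltW (small n)); have [sH _ <-] := HP n; apply: pr_sub.
  - by apply: bigcup_measurable => k _; exact: sig_meas.
  - exact: sig_meas.
  - by move=> t [k /= kn /(ndF k n (ltnW kn))]; apply => /=.
have h3 := le_trans h1 h2; lra.
Qed.

Section scheme.
Variable C : nat -> (nat -> nat) -> set T.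
Hypothesis C_sig : forall n s, sig (C n s).
Hypothesis C_dep : forall n s s', agree n s s' -> C n s = C n s'.

Let S := [set t | exists s, forall n, C n s t].

(** Koenig's lemma: if every finite stage of the scheme can be met by a branch
    below [m], then so can the whole scheme. *)
Let koenig (m : nat -> nat) t :
  (forall k, exists s, (forall i, (i < k)%N -> (s i <= m i)%N) /\
     forall n, (n <= k)%N -> C n s t) -> S t.
Proof.
move=> Dt.
pose good s k := forall k', (k <= k')%N -> exists s', [/\ agree k s' s,
  forall i, (i < k')%N -> (s' i <= m i)%N & forall n, (n <= k')%N -> C n s' t].
pose upd (s : nat -> nat) k j : nat -> nat := fun i => if i == k then j else s i.
have good0 : good (fun=> 0%N) 0%N.
  by move=> k' _; have [s' [h1 h2]] := Dt k'; exists s'.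
have goodS s k : good s k -> exists j, good (upd s k j) k.+1.
  move=> gs; apply: contrapT => /forallNP nj.
  have bad j : exists k', (k < k')%N /\ ~ exists s', [/\ agree k.+1 s' (upd s k j),
      forall i, (i < k')%N -> (s' i <= m i)%N & forall n, (n <= k')%N -> C n s' t].
    have /existsNP[k' /not_implyP[kk' h]] := nj j.
    by exists k'.
  pose b j := sval (cid (bad j)).
  pose k' := maxn k.+1 (\max_(j < (m k).+1) b j).
  have [s' [h1 h2 h3]] := gs k' (leq_trans (leqnSn _) (leq_maxl _ _)).
  have km : (s' k < (m k).+1)%N by rewrite ltnS h2// leq_maxl.
  have [_] : (k < b (s' k))%N /\ ~ exists s'', [/\ agree k.+1 s'' (upd s k (s' k)),
      forall i, (i < b (s' k))%N -> (s'' i <= m i)%N &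
      forall n, (n <= b (s' k))%N -> C n s'' t] by rewrite /b; case: cid.
  have bk : (b (s' k) <= k')%N.
    by rewrite (leq_trans _ (leq_maxr _ _))// (leq_bigmax (Ordinal km)).
  apply; exists s'; split.
  - move=> i; rewrite ltnS leq_eqVlt /upd => /predU1P[->|ik]; first by rewrite eqxx.
    by rewrite ltn_eqF// h1.
  - by move=> i ib; apply: h2; exact: leq_trans bk.
  - by move=> n nb; apply: h3; exact: leq_trans bk.
pose nxt (p : (nat -> nat) * nat) : nat :=
  if pselect (good p.1 p.2) is left g then sval (cid (goodS _ _ g)) else 0%N.
pose fix st k := if k is k'.+1 then upd (st k') k' (nxt (st k', k')) else (fun=> 0%N).
have stg k : good (st k) k.
  elim: k => [|k IH] //=; rewrite /nxt; case: pselect => [g|//] /=.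
  by case: cid.
have st_stab i k : (i < k)%N -> st k i = st i.+1 i.
  elim: k => // k IH; rewrite ltnS leq_eqVlt => /predU1P[->//|ik].
  by rewrite -IH//= /upd ltn_eqF.
exists (fun i => st i.+1 i) => n.
have [s' [h1 _ h3]] := stg n n (leqnn n).
rewrite -(@C_dep n s'); first exact: h3.
by move=> i ni; rewrite h1// st_stab.
Qed.

(** [m] bounds the coordinates of the branch in turn, the bound on the coordinate [k]
    losing at most [e / 2 ^ k.+1] of outer measure. *)
Let inner e : 0 < e -> exists K, [/\ sig K, K `<=` S & ostar S <= pr P K + e].
Proof.
move=> e0.
pose Sp (p : seq nat) := [set t | exists s,
  (forall i, (i < size p)%N -> (s i <= nth 0%N p i)%N) /\ forall n, C n s t].
have step p : exists j, ostar (Sp p) <= ostar (Sp (rcons p j)) + e / 2 ^+ (size p).+1.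
  have ep : 0 < e / 2 ^+ (size p).+1 by rewrite divr_gt0// exprn_gt0.
  have [|j hj] := @ostar_incr (fun j => Sp (rcons p j)) _ ep.
    move=> a b ab t [s [h1 h2]]; exists s; split => // i ip.
    have := h1 i; rewrite !size_rcons !nth_rcons in ip *; move=> /(_ ip).
    case: ifP => // _; case: ifP => // _ sa; exact: leq_trans ab.
  exists j; apply: le_trans hj; apply: ostar_mono => t [s [h1 h2]].
  exists (s (size p)) => //; exists s; split => // i; rewrite size_rcons ltnS.
  rewrite leq_eqVlt nth_rcons => /predU1P[->|ip]; first by rewrite ltnn eqxx.
  by rewrite ip; exact: h1.
pose nxt p := sval (cid (step p)).
pose fix pre k := if k is k'.+1 then rcons (pre k') (nxt (pre k')) else [::].
have size_pre k : size (pre k) = k by elim: k => //= k IH; rewrite size_rcons IH.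
pose m i := nth 0%N (pre i.+1) i.
have pre_m k i : (i < k)%N -> nth 0%N (pre k) i = m i.
  elim: k => // k IH; rewrite ltnS leq_eqVlt => /predU1P[->//|ik].
  by rewrite /= nth_rcons size_pre ik IH.
have ostar_pre k : ostar S <= ostar (Sp (pre k)) + e * (1 - 2^-1 ^+ k).
  elim: k => [|k IH].
    rewrite expr0 subrr mulr0 addr0; apply: ostar_mono => t [s hs].
    by exists s.
  apply: (le_trans IH); rewrite [pre k.+1]/=.
  have : ostar (Sp (pre k)) <= ostar (Sp (rcons (pre k) (nxt (pre k)))) + e / 2 ^+ k.+1.
    by rewrite /nxt; case: cid => j /=; rewrite size_pre.
  by rewrite -[2 ^- k.+1]exprVn exprS; set x := _^-1 ^+ k; lra.
pose D k := [set t | exists s, (forall i, (i < k)%N -> (s i <= m i)%N) /\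
   forall n, (n <= k)%N -> C n s t].
have sD k : sig (D k).
  pose Du (o : option (seq nat)) : set T := if o is Some s then
    (if all (fun i => nth 0%N s i <= m i)%N (iota 0 k)
     then \bigcap_(n in [set n | (n <= k)%N]) C n (nth 0%N s) else set0) else set0.
  have sDu o : sig (Du o).
    case: o => [s|] /=; last exact: (@measurable0 _ TG).
    case: ifP => _; last exact: (@measurable0 _ TG).
    by apply: (@bigcap_measurableType _ TG) => n _; exact: C_sig.
  rewrite (_ : D k = \bigcup_i Du (unpickle i)).
    by apply: (@bigcupT_measurable _ TG) => i; exact: sDu.
  apply/seteqP; split=> t.
    move=> [s [h1 h2]]; exists (pickle (mkseq s k)) => //; rewrite pickleK /Du.
    have ag : agree k s (nth 0%N (mkseq s k)) by move=> i ik; rewrite nth_mkseq.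
    rewrite ifT.
      by move=> n /= nk; rewrite -(C_dep (agreeW nk ag)); exact: h2.
    apply/allP => i; rewrite mem_iota add0n => /andP[_ ik].
    by rewrite nth_mkseq// h1.
  move=> [i _]; rewrite /Du; case: (unpickle i : option (seq nat)) => [s|//].
  case: ifP => // /allP h1 h2.
  exists (nth 0%N s); split => [j jk|n nk]; last exact: h2.
  by apply: h1; rewrite mem_iota.
exists (\bigcap_k D k); split.
- by apply: (@bigcapT_measurable _ TG) => k; exact: sD.
- by move=> t Dt; apply: (@koenig m) => k; exact: Dt.
- have mD k : measurable (D k) by exact: sig_meas.
  have mDI : measurable (\bigcap_k D k) by exact: bigcapT_measurable.
  have Dk k : ostar S - e <= pr P (D k).
    have h1 := ostar_pre k.
    have h2 : ostar (Sp (pre k)) <= pr P (D k).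
      apply: ostar_le => // t [s [h3 h4]]; exists s; split => // i ik.
      by rewrite -(pre_m k i ik); apply: h3; rewrite size_pre.
    have : 0 <= e * 2^-1 ^+ k by rewrite mulr_ge0 ?(ltW e0)// exprn_ge0// invr_ge0.
    lra.
  have : pr P (\bigcup_k ~` D k) <= 1 - (ostar S - e).
    apply: pr_bigcup_le => [k|n]; first exact: measurableC.
    apply: (@le_trans _ _ (pr P (~` D n))); last by rewrite pr_setC// lerD2l lerN2.
    apply: pr_sub; [|exact: measurableC|].
      by apply: bigcup_measurable => k _; exact: measurableC.
    move=> t [k /= kn nDk] [s [h1 h2]]; apply: nDk; exists s; split.
      by move=> i ik; apply: h1; exact: leq_trans (ltnW kn).
    by move=> l lk; apply: h2; exact: leq_trans (ltnW kn).
  rewrite -setC_bigcap pr_setC//; lra.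
Qed.

(** Lusin's theorem: the Souslin operation leads from a sigma-algebra into its
    completion. As for Choquet capacities, bounding the branches one coordinate at a
    time loses little outer measure, and the bounded branches form a compact set. *)
Lemma souslin_ae : exists B, sig B /\ {ae P, forall t, S t <-> B t}.
Proof.
have [H [sH SH HS]] := hull S.
have e0 n : 0 < n.+1%:R^-1 :> R by rewrite invr_gt0.
pose K n := sval (cid (inner (e0 n))).
have KP n : [/\ sig (K n), K n `<=` S & ostar S <= pr P (K n) + n.+1%:R^-1].
  by rewrite /K; case: cid.
pose B := \bigcup_n K n.
have sB : sig B by apply: (@bigcupT_measurable _ TG) => n; have [] := KP n.
have BS : B `<=` S by move=> t [n _]; have [_ h _] := KP n; exact: h.
exists B; split => //; exists (H `\` B); split.
- by apply: measurableD; exact: sig_meas.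
- have mH := sig_meas sH; have mB := sig_meas sB.
  have mHB : measurable (H `\` B) by exact: measurableD.
  rewrite prE//; congr EFin; apply/eqP; rewrite eq_le pr_ge0 andbT.
  have E : pr P H = pr P B + pr P (H `\` B).
    rewrite -pr_setU_disj//; last by apply/seteqP; split=> // t [Bt [_]].
    by rewrite setDUK//; exact: subset_trans SH.
  have BH : pr P H <= pr P B.
    rewrite HS; apply/ler_addgt0Pl => e e1.
    pose n := Num.truncn e^-1.
    have ei : 0 <= e^-1 by rewrite invr_ge0 ltW.
    have /andP[_ h1] := truncn_itv ei.
    have [sK _ h2] := KP n.
    apply: (le_trans h2); rewrite addrC lerD//; last first.
      by apply: pr_sub => //; [exact: sig_meas|exact: bigcup_sup].
    by rewrite -[leRHS]invrK lef_pV2 ?posrE ?invr_gt0//; exact: ltW.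
  by move: E BH; lra.
- move=> t /= nSB; have [Bt|nBt] := pselect (B t).
    by exfalso; apply: nSB; split => // _; exact: BS.
  split=> //; apply: SH; apply: contrapT => nS; apply: nSB; split=> //.
Qed.

End scheme.
End souslin_operation.

(** * Projections of measurable sets *)

Local Notation baire := (nat -> nat).

Definition loc_const (U : Type) (F : baire -> baire -> U) := forall y s,
  exists N, forall y' s', agree N y y' -> agree N s s' -> F y' s' = F y s.

Section souslin_products.
Context (T : pointedType) (G : set (set T)).
Local Notation sig := (<<s G >>).
Local Notation TG := (g_sigma_algebraType G).

(** Sets obtained by the Souslin operation from rectangles with a measurable side
    in [T] and a clopen side in the Baire space [nat -> nat]. Local constancy of the
    scheme in both arguments makes closure under countable unions and intersections
    a matter of recoding the branch [s]. *)
Definition souslin (B : set (T * baire)) := exists C : nat -> baire -> baire -> set T,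
  [/\ forall n y s, sig (C n y s), forall n, loc_const (C n) &
      forall t y, B (t, y) <-> exists s, forall n, C n y s t].

Definition bisouslin (B : set (T * baire)) := souslin B /\ souslin (~` B).

Lemma souslin_bigcap (B : nat -> set (T * baire)) : (forall i, souslin (B i)) ->
  souslin (\bigcap_i B i).
Proof.
move=> sB; pose C i := sval (cid (sB i)).
have CP i : [/\ forall n y s, sig (C i n y s), forall n, loc_const (C i n) &
    forall t y, B i (t, y) <-> exists s, forall n, C i n y s t].
  by rewrite /C; case: cid.
pose dec k : nat * nat := odflt (0%N, 0%N) (unpickle k).
have decK p : dec (pickle p) = p by rewrite /dec pickleK.
pose part (s : baire) (i : nat) : baire := fun l => s (pickle (i, l)).
exists (fun k y s => C (dec k).1 (dec k).2 y (part s (dec k).1)); split.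
- by move=> k y s; have [h _ _] := CP (dec k).1; exact: h.
- move=> k y s; set i := (dec k).1; set n := (dec k).2.
  have [_ h _] := CP i; have [N hN] := h n y (part s i).
  exists (maxn N (\max_(l < N) (pickle (i, nat_of_ord l)).+1)) => y' s' yy' ss'; apply: hN.
    exact: (agreeW (leq_maxl _ _) yy').
  move=> l lN; apply: ss'; rewrite leq_max; apply/orP; right.
  by rewrite (leq_bigmax (Ordinal lN)).
- move=> t y; split.
    move=> Bty; have h i : exists s, forall n, C i n y s t.
      by have [_ _ h] := CP i; apply/h; exact: Bty.
    pose s i := sval (cid (h i)).
    have sP i n : C i n y (s i) t by rewrite /s; case: cid.
    exists (fun k => s (dec k).1 (dec k).2) => k; set i := (dec k).1.
    rewrite (_ : part _ i = s i)//.
    by apply/funext => l; rewrite /part decK.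
  move=> [s hs] i _; have [_ _ h] := CP i; apply/h; exists (part s i) => n.
  by have := hs (pickle (i, n)); rewrite decK.
Qed.

Lemma souslin_bigcup (B : nat -> set (T * baire)) : (forall i, souslin (B i)) ->
  souslin (\bigcup_i B i).
Proof.
move=> sB; pose C i := sval (cid (sB i)).
have CP i : [/\ forall n y s, sig (C i n y s), forall n, loc_const (C i n) &
    forall t y, B i (t, y) <-> exists s, forall n, C i n y s t].
  by rewrite /C; case: cid.
pose shift (s : baire) : baire := fun l => s l.+1.
exists (fun n y s => C (s 0%N) n y (shift s)); split.
- by move=> n y s; have [h _ _] := CP (s 0%N); exact: h.
- move=> n y s; have [_ h _] := CP (s 0%N); have [N hN] := h n y (shift s).
  exists N.+1 => y' s' yy' ss'; rewrite -(ss' 0%N)//; apply: hN.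
    exact: (agreeW (leqnSn N) yy').
  by move=> l lN; apply: ss'.
- move=> t y; split.
    move=> [i _ Bi]; have [_ _ h] := CP i; have [s hs] := (h t y).1 Bi.
    by exists (fun k => if k is l.+1 then s l else i).
  move=> [s hs]; exists (s 0%N) => //; have [_ _ h] := CP (s 0%N).
  by apply/h; exists (shift s).
Qed.

Lemma souslin_rect (U : baire -> set T) : (forall y, sig (U y)) ->
  (forall y, exists N, forall y', agree N y y' -> U y' = U y) ->
  souslin [set p | U p.2 p.1].
Proof.
move=> sU lU; exists (fun _ y _ => U y); split => //.
- by move=> _ y s; have [N hN] := lU y; exists N => y' s' yy' _; exact: hN.
- by move=> t y; split=> [h|[s /(_ 0%N)]//]; exists (fun=> 0%N).
Qed.

Lemma bisouslin_rect (U : baire -> set T) : (forall y, sig (U y)) ->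
  (forall y, exists N, forall y', agree N y y' -> U y' = U y) ->
  bisouslin [set p | U p.2 p.1].
Proof.
move=> sU lU; split; first exact: souslin_rect.
apply: (@souslin_rect (fun y => ~` U y)) => y.
  by apply: (@measurableC _ TG); exact: sU.
by have [N hN] := lU y; exists N => y' yy'; rewrite hN.
Qed.

Lemma bisouslin_sigma_algebra : sigma_algebra setT bisouslin.
Proof.
split.
- rewrite (_ : set0 = [set p | (fun _ : baire => set0) p.2 p.1])//.
  apply: (@bisouslin_rect (fun=> set0)) => [y|y]; first exact: (@measurable0 _ TG).
  by exists 0%N.
- by move=> B [sB sCB]; rewrite setTD; split; rewrite ?setCK.
- move=> B bB; split; first by apply: souslin_bigcup => i; have [] := bB i.
  by rewrite setC_bigcup; apply: souslin_bigcap => i; have [] := bB i.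
Qed.

End souslin_products.

(** Measurable projection theorem: the pair (y, s) of a point of the Baire space and a
    branch of a scheme is coded by a single branch. *)
Lemma projection_ae d (T : measurableType d) (R : realType) (P : probability T R)
    (G : set (set T)) (B : set (T * baire)) : G `<=` measurable -> souslin G B ->
  exists A, <<s G >> A /\ {ae P, forall t, (exists y, B (t, y)) <-> A t}.
Proof.
move=> Gm [C [sC lC BC]].
pose ev (r : baire) : baire := fun l => r l.*2.
pose od (r : baire) : baire := fun l => r l.*2.+1.
pose Ck k r := C k (ev r) (od r).
(* A stage is imposed once the first [n] coordinates of the branch settle it, so that
   the stage [n] of the new scheme depends on these coordinates only. *)
pose settled n k r := forall r', agree n r r' -> Ck k r' = Ck k r.
pose D n r := \bigcap_(k in [set k | (k < n)%N /\ settled n k r]) Ck k r.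
have sD n r : <<s G >> (D n r).
  by apply: (@bigcap_measurableType _ (g_sigma_algebraType G)) => k _; exact: sC.
have D_dep n r r' : agree n r r' -> D n r = D n r'.
  have half u u' : agree n u u' -> D n u `<=` D n u'.
    move=> uu' t Du k [kn st].
    have E : Ck k u = Ck k u' by apply: st; exact: agree_sym.
    rewrite -E; apply: Du; split => // v uv.
    by rewrite E; apply: st; exact: agree_trans (agree_sym uu') uv.
  by move=> rr'; apply/seteqP; split; apply: half => //; exact: agree_sym.
have [A [sA aeA]] := souslin_ae P Gm sD D_dep.
exists A; split => //; apply: filterS aeA => t <-; split.
  move=> [y /BC[s hs]].
  pose r : baire := fun l => if odd l then s l./2 else y l./2.
  have evr : ev r = y by apply/funext => l; rewrite /ev /r odd_double doubleK.
  have odr : od r = s.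
    by apply/funext => l; rewrite /od /r /= odd_double/= uphalf_double.
  by exists r => n k _; rewrite /Ck evr odr.
move=> [r hr]; exists (ev r); apply/BC; exists (od r) => k.
have [N hN] := lC k (ev r) (od r).
apply: (hr (maxn k.+1 N.*2.+1)); split; first by rewrite leq_maxl.
move=> r' rr'; apply: hN => l lN; apply: rr'; rewrite leq_max; apply/orP; right.
  by rewrite ltnS leq_double ltnW.
by rewrite ltnS ltn_double.
Qed.

Section real_parameters.
Context (R : realType).

Definition rat_of_nat (n : nat) : rat := odflt 0%R (unpickle n).

(** A Borel map of the Baire space onto the real line: its measurability is that of
    limits superior, and every real is a limit of rationals. *)
Definition real_of_baire (y : baire) : R :=
  fine (limn_esup (fun n => (ratr (rat_of_nat (y n)) : R)%:E)).

Lemma real_of_baire_surj (r : R) : exists y, real_of_baire y = r.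
Proof.
have h n : exists q : rat, ratr q \in `]r - n.+1%:R^-1, r[.
  by apply: rat_in_itvoo; rewrite gtrBl invr_gt0.
pose q n := sval (cid (h n)).
have qP n : r - n.+1%:R^-1 < ratr (q n) < r.
  by rewrite /q; case: cid => ? /=; rewrite in_itv.
exists (fun n => pickle (q n)); rewrite /real_of_baire.
have -> : (fun n => (ratr (rat_of_nat (pickle (q n))) : R)%:E) =
    (fun n => (ratr (q n) : R)%:E).
  by apply/funext => n; rewrite /rat_of_nat pickleK.
have c : (ratr (q n) : R)%:E @[n --> \oo] --> r%:E.
  apply: cvg_EFin; first exact: nearW.
  apply: (@squeeze_cvgr _ _ _ _ (fun n => r - n.+1%:R^-1) (cst r)).
  - by apply: nearW => n; have /andP[/ltW -> /ltW ->] := qP n.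
  - rewrite -[X in _ --> X]subr0; apply: cvgB; first exact: cvg_cst.
    exact: cvg_harmonic.
  - exact: cvg_cst.
by rewrite (cvg_limn_einf_sup c).2.
Qed.

Section product_space.
Context (T : pointedType) (G : set (set T)).

(** On the sigma-algebra of bisouslin sets the points and the branches are measurable
    coordinates, and projections along the branch are measurable up to null sets. *)
Definition souslin_space := g_sigma_algebraType (@bisouslin T G).
Local Notation W := souslin_space.

Lemma souslin_spaceP (B : set W) : measurable B -> bisouslin G B.
Proof. by rewrite /measurable/= sigma_algebra_id//; exact: bisouslin_sigma_algebra. Qed.

Lemma measurable_base d (E : measurableType d) (a : T -> E) :
  (forall A, measurable A -> <<s G >> (a @^-1` A)) ->
  measurable_fun [set: W] (fun p : W => a p.1).
Proof.
move=> aG _ A mA; rewrite setTI; apply: sub_sigma_algebra.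
apply: (@bisouslin_rect T G (fun=> a @^-1` A)) => y; first exact: aG.
by exists 0%N.
Qed.

Lemma measurable_branch d (E : measurableType d) (f : nat -> E) i :
  measurable_fun [set: W] (fun p : W => f (p.2 i)).
Proof.
move=> _ A mA; rewrite setTI; apply: sub_sigma_algebra.
apply: (@bisouslin_rect T G (fun y => [set _ | A (f (y i))])) => y; last first.
  by exists i.+1 => y' yy'; rewrite yy'.
have [Afy|nAfy] := pselect (A (f (y i))).
  rewrite (_ : [set _ | _] = setT); first exact: (@measurableT _ (g_sigma_algebraType G)).
  by apply/seteqP; split.
rewrite (_ : [set _ | _] = set0); first exact: (@measurable0 _ (g_sigma_algebraType G)).
by apply/seteqP; split.
Qed.

Lemma measurable_real_of_baire (phi : nat -> nat) :
  measurable_fun [set: W] (fun p : W => real_of_baire (fun n => p.2 (phi n))).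
Proof.
apply: (@measurableT_comp _ _ _ _ _ _ (@fine R)); first exact: fine_measurable.
apply: (@measurable_fun_limn_esup _ W R setT
  (fun n (p : W) => (ratr (rat_of_nat (p.2 (phi n))) : R)%:E)) => n.
apply/measurable_EFinP.
exact: (@measurable_branch _ (measurableTypeR R) (fun k => ratr (rat_of_nat k) : R)).
Qed.

Definition bandwidth_param (y : baire) : R :=
  real_of_baire (fun n => y (pickle (0%N, n))).

Definition point_param d (y : baire) : euclid R d :=
  [tuple real_of_baire (fun n => y (pickle (i.+1, n))) | i < d].

Lemma param_surj d (h : R) (x : euclid R d) :
  exists y, bandwidth_param y = h /\ point_param d y = x.
Proof.
pose r i := if i is j.+1 then nth 0 x j else h.
have yi i : exists y, real_of_baire y = r i by exact: real_of_baire_surj.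
pose Y i := sval (cid (yi i)).
have YP i : real_of_baire (Y i) = r i by rewrite /Y; case: cid.
pose dec k : nat * nat := odflt (0%N, 0%N) (unpickle k).
exists (fun k => Y (dec k).1 (dec k).2).
have E (i : nat) : (fun n => Y (dec (pickle (i, n))).1 (dec (pickle (i, n))).2) = Y i.
  by apply/funext => n; rewrite /dec pickleK.
split; first by rewrite /bandwidth_param E YP.
apply: eq_from_tnth => i; rewrite tnth_mktuple E YP /=.
by rewrite (tnth_nth 0).
Qed.

Lemma measurable_bandwidth_param :
  measurable_fun [set: W] (fun p : W => bandwidth_param p.2).
Proof. exact: (measurable_real_of_baire (fun n => pickle (0%N, n))). Qed.

Lemma measurable_point_param d :
  measurable_fun [set: W] (fun p : W => point_param d p.2).
Proof.
apply/measurable_fun_tnthP => i.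
rewrite (_ : _ \o _ = (fun p : W => real_of_baire (fun n => p.2 (pickle (i.+1, n))))).
  exact: (measurable_real_of_baire (fun n => pickle (i.+1, n))).
by apply/funext => p /=; rewrite tnth_mktuple.
Qed.

Lemma measurable_rescale d d' (S : measurableType d') (x y : S -> euclid R d) (h : S -> R) :
  measurable_fun setT x -> measurable_fun setT y -> measurable_fun setT h ->
  measurable_fun setT (fun p => rescale (h p) (x p) (y p)).
Proof.
move=> mx my mh; apply/measurable_fun_tnthP => i.
rewrite (_ : _ \o _ = (fun p => (tnth (x p) i - tnth (y p) i) * h p `^ (- d%:R^-1))); last first.
  by apply/funext => p /=; rewrite tnth_mktuple powRN.
apply: measurable_funM; last exact: (measurableT_comp (measurable_powR _)).
apply: measurable_funB.
  by apply: (measurableT_comp (measurable_tnth i) mx).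
by apply: (measurableT_comp (measurable_tnth i) my).
Qed.

End product_space.

(** The bandwidth and the point range over uncountable sets, but both are read off
    one branch of the Baire space, along which one can project. *)
Lemma exists_param_ae d0 (T : measurableType d0) (P : probability T R) (G : set (set T))
    d (A : T -> R -> euclid R d -> Prop) : G `<=` measurable ->
  measurable [set p : souslin_space G | A p.1 (bandwidth_param p.2) (point_param d p.2)] ->
  exists B, <<s G >> B /\ {ae P, forall t, (exists h x, A t h x) <-> B t}.
Proof.
move=> Gm mA.
have [sA _] := souslin_spaceP mA.
have [B [sB aeB]] := projection_ae P Gm sA.
exists B; split => //; apply: filterS aeB => t <-; split.
  by move=> [h [x]]; have [y [<- <-]] := param_surj h x => Ay; exists y.
by move=> [y Ay]; exists (bandwidth_param y), (point_param d y).
Qed.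

End real_parameters.

(** * The zero-one law *)

Section zero_one.
Context d d' (Om : measurableType d) (E : measurableType d') (R : realType).
Context (P : probability Om R) (X : nat -> {RV P >-> E}).
Hypotheses (X_indep : mutually_independent X) (X_idist : identically_distributed X).

Definition tail_index (m : nat) : set nat := [set i | (m <= i)%N].

(** Tail events are taken up to null sets, which is how projections of measurable
    sets are measurable. *)
Definition ae_tail m (D : set Om) :=
  exists A, sig_obs X (tail_index m) A /\ {ae P, forall w, D w <-> A w}.

Local Notation TG m :=
  (g_sigma_algebraType [set C | exists i A, [/\ tail_index m i, measurable A &
     C = X i @^-1` A] ]).

Lemma ae_tailC m D : ae_tail m D -> ae_tail m (~` D).
Proof.
move=> [A [sA aeA]]; exists (~` A); split; first exact: (@measurableC _ (TG m)).
by apply: filterS aeA => w [h1 h2]; split=> h3 h4; apply: h3; [exact: h2|exact: h1].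
Qed.

Lemma ae_tail_bigcap m (D : nat -> set Om) : (forall n, ae_tail m (D n)) ->
  ae_tail m (\bigcap_n D n).
Proof.
move=> h; pose A n := sval (cid (h n)).
have AP n : sig_obs X (tail_index m) (A n) /\ {ae P, forall w, D n w <-> A n w}.
  by rewrite /A; case: cid.
exists (\bigcap_n A n); split.
  by apply: (@bigcapT_measurable _ (TG m)) => n; have [] := AP n.
have := ae_foralln (fun n => (AP n).2); apply: filterS => w hw.
by split=> h1 n _; [apply/(hw n)|apply/(hw n)]; exact: h1.
Qed.

Lemma ae_tail_bigcup m (D : nat -> set Om) : (forall n, ae_tail m (D n)) ->
  ae_tail m (\bigcup_n D n).
Proof.
move=> h; rewrite -[X in ae_tail m X]setCK setC_bigcup; apply: ae_tailC.
by apply: ae_tail_bigcap => n; exact: ae_tailC.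
Qed.

Lemma ae_tail_cst m (b : Prop) : ae_tail m (fun=> b).
Proof.
have [hb|nb] := pselect b.
  by exists setT; split; [exact: (@measurableT _ (TG m))|exact: aeW].
by exists set0; split; [exact: (@measurable0 _ (TG m))|exact: aeW].
Qed.

Lemma ae_eq_pr A B : measurable A -> measurable B ->
  {ae P, forall w, A w <-> B w} -> pr P A = pr P B.
Proof.
move=> mA mB [N [mN N0 sN]].
have half (A' B' : set Om) : measurable A' -> measurable B' ->
    (forall w, ~ N w -> A' w -> B' w) -> pr P A' <= pr P B'.
  move=> mA' mB' h; apply: (@le_trans _ _ (pr P (B' `|` N))).
    apply: pr_sub => //; first exact: measurableU.
    by move=> w A'w; have [Nw|nN] := pselect (N w); [right|left; exact: h].
  apply: (le_trans (pr_setU P mB' mN)).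
  by rewrite [X in _ + X](_ : _ = 0) ?addr0// /pr N0.
have h w : ~ N w -> (A w <-> B w).
  by move=> nN; apply: contrapT => nAB; apply: nN; exact: sN.
by apply/eqP; rewrite eq_le !half// => w /h [].
Qed.

(** Kolmogorov's zero-one law, up to null sets: such an event is independent of
    every finite block of observations, hence of itself. *)
Lemma zero_one_law D : (forall m, ae_tail m D) ->
  {ae P, forall w, D w} \/ {ae P, forall w, ~ D w}.
Proof.
move=> tD; have [A [sA aeA]] := tD 0%N.
have mA : measurable A by exact: sig_obs_measurable sA.
pose G := [set B | exists m, sig_obs X `I_m B].
have Gm : G `<=` measurable by move=> B [m]; exact: sig_obs_measurable.
have GI : setI_closed G.
  move=> B B' [m sB] [m' sB']; exists (maxn m m').
  apply: (@measurableI _ (g_sigma_algebraType _)).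
    by apply: sig_obsS sB => i /= im; rewrite leq_max im.
  by apply: sig_obsS sB' => i /= im; rewrite leq_max im orbT.
have GT : G setT by exists 0%N; exact: (@measurableT _ (g_sigma_algebraType _)).
have prod B : G B -> pr P (B `&` A) = pr P B * pr P A.
  move=> [m sB]; have [Am [sAm aeAm]] := tD m.
  have mB : measurable B by exact: sig_obs_measurable sB.
  have mAm : measurable Am by exact: sig_obs_measurable sAm.
  have AAm : {ae P, forall w, A w <-> Am w}.
    by apply: filterS2 aeA aeAm => w h1 h2; rewrite -h1.
  rewrite (ae_eq_pr mA mAm AAm) -(sig_obs_indep X_indep X_idist _ sB sAm); last first.
    by apply/seteqP; split=> // i [/= im]; rewrite /tail_index /= leqNgt im.
  apply: ae_eq_pr; [exact: measurableI|exact: measurableI|].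
  by apply: filterS AAm => w h; split=> -[? ?]; split=> //; apply/h.
have sGA : <<s G >> A.
  apply: (smallest_sub (smallest_sigma_algebra _ _) _ sA) => _ [i [B [_ mB ->]]].
  by apply: sub_sigma_algebra; exists i.+1; apply: sig_obs_RV => //=.
have h2 : pr P (A `&` A) = pr P A * pr P A := product_rule_generated Gm GI GT mA prod sGA.
have : pr P A * (1 - pr P A) = 0 by rewrite mulrBr mulr1 -h2 setIid subrr.
move=> /eqP; rewrite mulf_eq0 => /orP[|] /eqP A0.
  right; have nA : {ae P, forall w, ~ A w}.
    by exists A; split => //; [rewrite prE// A0|move=> w /= /contrapT].
  by apply: filterS2 aeA nA => w h1 h3 /h1.
left; have nA : {ae P, forall w, A w}.
  exists (~` A); split => //; first exact: measurableC.
  by rewrite prE ?pr_setC ?A0//; exact: measurableC.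
by apply: filterS2 aeA nA => w h1 h3; apply/h1.
Qed.

End zero_one.

Lemma limn_esup_leP (R : realType) (u : nat -> \bar R) (q : R) :
  (limn_esup u <= q%:E)%E <->
  forall l : nat, exists n0, forall n, (n0 <= n)%N -> (u n <= (q + l.+1%:R^-1)%:E)%E.
Proof.
split=> [h l|h].
  have l0 : 0 < l.+1%:R^-1 :> R by rewrite invr_gt0.
  have : (limn_esup u < (q + l.+1%:R^-1)%:E)%E.
    by apply: (le_lt_trans h); rewrite lte_fin ltrDl.
  move=> /ereal_inf_lt[_ [V [n0 _ nV] <-]] hV; exists n0 => n nn.
  apply: ltW; apply: le_lt_trans hV; apply: ereal_sup_ubound.
  by exists n => //; exact: nV.
apply/lee_addgt0Pr => e e0.
have ei : 0 <= e^-1 by rewrite invr_ge0 ltW.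
pose l := Num.truncn e^-1; have /andP[_ h1] := truncn_itv ei.
have [n0 hn] := h l.
apply: (@le_trans _ _ (q + l.+1%:R^-1)%:E); last first.
  rewrite -EFinD lee_fin lerD2l -[leRHS]invrK lef_pV2 ?posrE ?invr_gt0//.
  exact: ltW.
apply: ge_ereal_inf; exists (ereal_sup [set u n | n in [set n | (n0 <= n)%N] ]).
  by exists [set n | (n0 <= n)%N] => //; exists n0.
by apply: ge_ereal_sup => _ [n nn <-]; exact: hn.
Qed.

(** * The limit superior is almost surely constant *)

Definition rate (R : realType) (n : nat) (h : R) : R :=
  Num.sqrt (n%:R * h * Num.max (ln h^-1) (ln (ln n%:R))).

Lemma measurable_sum_from (R : realType) d (S : measurableType d) (F : nat -> S -> R) m n :
  (forall i, (m <= i)%N -> measurable_fun setT (F i)) ->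
  measurable_fun setT (fun p => \sum_(i < n | (m <= i)%N) F i p).
Proof.
move=> mF; under eq_fun do rewrite big_mkcond; apply: measurable_sum => i.
by case: (m <= i)%N (mF i) => mFi; [exact: mFi|exact: measurable_cst].
Qed.

Section joint_measurability.
Context (R : realType) (d : nat) (Q : probability (euclid R d) R).
Context (K : euclid R d -> R) (kap : R).
Hypotheses (K_meas : measurable_fun setT K) (K_le : forall y, `|K y| <= kap).
Context d' (S : measurableType d') (x : S -> euclid R d) (h : S -> R).
Hypotheses (mx : measurable_fun setT x) (mh : measurable_fun setT h).

(** Tonelli's theorem for the nonnegative function [K + kap]. *)
Lemma measurable_kernel_mean :
  measurable_fun setT (fun p => \int[Q]_y K (rescale (h p) (x p) y)).
Proof.
pose F (p : S * euclid R d) : \bar R := (K (rescale (h p.1) (x p.1) p.2) + kap)%:E.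
have F0 p : (0 <= F p)%E.
  have := K_le (rescale (h p.1) (x p.1) p.2); rewrite ler_norml => /andP[h1 _].
  by rewrite lee_fin -(opprK kap) subr_ge0.
have mF : measurable_fun setT F.
  apply/measurable_EFinP; apply: measurable_funD; last exact: measurable_cst.
  apply: (measurableT_comp K_meas); apply: measurable_rescale.
  - exact: (measurableT_comp mx measurable_fst).
  - exact: measurable_snd.
  - exact: (measurableT_comp mh measurable_fst).
have mI := @measurable_fun_fubini_tonelli_F _ _ _ _ R Q F mF F0.
have bK p : bmf (fun y => K (rescale (h p) (x p) y)).
  by split; [exact: measurable_rescaled|exists kap].
rewrite (_ : (fun p => _) = (fun p => fine (fubini_F Q F p) - kap)).
  apply: measurable_funB; last exact: measurable_cst.
  exact: (measurableT_comp (fine_measurable _) mI).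
apply/funext => p; rewrite -[fine _]/(\int[Q]_y (K (rescale (h p) (x p) y) + kap)).
rewrite RintegralD//; last 2 first.
- by apply: (@bmf_integrable _ _ _ Q); exact: bK.
- by apply: (@bmf_integrable _ _ _ Q); exact: bmf_cst.
by rewrite Rintegral_cst1 addrK.
Qed.

Lemma measurable_rate n : measurable_fun setT (fun p => rate n (h p)).
Proof.
rewrite /rate.
have lnV' (r : R) : ln r^-1 = - ln r.
  have [r0|r0] := ltP 0 r; first by rewrite lnV.
  by rewrite !ln0// ?oppr0// invr_le0.
apply: (measurableT_comp (continuous_measurable_fun (@sqrt_continuous R))).
apply: measurable_funM.
  by apply: measurable_funM; [exact: measurable_cst|exact: mh].
apply: (@measurable_maxr _ _ _ _ (fun p => ln (h p)^-1) (cst (ln (ln n%:R)))).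
  under eq_fun do rewrite lnV'.
  by apply: measurableT_comp => //; exact: (measurableT_comp (@measurable_ln R)).
exact: measurable_cst.
Qed.

End joint_measurability.

Section level_events.
Context (R : realType) (d : nat) (disp : measure_display).
Context (Om : measurableType disp) (P : probability Om R).
Context (X : nat -> {RV P >-> euclid R d}) (K : euclid R d -> R) (kap c : R).
Hypotheses (X_idist : identically_distributed X).
Hypotheses (K_meas : measurable_fun setT K) (kap_gt0 : 0 < kap).
Hypotheses (K_le : forall y, `|K y| <= kap) (c_gt0 : 0 < c).

Local Notation Q := (distribution P (X 0%N)).

Definition centred_sum m n h x w : R :=
  \sum_(i < n | (m <= i)%N) (K (rescale h x (X i w)) - \int[Q]_y K (rescale h x y)).

(** The event that the limit superior, computed with the observations of index
    at least [m] only, is at most [q]. *)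
Definition level_event m q : set Om := [set w | forall l : nat, exists n0, forall n,
  (n0 <= n)%N -> forall h x, c * ln n%:R / n%:R <= h <= 1 ->
  `|centred_sum m n h x w| <= (q + l.+1%:R^-1) * rate n h].

Lemma ae_tail_exceed m n r : ae_tail X m [set w | exists h x,
  c * ln n%:R / n%:R <= h <= 1 /\ r * rate n h < `|centred_sum m n h x w|].
Proof.
pose G := [set C | exists i A, [/\ tail_index m i, measurable A & C = X i @^-1` A] ].
have GM : G `<=` measurable.
  by move=> _ [i [A [_ mA ->]]]; rewrite -[X in measurable X]setTI; exact: measurable_funP.
apply: (exists_param_ae P GM).
have mh := @measurable_bandwidth_param R Om G.
have mx := @measurable_point_param R Om G d.
have mX i : (m <= i)%N -> measurable_fun [set: souslin_space G] (fun p : souslin_space G => X i p.1).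
  by move=> mi; apply: measurable_base => A mA; exact: (@sig_obs_RV _ _ _ _ _ _ X (tail_index m)).
rewrite (_ : [set p | _] =
  [set p : souslin_space G | c * ln n%:R / n%:R <= bandwidth_param R p.2] `&`
  [set p : souslin_space G | bandwidth_param R p.2 <= 1] `&`
  [set p : souslin_space G | 0 < `|centred_sum m n (bandwidth_param R p.2) (point_param R d p.2) p.1|
     - r * rate n (bandwidth_param R p.2)]); last first.
  apply/seteqP; split=> p /=; first by move=> [/andP[-> ->]]; rewrite subr_gt0.
  by move=> [[-> ->]]; rewrite subr_gt0.
apply: measurableI; first apply: measurableI.
- rewrite (_ : [set p | _] = [set p | - bandwidth_param R p.2 <= - (c * ln n%:R / n%:R)]).
    by apply: measurable_le_set; exact: measurableT_comp mh.
  by apply/seteqP; split=> p /=; rewrite lerN2.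
- exact: measurable_le_set.
- apply: measurable_gt_set; apply: measurable_funB.
    apply: measurableT_comp => //; rewrite /centred_sum.
    apply: (measurable_sum_from n (F := fun i (p : souslin_space G) =>
      K (rescale (bandwidth_param R p.2) (point_param R d p.2) (X i p.1)) -
      \int[Q]_y K (rescale (bandwidth_param R p.2) (point_param R d p.2) y))) => i mi; apply: measurable_funB; last exact: measurable_kernel_mean.
    by apply: (measurableT_comp K_meas); apply: measurable_rescale => //; exact: mX.
  by apply: measurable_funM; [exact: measurable_cst|exact: measurable_rate].
Qed.

(** Quantifiers over integers are countable operations; the two over the bandwidth and
    the point are a projection. *)
Lemma ae_tail_level_event m q : ae_tail X m (level_event m q).
Proof.
rewrite (_ : level_event m q = \bigcap_l \bigcup_n0 \bigcap_n
    (~` [set w | (n0 <= n)%N] `|` ~` [set w | exists h x,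
      c * ln n%:R / n%:R <= h <= 1 /\
      (q + l.+1%:R^-1) * rate n h < `|centred_sum m n h x w|])).
  apply: ae_tail_bigcap => l; apply: ae_tail_bigcup => n0; apply: ae_tail_bigcap => n.
  have [nn|nn] := boolP (n0 <= n)%N.
    rewrite (_ : ~` [set w | is_true true] = set0) ?set0U; last first.
      by apply/seteqP; split=> // w /= /(_ isT).
    exact/ae_tailC/ae_tail_exceed.
  rewrite (_ : _ `|` _ = fun=> True); first exact: ae_tail_cst.
  by apply/seteqP; split=> // w _; left.
apply/seteqP; split=> w.
  move=> hw l _; have [n0 hn] := hw l; exists n0 => // n _.
  have [nn|nn] := boolP (n0 <= n)%N; [right|by left].
  by move=> [h [x [hr]]]; rewrite ltNge (hn n nn h x hr).
move=> hw l; have [n0 _ hn] := hw l I; exists n0 => n nn h x hr.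
have [/(_ nn)//|nh] := hn n I.
by rewrite leNgt; apply/negP => h1; apply: nh; exists h, x.
Qed.

(** The lower bound on the bandwidth makes [n * h] of order [ln n] at least. *)
Lemma rate_unbounded B : exists n0, forall n, (n0 <= n)%N ->
  forall h, c * ln n%:R / n%:R <= h <= 1 -> B <= rate n h.
Proof.
pose v := Num.max (B ^+ 2 / c) (expR 1).
exists (Num.truncn (expR v)).+1 => n nn h /andP[hl _].
have nv : expR v < n%:R.
  have /andP[_] := truncn_itv (ltW (expR_gt0 v)).
  by move=> h1; apply: (lt_le_trans h1); rewrite ler_nat.
have n_gt0 : 0 < n%:R :> R := lt_trans (expR_gt0 v) nv.
have lnv : v <= ln n%:R by rewrite -[leLHS]expRK ler_ln ?posrE ?expR_gt0// ltW.
have L1 : 1 <= Num.max (ln h^-1) (ln (ln n%:R)).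
  rewrite le_max; apply/orP; right; rewrite -[leLHS]expRK ler_ln ?posrE ?expR_gt0//.
    by apply: le_trans lnv; rewrite le_max lexx orbT.
  by apply: (lt_le_trans _ lnv); rewrite lt_max expR_gt0 orbT.
have nh : B ^+ 2 <= n%:R * h.
  apply: (@le_trans _ _ (c * ln n%:R)); last by rewrite [leRHS]mulrC -ler_pdivrMr.
  by rewrite [leRHS]mulrC -ler_pdivrMr// (le_trans _ lnv)// le_max lexx.
apply: (le_trans (ler_norm B)); rewrite -sqrtr_sqr /rate; apply: ler_wsqrtr.
by rewrite -[leLHS]mulr1; apply: ler_pM => //; rewrite ?sqr_ge0.
Qed.

Lemma centred_sum_shift m n h x w :
  `|centred_sum m n h x w - centred_sum 0 n h x w| <= 2 * kap * m%:R.
Proof.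
pose g y := K (rescale h x y); pose t i := g (X i w) - \int[Q]_y g y.
have bg : bmf g by split; [exact: measurable_rescaled|exists kap => y; exact: K_le].
have t2 i : `|t i| <= 2 * kap.
  apply: (le_trans (ler_normB _ _)); rewrite mulr_natl mulr2n; apply: lerD; first exact: K_le.
  have ig := bmf_integrable Q bg.
  apply: (le_trans (le_normr_Rintegral measurableT ig)).
  rewrite -[leRHS](Rintegral_cst1 Q kap); apply: le_Rintegral => //.
  - by apply: (@bmf_integrable _ _ _ Q (fun y => `|g y|)); split;
      [exact: (measurableT_comp _ bg.1)|exists kap => y; rewrite normr_id; exact: K_le].
  - by apply: (@bmf_integrable _ _ _ Q); exact: bmf_cst.
  - by move=> y _; exact: K_le.
rewrite distrC /centred_sum.
have -> : \sum_(i < n | (0 <= i)%N) t i = \sum_(i < n | (m <= i)%N) t i + \sum_(i < n | (i < m)%N) t i.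
  rewrite (bigID (fun i : 'I_n => (m <= i)%N))/=; congr (_ + _).
  by apply: eq_bigl => i; rewrite -ltnNge.
rewrite addrAC subrr add0r; apply: (le_trans (ler_norm_sum _ _ _)).
apply: (@le_trans _ _ (\sum_(i < n | (i < m)%N) (2 * kap))).
  by apply: ler_sum => i _; exact: t2.
rewrite sumr_const -[leLHS]mulr_natr; apply: ler_wpM2l; first by rewrite mulr_ge0// ltW.
rewrite ler_nat; have [nm|mn] := leqP n m.
  by apply: leq_trans nm; rewrite -[leqRHS](card_ord n); exact: max_card.
by rewrite -sum1_card (big_ord_narrow (ltnW mn)) sum1_card card_ord.
Qed.

(** Finitely many observations do not affect the event, since the rate tends to
    infinity uniformly over the bandwidths. *)
Lemma level_event_shift m q : level_event m q = level_event 0 q.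
Proof.
have slack (a b : nat -> R -> euclid R d -> Om -> R) w :
    (forall n h x, `|a n h x w - b n h x w| <= 2 * kap * m%:R) ->
    (forall l : nat, exists n0, forall n, (n0 <= n)%N -> forall h x,
      c * ln n%:R / n%:R <= h <= 1 -> `|a n h x w| <= (q + l.+1%:R^-1) * rate n h) ->
    (forall l : nat, exists n0, forall n, (n0 <= n)%N -> forall h x,
      c * ln n%:R / n%:R <= h <= 1 -> `|b n h x w| <= (q + l.+1%:R^-1) * rate n h).
  move=> ab ha l; have [n1 hn1] := ha (l.*2.+1).
  have [n2 hn2] := rate_unbounded (2 * kap * m%:R * 2 * l.+1%:R).
  exists (maxn n1 n2) => n; rewrite geq_max => /andP[/hn1 h1 /hn2 h2] h x hr.
  have {}h1 := h1 h x hr; have {}h2 := h2 h hr.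
  have -> : b n h x w = a n h x w - (a n h x w - b n h x w) by ring.
  apply: (le_trans (ler_normB _ _)); have := ab n h x; move: kap_gt0 => k0.
  move: h1; have -> : l.*2.+2%:R^-1 = l.+1%:R^-1 / 2 :> R.
    by rewrite -doubleS -muln2 natrM invfM.
  have : 2 * kap * m%:R <= l.+1%:R^-1 / 2 * rate n h.
    have -> : 2 * kap * m%:R = l.+1%:R^-1 / 2 * (2 * kap * m%:R * 2 * l.+1%:R).
      have : l.+1%:R != 0 :> R by rewrite pnatr_eq0.
      by move: (l.+1%:R) => r r0; field.
    by apply: ler_wpM2l => //; rewrite mulr_ge0 ?invr_ge0.
  move=> r1 r2 r3; have : l.+1%:R^-1 = l.+1%:R^-1 / 2 + l.+1%:R^-1 / 2 :> R.
    exact: splitr.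
  move=> ->; rewrite addrA (mulrDl _ _ (rate n h)); apply: lerD => //.
  exact: le_trans r3 r1.
apply/seteqP; split=> w; apply: slack => n h x.
  exact: centred_sum_shift.
by rewrite distrC; exact: centred_sum_shift.
Qed.

Lemma level_event_zero_one q : mutually_independent X ->
  {ae P, forall w, level_event 0 q w} \/ {ae P, forall w, ~ level_event 0 q w}.
Proof.
move=> X_indep; apply: (zero_one_law X_indep X_idist) => m.
by rewrite -(level_event_shift m); exact: ae_tail_level_event.
Qed.

End level_events.

Section deviation_bound.
Context (R : realType) (d : nat) (disp : measure_display).
Context (Om : measurableType disp) (P : probability Om R).
Context (X : nat -> {RV P >-> euclid R d}) (K : euclid R d -> R) (kap c : R).
Hypotheses (X_idist : identically_distributed X).
Hypotheses (K_meas : measurable_fun setT K) (K_le : forall y, `|K y| <= kap).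
Hypothesis c_gt0 : 0 < c.

Lemma kde_centred n h x w :
  ((kde_rv X K n h x w)%:E - 'E_P[kde_rv X K n h x])%E =
  ((n%:R * h)^-1 * centred_sum X K 0 n h x w)%:E.
Proof.
pose g y := K (rescale h x y).
have bg : bmf g by split; [exact: measurable_rescaled|exists kap => y; exact: K_le].
have bX i : bmf (fun w => g (X i w)) by exact: (bmf_obs X i bg).
have bS : bmf (fun w => \sum_(i < n) g (X i w)) by exact: (bmf_sum n (f := fun i w => g (X i w))).
have bk : bmf (kde_rv X K n h x) by apply: (bmfM (bmf_cst _ _) bS).
have -> : ('E_P[kde_rv X K n h x])%E = (\int[P]_w kde_rv X K n h x w)%:E.
  rewrite unlock /Rintegral fineK//.
  exact: (integrable_fin_num measurableT (bmf_integrable P bk)).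
rewrite -EFinB; congr EFin; rewrite {2}/kde_rv /kde RintegralZl//; last exact: bmf_integrable.
rewrite -[kde_rv _ _ _ _ _ _]/(_^-1 * _) -mulrBr; congr (_ * _).
rewrite (@Rintegral_sum _ _ _ P n (fun i w => g (X i w)))// -sumrB.
by apply: eq_bigr => i _; rewrite (Rintegral_obs X_idist i bg).
Qed.

Lemma sup_deviation_le n r w : 1 < ln n%:R :> R ->
  (sup_deviation X K c n w <= r%:E)%E <-> forall h x,
    c * ln n%:R / n%:R <= h <= 1 -> `|centred_sum X K 0 n h x w| <= r * rate n h.
Proof.
move=> ln1.
have n0 : 0 < n%:R :> R.
  by rewrite ltNge; apply/negP => n0; move: ln1; rewrite ln0// ltr10.
have L0 (h : R) : 0 < Num.max (ln h^-1) (ln (ln n%:R)) :> R.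
  by rewrite lt_max (ln_gt0 ln1) orbT.
have key h : c * ln n%:R / n%:R <= h <= 1 ->
    (normalized_deviation X K n h w <= r%:E)%E <->
    forall x, `|centred_sum X K 0 n h x w| <= r * rate n h.
  move=> /andP[h1 _].
  have h0 : 0 < h.
    by apply: lt_le_trans h1; rewrite divr_gt0// mulr_gt0// (lt_trans _ ln1).
  have nh0 : 0 < n%:R * h by rewrite mulr_gt0.
  pose a := Num.sqrt (n%:R * h); pose b := Num.sqrt (Num.max (ln h^-1) (ln (ln n%:R))).
  have a0 : 0 < a by rewrite sqrtr_gt0.
  have b0 : 0 < b by rewrite sqrtr_gt0.
  have ab : rate n h = a * b by rewrite /rate sqrtrM// ltW.
  have aa : n%:R * h = a * a by rewrite -expr2 sqr_sqrtr// ltW.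
  (* The normalization by [sqrt (n h)] of a mean divided by [n h] and the rate
   [sqrt (n h) * b] of the sum differ by the factor [n h] only. *)
  rewrite /normalized_deviation -/a -/b lee_pdivrMr// -{1}[a]invrK lee_pdivrMl ?invr_gt0//.
  split=> [H x|H].
    have : (`|((kde_rv X K n h x w)%:E - 'E_P[kde_rv X K n h x])%E| <= (a^-1)%:E * (r%:E * b%:E))%E.
      by apply: le_trans H; apply: ereal_sup_ubound; exists x.
    rewrite kde_centred/= lee_fin normrM ger0_norm ?invr_ge0 ?(ltW nh0)//.
    rewrite ler_pdivrMl// => /le_trans; apply; rewrite ab aa.
    by rewrite le_eqVlt; apply/orP; left; apply/eqP; field; exact: lt0r_neq0.
  apply: ge_ereal_sup => _ [x _ <-].
  rewrite kde_centred/= lee_fin normrM ger0_norm ?invr_ge0 ?(ltW nh0)//.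
  rewrite ler_pdivrMl//; apply: (le_trans (H x)); rewrite ab aa.
  by rewrite le_eqVlt; apply/orP; left; apply/eqP; field; exact: lt0r_neq0.
split=> [H h x hr|H].
  by apply: (key h hr).1; apply: le_trans H; apply: ereal_sup_ubound; exists h.
by apply: ge_ereal_sup => _ [h hr <-]; apply/(key h hr) => x; exact: H.
Qed.

Lemma limn_esup_sup_deviation_le q w :
  (limn_esup (fun n => sup_deviation X K c n w) <= q%:E)%E <->
  level_event X K c 0 q w.
Proof.
pose n1 := (Num.truncn (expR 1 : R)).+1.
have ln1 n : (n1 <= n)%N -> 1 < ln n%:R :> R.
  move=> nn; have n_gt : expR 1 < n%:R :> R.
    have /andP[_ h1] := truncn_itv (ltW (expR_gt0 (1 : R))).
    by apply: (lt_le_trans h1); rewrite ler_nat.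
  by rewrite -[ltLHS]expRK ltr_ln// posrE ?expR_gt0// (lt_trans _ n_gt)// expR_gt0.
rewrite limn_esup_leP; split=> H l; have [n0 hn] := H l;
  exists (maxn n0 n1) => n; rewrite geq_max => /andP[/hn h1 /ln1 h2].
  exact/(sup_deviation_le _ _ h2).
exact/(sup_deviation_le _ _ h2).
Qed.

End deviation_bound.

(** The logarithm of [n] is twice that of its square root. *)
Lemma ln_div_eventually_le1 (R : realType) (c : R) : 0 < c ->
  exists n0, forall n, (n0 <= n)%N -> c * ln n%:R / n%:R <= 1 :> R.
Proof.
move=> c0; exists (Num.truncn ((2 * c) ^+ 2)).+1 => n nn.
have n4 : (2 * c) ^+ 2 < n%:R.
  have /andP[_ h1] := truncn_itv (sqr_ge0 (2 * c)).
  by apply: (lt_le_trans h1); rewrite ler_nat.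
have n0 : 0 < n%:R :> R by apply: le_lt_trans n4; exact: sqr_ge0.
pose r := Num.sqrt (n%:R : R).
have rr : r ^+ 2 = n%:R by rewrite sqr_sqrtr// ltW.
have r0 : 0 < r by rewrite sqrtr_gt0.
have cr : 2 * c <= r.
  by rewrite -(ler_pXn2r (ltn0Sn 1)) ?nnegrE ?rr ?ltW// mulr_gt0.
have lr : ln r <= r.
  have := le_ln1Dx (x := r - 1); rewrite subrKC => h.
  by apply: (le_trans (h _)); rewrite ?gerBl// ltrBrDr addNr.
rewrite ler_pdivrMr// mul1r -rr lnXn// -mulr_natl mulrA (mulrC c) expr2.
by apply: le_trans (ler_wpM2l _ lr) _; [rewrite mulr_ge0// ltW|rewrite ler_wpM2r// ltW].
Qed.

Section limsup_constant.
Context (R : realType) (d : nat) (disp : measure_display).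
Context (Om : measurableType disp) (P : probability Om R).
Context (X : nat -> {RV P >-> euclid R d}) (K : euclid R d -> R) (kap c : R).
Hypotheses (X_indep : mutually_independent X) (X_idist : identically_distributed X).
Hypotheses (K_meas : measurable_fun setT K) (kap_gt0 : 0 < kap).
Hypotheses (K_le : forall y, `|K y| <= kap) (c_gt0 : 0 < c).

(** The bandwidth [1] is eventually admissible, with a positive rate. *)
Lemma level_event_neg q w : q < 0 -> ~ level_event X K c 0 q w.
Proof.
move=> q0 H; pose x0 : euclid R d := [tuple 0 | i < d].
have nq : 0 <= (- q)^-1 by rewrite invr_ge0 oppr_ge0 ltW.
pose l := Num.truncn (- q)^-1; have /andP[_ hl] := truncn_itv nq.
have ql : q + l.+1%:R^-1 < 0.
  by rewrite addrC -ltrBrDr sub0r -[ltRHS]invrK ltf_pV2 ?posrE// invr_gt0 oppr_gt0.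
have [n1 hn1] := H l; have [n2 hn2] := ln_div_eventually_le1 c_gt0.
have [n3 hn3] := rate_unbounded c_gt0 1.
pose n := maxn n1 (maxn n2 n3).
have /hn1 h1 : (n1 <= n)%N by rewrite leq_maxl.
have /hn2 h2 : (n2 <= n)%N by rewrite /n maxnCA leq_maxl.
have /hn3 h3 : (n3 <= n)%N by rewrite /n !leq_max leqnn !orbT.
have hr : c * ln n%:R / n%:R <= 1 <= (1 : R) by rewrite h2 lexx.
have := h1 1 x0 hr; rewrite leNgt => /negP; apply.
apply: lt_le_trans (normr_ge0 _); rewrite nmulr_rlt0//.
exact: lt_le_trans ltr01 (h3 1 hr).
Qed.

(** Every level is almost surely exceeded or almost surely not exceeded, so that
    the limit superior equals almost surely the least level not exceeded. *)
Lemma limn_esup_sup_deviation_cst : (exists A, {ae P, forall w, level_event X K c 0 A w}) ->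
  exists Kc : R, {ae P, forall w, limn_esup (fun n => sup_deviation X K c n w) = Kc%:E}.
Proof.
pose V := [set q | {ae P, forall w, level_event X K c 0 q w}].
move=> [A VA].
have V_ge0 : lbound V 0.
  move=> q Vq; rewrite leNgt; apply/negP => q0.
  have [w] : exists w, level_event X K c 0 q w.
    apply: contrapT => nex; have [N [mN N0 sN]] := Vq.
    have NT : N = setT.
      by apply/seteqP; split=> // w _; apply: sN => hw; apply: nex; exists w.
    move: N0; rewrite NT probability_setT => /eqP; rewrite onee_eq0//.
  exact: level_event_neg.
have hV : has_inf V by split; [exists A|exists 0].
exists (inf V).
have up l : {ae P, forall w, (limn_esup (fun n => sup_deviation X K c n w) <= (inf V + l.+1%:R^-1)%:E)%E}.
  have l0 : 0 < l.+1%:R^-1 :> R by rewrite invr_gt0.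
  have [q Vq qlt] := inf_adherent l0 hV.
  apply: filterS Vq => w.
  move/(limn_esup_sup_deviation_le X_idist K_meas K_le c_gt0) => hq.
  by apply: (le_trans hq); rewrite lee_fin ltW.
have dn l : {ae P, forall w, ~ (limn_esup (fun n => sup_deviation X K c n w) <= (inf V - l.+1%:R^-1)%:E)%E}.
  have l0 : 0 < l.+1%:R^-1 :> R by rewrite invr_gt0.
  have [Vq|] := level_event_zero_one X_idist K_meas kap_gt0 K_le c_gt0
     (inf V - l.+1%:R^-1) X_indep.
    by have := ge_inf hV.2 Vq; rewrite leNgt ltrBlDr ltrDl l0.
  by apply: filterS => w; apply: contra_not =>
    /(limn_esup_sup_deviation_le X_idist K_meas K_le c_gt0).
apply: filterS2 (ae_foralln up) (ae_foralln dn) => w h1 h2.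
apply/eqP; rewrite eq_le; apply/andP; split.
  apply/lee_addgt0Pr => e e0.
  have /ltr_add_invr[l hl] : 0 < e by [].
  by apply: (le_trans (h1 l)); rewrite -EFinD lee_fin lerD2l ltW// -[ltLHS]add0r.
apply/lee_subgt0Pr => e e0; have /ltr_add_invr[l hl] : 0 < e by [].
have /negP := h2 l; rewrite -ltNge => /ltW; apply: le_trans.
by rewrite -EFinB lee_fin lerD2l lerN2 ltW// -[ltLHS]add0r.
Qed.

End limsup_constant.

Theorem theorem1 (R : realType) (d : nat) (disp : measure_display)
    (Omega : measurableType disp) (P : probability Omega R)
    (X : nat -> {RV P >-> euclid R d}) (f K : euclid R d -> R) (kappa : R)
    (d_ge1 : (1 <= d)%N)
    (X_indep : mutually_independent X)
    (X_idist : identically_distributed X)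
    (f_density : has_lebesgue_density (distribution P (X 0%N)) f)
    (f_bounded : exists M : R, forall x, `|f x| <= M)
    (K_measurable : measurable_fun setT K)
    (K_integrable : (@lebesgue_euclid R d).-integrable setT (EFin \o K))
    (K_i : (\int[@lebesgue_euclid R d]_x (K x)%:E = 1)%E)
    (K_ii : supnorm (EFin \o K) = kappa%:E)
    (K_iii : uniform_entropy_condition K kappa)
    (K_iv : pointwise_measurable_class (kernel_class K))
    (c : R) (c_gt0 : 0 < c) :
  exists Kc : R, {ae P, forall w : Omega,
    limn_esup (fun n : nat => sup_deviation X K c n w) = Kc%:E}.
Proof.
have K_le y : `|K y| <= kappa.
  by rewrite -lee_fin -K_ii; apply: ereal_sup_ubound; exists y.
have kappa_gt0 : 0 < kappa.
  rewrite lt_neqAle (le_trans (normr_ge0 _) (K_le [tuple 0 | i < d])) andbT.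
  apply/eqP => k0; move: K_i; rewrite integral0_eq.
    by move/esym/eqP; rewrite onee_eq0.
  by move=> y _; apply/eqP; rewrite eqe -normr_le0 k0 K_le.
have [M fM] := f_bounded.
apply: (limn_esup_sup_deviation_cst X_indep X_idist K_measurable kappa_gt0 K_le c_gt0).
have [A hA] := kernel_sum_bound d_ge1 X_indep X_idist f_density fM K_measurable
  K_integrable kappa_gt0 K_le K_iii K_iv c_gt0.
exists A; apply: filterS hA => w [n0 hn] l; exists n0 => n nn h x hr.
apply: (le_trans (hn n nn h x hr)).
by apply: ler_wpM2r; [exact: sqrtr_ge0|rewrite lerDl invr_ge0].
Qed.
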